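(* Let $(M,\mathcal{F})$ be a minimal compact lamination by hyperbolic surfaces. If no leaf of $\mathcal{F}$ is simply connected, then the horocycle flow on the unit tangent bundle $T^1\mathcal{F}$ is minimal, i.e. every orbit of the horocycle flow is dense in $T^1\mathcal{F}$.
   Context: A compact lamination by surfaces $(M,\mathcal{F})$ is a compact metrizable space $M$ with an open cover $\{U_\alpha\}$ and homeomorphisms $\varphi_\alpha:U_\alpha\to D\times T$, where $D$ is a disk in $\mathbb{R}^2$ and $T$ is a separable locally compact metrizable space (possibly depending on $\alpha$), such that the changes of coordinates have the form $\varphi_\alpha\circ\varphi_\beta^{-1}(x,t)=(\lambda^t_{\alpha\beta}(x),\tau_{\alpha\beta}(t))$ with $\lambda^t_{\alpha\beta}$ smooth and depending continuously on $t$ in the $C^\infty$ topology. The plaques $\varphi_\alpha^{-1}(D\times\{t\})$ glue together to form maximal connected surfaces called leaves. The lamination is minimal if all its leaves are dense in $M$. A hyperbolic surface is a quotient $S=\Gamma\backslash\mathbb{H}$ of the hyperbolic plane by a torsion-free discrete subgroup $\Gamma$ of $PSL(2,\mathbb{R})$ (so it is complete, oriented, of constant curvature $-1$). Its unit tangent bundle is identified with $\Gamma\backslash PSL(2,\mathbb{R})$. A (compact) lamination by hyperbolic surfaces is a compact lamination by surfaces whose leaves are endowed with Riemannian metrics, varying continuously in the $C^\infty$ topology from leaf to leaf, for which every leaf is a hyperbolic surface. The unit tangent bundle $T^1\mathcal{F}$ is the circle bundle over $M$ consisting of the unit vectors tangent to the leaves; it is a lamination whose leaves are the unit tangent bundles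 of the leaves of $\mathcal{F}$. There is a continuous right $PSL(2,\mathbb{R})$-action on $T^1\mathcal{F}$ which on the unit tangent bundle $\Gamma\backslash PSL(2,\mathbb{R})$ of each leaf is right translation. The horocycle flow $h_s$ on $T^1\mathcal{F}$ is the action of the one-parameter subgroup of matrices $\begin{pmatrix}1&s\\0&1\end{pmatrix}$, $s\in\mathbb{R}$. *)

(* Defs.v *)
From HB Require Import structures.
From mathcomp Require Import all_boot all_order all_algebra.
From mathcomp Require Import all_classical all_reals all_analysis.

Set Implicit Arguments.
Unset Strict Implicit.
Unset Printing Implicit Defensive.

Import Order.TTheory GRing.Theory Num.Theory.
Import numFieldNormedType.Exports.

Local Open Scope classical_set_scope.
Local Open Scope ring_scope.

Notation plane R := (R * R)%type.

Definition disk (R : realType) (c : plane R) (r : R) : set (plane R) :=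
  [set x | (x.1 - c.1) ^+ 2 + (x.2 - c.2) ^+ 2 < r ^+ 2].

Definition jac_det (R : realType) (l : plane R -> plane R) : R :=
  (l (1, 0)).1 * (l (0, 1)).2 - (l (0, 1)).1 * (l (1, 0)).2.

Definition iter_derive (R : realType) (W : normedModType R)
    (vs : seq (plane R)) (f : plane R -> W) : plane R -> W :=
  foldr (fun v g => fun x => 'D_v g x) f vs.

(* [Om] is meant to be open. Each [f^~ t] is smooth, and joint continuity of
   all the derivatives in (x, t) is the continuous dependence of [f^~ t] on t
   for the topology of locally uniform convergence of all derivatives. *)
Definition smooth_family (R : realType) (T : topologicalType)
    (W : normedModType R) (Om : set (plane R * T)) (f : plane R -> T -> W) :=
  forall (vs : seq (plane R)) (p : plane R * T), Om p ->
    (forall v, derivable (iter_derive vs (f^~ p.2)) p.1 v) /\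
    {for p, continuous (fun q : plane R * T => iter_derive vs (f^~ q.2) q.1)}.

Definition smooth_on (R : realType) (W : normedModType R)
    (Om : set (plane R)) (f : plane R -> W) :=
  forall (vs : seq (plane R)) (x : plane R), Om x ->
    (forall v, derivable (iter_derive vs f) x v) /\
    {for x, continuous (iter_derive vs f)}.

Definition path_connected (X : topologicalType) (R : realType) (A : set X) :=
  forall x y, A x -> A y -> exists c : R -> X,
    [/\ {within `[0, 1], continuous c}, c @` `[0, 1] `<=` A, c 0 = x & c 1 = y].

Definition simply_connected (X : topologicalType) (R : realType)
    (A : set X) :=
  path_connected R A /\
  forall c : R -> X, {within `[0, 1], continuous c} ->
    c @` `[0, 1] `<=` A -> c 0 = c 1 ->
    exists H : R * R -> X,
      [/\ {within `[0, 1] `*` `[0, 1], continuous H},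
          H @` (`[0, 1] `*` `[0, 1]) `<=` A,
          forall s, s \in `[0, 1] -> H (s, 0) = c s /\ H (s, 1) = c 0 &
          forall t, t \in `[0, 1] -> H (0, t) = c 0 /\ H (1, t) = c 0].

(* [chart a] and [param a] are total functions, meaningful on [dom a] and on
   [disk (disk_center a) (disk_radius a) `*` setT] respectively. *)
Record lamination (R : realType) (M : topologicalType) := Lamination {
  idx : Type;
  transv : idx -> metricType R;
  transv_separable : forall a,
    exists S : set (transv a), countable S /\ dense S;
  transv_locally_compact : forall a, locally_compact [set: transv a];
  disk_center : idx -> plane R;
  disk_radius : idx -> R;
  disk_radius_gt0 : forall a, 0 < disk_radius a;
  dom : idx -> set M;
  chart : forall a, M -> plane R * transv a;
  param : forall a, plane R * transv a -> M;
  dom_open : forall a, open (dom a);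
  dom_cover : forall x, exists a, dom a x;
  chart_disk : forall a x, dom a x ->
    disk (disk_center a) (disk_radius a) (chart a x).1;
  param_dom : forall a (p : plane R * transv a),
    disk (disk_center a) (disk_radius a) p.1 -> dom a (param p);
  chartK : forall a x, dom a x -> param (chart a x) = x;
  paramK : forall a (p : plane R * transv a),
    disk (disk_center a) (disk_radius a) p.1 -> chart a (param p) = p;
  chart_continuous : forall a x, dom a x -> {for x, continuous (chart a)};
  param_continuous : forall a (p : plane R * transv a),
    disk (disk_center a) (disk_radius a) p.1 ->
    {for p, continuous (@param a)};
  change_transverse : forall a b, exists tau : transv b -> transv a,
    forall p : plane R * transv b,
      disk (disk_center b) (disk_radius b) p.1 -> dom a (param p) ->
      (chart a (param p)).2 = tau p.2;
  change_smooth : forall a b,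
    smooth_family
      [set p | disk (disk_center b) (disk_radius b) p.1 /\ dom a (@param b p)]
      (fun x t => (chart a (@param b (x, t))).1)
}.
Arguments chart {R M l} a.
Arguments param {R M l} a.
Arguments dom {R M l} a.
Arguments disk_center {R M l} a.
Arguments disk_radius {R M l} a.

(* The set M with the finer topology for which the plaques are open surfaces;
   its connected components are the leaves. *)
Definition leaf_space (R : realType) (M : topologicalType)
  (F : lamination R M) : Type := M.

Section LeafTopology.
Context (R : realType) (M : topologicalType) (F : lamination R M).
Local Notation leaf_space := (leaf_space F).

Definition chart_disk_of (a : idx F) := disk (disk_center a) (disk_radius a).

Definition overlap (a b : idx F) : set (plane R * transv b) :=
  [set p | chart_disk_of b p.1 /\ dom a (param b p)].

Definition dchange (a b : idx F) (p : plane R * transv b) :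
    plane R -> plane R :=
  'd (fun x => (chart a (param b (x, p.2))).1) (p.1).

HB.instance Definition _ := Choice.copy leaf_space M.

Definition leaf_open : set_system leaf_space :=
  [set O | forall (a : idx F) (t : transv a),
     open [set x : plane R | chart_disk_of a x /\ O (param a (x, t))]].

Lemma disk_open (c : plane R) r : open (disk c r).
Proof.
rewrite (_ : disk c r = (fun x : plane R =>
  (x.1 - c.1) * (x.1 - c.1) + (x.2 - c.2) * (x.2 - c.2)) @^-1`
  [set y | y < r ^+ 2]); last by apply/seteqP; split => x.
apply: open_comp; last exact: open_lt.
move=> x _.
by apply: cvgD; apply: cvgM; apply: cvgB;
  solve [exact: cvg_fst | exact: cvg_snd | exact: cvg_cst].
Qed.

Lemma leaf_openT : leaf_open setT.
Proof.
move=> a t; rewrite (_ : [set x | _] = chart_disk_of a); first exact: disk_open.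
by apply/seteqP; split => x // [].
Qed.

Lemma leaf_openI : setI_closed leaf_open.
Proof.
move=> A B oA oB a t.
have := openI (oA a t) (oB a t); congr open.
by apply/seteqP; split => x /=; [move=> [[? ?] [? ?]] | move=> [? [? ?]]].
Qed.

Lemma leaf_open_bigU (I : Type) (f : I -> set leaf_space) :
  (forall i, leaf_open (f i)) -> leaf_open (\bigcup_i f i).
Proof.
move=> of_ a t.
rewrite (_ : [set x | _] = \bigcup_i
  [set x : plane R | chart_disk_of a x /\ f i (param a (x, t))]).
  by apply: bigcup_open => i _; exact: of_.
apply/seteqP; split => x /=.
  by move=> [dx [i _ fi]]; exists i.
by move=> [i _ [dx fi]]; split => //; exists i.
Qed.

HB.instance Definition _ := isOpenTopological.Build leaf_space
  leaf_openT leaf_openI leaf_open_bigU.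

Definition leaf (x : M) : set leaf_space :=
  connected_component [set: leaf_space] x.

Definition minimal_lamination := forall x : M, @dense M (leaf x).

Record leaf_metric := LeafMetric {
  metric : forall a : idx F, plane R * transv a -> plane R -> plane R -> R;
  metric_linear : forall (a : idx F) (p : plane R * transv a),
    chart_disk_of a p.1 ->
    forall k u v w,
      metric p (k *: u + v) w = k * metric p u w + metric p v w;
  metric_sym : forall (a : idx F) (p : plane R * transv a),
    chart_disk_of a p.1 ->
    forall u v, metric p u v = metric p v u;
  metric_gt0 : forall (a : idx F) (p : plane R * transv a),
    chart_disk_of a p.1 ->
    forall u, u != 0 -> 0 < metric p u u;
  metric_smooth : forall (a : idx F) u v,
    smooth_family [set p : plane R * transv a | chart_disk_of a p.1]
      (fun x t => metric (x, t) u v);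
  metric_change : forall (a b : idx F) (p : plane R * transv b),
    overlap a p -> forall u v,
    metric (chart a (param b p)) (dchange a p u) (dchange a p v)
      = metric p u v
}.

(* [orient t] tells whether the chart is positively oriented on the plaque of
   t; continuity makes the orientations of neighbouring leaves agree. *)
Record leaf_orientation := LeafOrientation {
  orient : forall a : idx F, transv a -> bool;
  orient_continuous : forall a : idx F, continuous (@orient a);
  orient_change : forall (a b : idx F) (p : plane R * transv b), overlap a p ->
    (0 < jac_det (dchange a p))
      = (orient (chart a (param b p)).2 == orient p.2)
}.

End LeafTopology.
Arguments leaf {R M} F x.
Arguments metric {R M F} l {a}.
Arguments orient {R M F} l {a}.

Definition upper_half_plane (R : realType) : set (plane R) := [set z | 0 < z.2].

(* Real and imaginary parts of (a z + b) / (c z + d), for \det A = 1. *)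
Definition moebius (R : realType) (A : 'M[R]_2) (z : plane R) : plane R :=
  let a := A 0 0 in let b := A 0 1 in let c := A 1 0 in let d := A 1 1 in
  let q := (c * z.1 + d) ^+ 2 + (c * z.2) ^+ 2 in
  (((a * z.1 + b) * (c * z.1 + d) + a * c * z.2 ^+ 2) / q, z.2 / q).

(* Subgroups of PSL(2, R) are given by their inverse images in SL(2, R), which
   are the subgroups of SL(2, R) containing -1. *)
Record surface_group (R : realType) (G : set 'M[R]_2) : Prop := SurfaceGroup {
  surface_group_det : forall A, G A -> \det A = 1;
  surface_group1 : G 1;
  surface_groupN1 : G (- 1);
  surface_groupM : forall A B, G A -> G B -> G (A * B);
  surface_groupV : forall A, G A -> G A^-1;
  surface_group_discrete : G `<=` isolated G;
  surface_group_torsion_free : forall A n, G A -> (0 < n)%N ->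
    A ^+ n = 1 \/ A ^+ n = - 1 -> A = 1 \/ A = - 1
}.

Section HyperbolicLamination.
Context (R : realType) (M : topologicalType) (F : lamination R M).
Context (g : leaf_metric F) (o : leaf_orientation F).

(* [pi] induces an orientation-preserving isometry from G\H onto L, where H is
   the upper half-plane with the metric (dx^2 + dy^2) / y^2. *)
Record uniformization (G : set 'M[R]_2) (L : set (leaf_space F))
    (pi : plane R -> leaf_space F) : Prop := Uniformization {
  uniformization_group : surface_group G;
  uniformization_image : pi @` @upper_half_plane R = L;
  uniformization_fibers : forall z w,
    upper_half_plane z -> upper_half_plane w ->
    pi z = pi w <-> exists2 A, G A & w = moebius A z;
  uniformization_continuous : forall z,
    upper_half_plane z -> {for z, continuous pi};
  uniformization_smooth : forall a : idx F,
    smooth_on [set z | upper_half_plane z /\ dom a (pi z)]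
      (fun z => (chart a (pi z)).1);
  uniformization_isometry : forall (a : idx F) z,
    upper_half_plane z -> dom a (pi z) ->
    forall u v,
      metric g (chart a (pi z)) ('d (fun z => (chart a (pi z)).1) z u)
                                ('d (fun z => (chart a (pi z)).1) z v)
      = (u.1 * v.1 + u.2 * v.2) / z.2 ^+ 2;
  uniformization_oriented : forall (a : idx F) z,
    upper_half_plane z -> dom a (pi z) ->
    (0 < jac_det ('d (fun z => (chart a (pi z)).1) z))
      = orient o (chart a (pi z)).2
}.

Definition hyperbolic_leaves :=
  forall x : M, exists G pi, uniformization G (leaf F x) pi.

(* A unit vector tangent to the leaf at [foot], given by its coordinates in
   all the charts around [foot], with the junk value 0 in the other charts. *)
Record unit_tangent := UnitTangent {
  foot : M;
  tcoord : idx F -> plane R;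
  tcoord_out : forall a, ~ dom a foot -> tcoord a = 0;
  tcoord_change : forall a b, dom a foot -> dom b foot ->
    tcoord a = dchange a (chart b foot) (tcoord b);
  tcoord_unit : forall a, dom a foot ->
    metric g (chart a foot) (tcoord a) (tcoord a) = 1
}.

HB.instance Definition _ := gen_eqMixin unit_tangent.
HB.instance Definition _ := gen_choiceMixin unit_tangent.

(* The topology for which [foot] is continuous and the maps
   v |-> (chart a (foot v), tcoord v a), for v over [dom a], are
   homeomorphisms onto the bundle of unit vectors over the disk times the
   transversal. *)
Definition unit_tangent_open : set_system unit_tangent :=
  [set O | forall v, O v -> forall a, dom a (foot v) ->
     \forall q \near (chart a (foot v), tcoord v a),
       forall w, dom a (foot w) -> (chart a (foot w), tcoord w a) = q -> O w].

Lemma unit_tangent_openT : unit_tangent_open setT.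
Proof. by move=> v _ a _; apply: filterE => q w. Qed.

Lemma unit_tangent_openI : setI_closed unit_tangent_open.
Proof.
move=> A B oA oB v [Av Bv] a dv.
apply: filterS2 (oA v Av a dv) (oB v Bv a dv) => q hA hB w dw wq.
by split; [exact: hA | exact: hB].
Qed.

Lemma unit_tangent_open_bigU (I : Type) (f : I -> set unit_tangent) :
  (forall i, unit_tangent_open (f i)) -> unit_tangent_open (\bigcup_i f i).
Proof.
move=> of_ v [i _ fiv] a dv.
by apply: filterS (of_ i v fiv a dv) => q h w dw wq; exists i => //; exact: h.
Qed.

HB.instance Definition _ := isOpenTopological.Build unit_tangent
  unit_tangent_openT unit_tangent_openI unit_tangent_open_bigU.

(* The identification of G\PSL(2, R) with the unit tangent bundle of G\H:
   the class of A is the image under A and [pi] of the vertical unit vector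
   at the point i = (0, 1). *)
Definition is_frame (pi : plane R -> leaf_space F) (A : 'M[R]_2)
    (v : unit_tangent) :=
  foot v = pi (moebius A (0, 1)) /\
  forall a, dom a (foot v) ->
    tcoord v a
      = 'd (fun z => (chart a (pi (moebius A z))).1) ((0, 1) : plane R) (0, 1).

(* The vector v . B; it does not depend on the choice of [pi] and A below. *)
Definition right_translation (B : 'M[R]_2) (v : unit_tangent) : unit_tangent :=
  xget v [set w | exists G pi A,
    [/\ uniformization G (leaf F (foot v)) pi, \det A = 1,
        is_frame pi A v & is_frame pi (A * B) w]].

Definition horocycle_flow (s : R) : unit_tangent -> unit_tangent :=
  right_translation (1%:M + s *: delta_mx 0 1).

Definition horocycle_orbit (v : unit_tangent) : set unit_tangent :=
  [set horocycle_flow s v | s in [set: R]].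

End HyperbolicLamination.

(* Main.v *)
From HB Require Import structures.
Require Import Defs.
From mathcomp Require Import all_boot all_order all_algebra.
From mathcomp Require Import all_classical all_reals all_analysis.
From mathcomp Require Import ring lra.

Set Implicit Arguments.
Unset Strict Implicit.
Unset Printing Implicit Defensive.

Import Order.TTheory GRing.Theory Num.Theory.
Import numFieldNormedType.Exports.

Local Open Scope classical_set_scope.
Local Open Scope ring_scope.

(** The horocycle flow lives on the unit tangent bundle X, on which SL(2, R) acts on the right. The
    theorem combines a statement about actions of SL(2, R) on compact spaces with a description of
    this particular action.

    Dynamics. Suppose that SL(2, R) acts continuously on a compact Hausdorff space X, that -1 acts
    trivially, that stabilizers are discrete and never reduced to 1 and -1, and that all orbits of
    the whole group are dense. Then all orbits of the unipotent group are dense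
    ([horocycle_orbits_dense]). By Baire and compactness the stabilizers are uniformly nontrivial:
    for some N, every point is fixed by a matrix with entries bounded by N that stays at distance
    1/N from 1 and -1; geometrically, the leaves have closed loops of bounded length through every
    point ([uniform_loops]). Let A be a minimal set of the horocycle flow inside the closure of an
    orbit ([exists_minimal]). Push a point x of A by the diagonal matrix of entries r, 1/r with r
    large, and take a bounded loop (a b; c d) at the point that is reached; at x, this loop becomes
    (a, b r^2; c/r^2, d), which is almost upper triangular. Sliding x along its horocycle changes a
    into any prescribed l, as soon as c is not zero, and in the limit the loop says that the
    diagonal matrix of entries l, 1/l maps a point of A to a point of A. As it normalizes the
    horocycle flow, it preserves A by minimality ([minimal_diag_invariant]). Pushing in the other
    direction makes loops almost lower triangular, and the Bruhat decomposition of these loops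
    shows that A is preserved by the rotation of matrix (0 -1; 1 0) ([weyl_invariant]). So A is
    invariant under SL(2, R), hence dense.

    Geometry. The hypotheses on the action are consequences of one fact: local isometries from the
    upper half plane H to the leaves depend continuously on their 1-jet at a point, even when the
    leaf varies. In a chart, the Koszul formula expresses the second derivatives of a local isometry
    through its first derivatives and the first derivatives of the coefficients of the metric
    ([koszul_jet]); along a segment of H the 1-jet thus solves an ordinary differential equation,
    and Gronwall's inequality compares two solutions ([jet_gronwall]). This gives convergence of
    jets near a point ([jets_cvg_local]), and then along any segment ([jets_cvg_all]). The 1-jet of
    an oriented local isometry at the point i is determined by the image of the vertical vector
    ([jets_cvg_vertical]). Consequently a unit tangent vector is the image of the vertical vector at
    i under exactly one oriented local isometry ([dev_unique], [dev_at]), the translation by a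
    matrix can be computed from this isometry ([right_translationP]), and it is continuous
    ([act_cvg]). If the uniformizing group of the leaf is G, the stabilizer of a unit vector is a
    conjugate of G ([stabilizer_conj], [stabilizer_of_group]): it is discrete, and if it were reduced
    to 1 and -1, the uniformization would be an injective open map, and straight segments of H would
    contract all loops of the leaf ([injective_uniformization_simply_connected]). *)

(** * Limits *)

Section UltrafilterLimits.
Context {I : Type} (U : set_system I) (UU : UltraFilter U).

Lemma ultra_cvg (T : topologicalType) (A : set T) (f : I -> T) :
  compact A -> U (f @^-1` A) -> exists2 p, A p & f @ U --> p.
Proof.
have PU := @ultra_proper _ _ UU.
move=> cA UA; have [p [Ap clp]] := cA (f @ U) _ UA.
exists p => // B nB.
case: (in_ultra_setVsetC (f @^-1` B) UU) => // UB.
have [q [/= nBq Bq]] := clp (~` B) B UB nB.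
by [].
Qed.

Lemma ultra_cvg_bounded (R : realType) (u : I -> R) (M : R) :
  (\forall i \near U, `|u i| <= M) -> exists2 l : R, `|l| <= M & u @ U --> l.
Proof.
move=> uM; have [|l] := @ultra_cvg _ `[- M, M] u (@segment_compact _ _ _).
  by apply: filterS uM => i /=; rewrite in_itv /= -ler_norml.
by rewrite /= in_itv /= -ler_norml => lM ul; exists l.
Qed.

End UltrafilterLimits.

(** A limit along a fixed free ultrafilter plays the role of the limit of an extracted sequence,
    simultaneously for all sequences in compact sets. *)
Lemma free_ultrafilter : exists U : set_system nat, UltraFilter U /\ \oo `<=` U.
Proof. exact: ultraFilterLemma. Qed.

Lemma cvg1 (I : Type) (U V : topologicalType) (FF : set_system I) (FFF : Filter FF)
    (f : I -> U * V) (p : U * V) : f @ FF --> p -> (fun i => (f i).1) @ FF --> p.1.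
Proof. by move=> h; apply: (cvg_comp _ _ h); exact: cvg_fst. Qed.

Lemma cvg2 (I : Type) (U V : topologicalType) (FF : set_system I) (FFF : Filter FF)
    (f : I -> U * V) (p : U * V) : f @ FF --> p -> (fun i => (f i).2) @ FF --> p.2.
Proof. by move=> h; apply: (cvg_comp _ _ h); exact: cvg_snd. Qed.

Lemma cvg_app (I : Type) (U V : topologicalType) (FF : set_system I) (FFF : Filter FF)
    (h : U -> V) (f : I -> U) (p : U) : {for p, continuous h} -> f @ FF --> p ->
  (fun i => h (f i)) @ FF --> h p.
Proof. by move=> ch fp; exact: (cvg_comp _ _ fp ch). Qed.

Lemma cvg_pr (I : Type) (U V : topologicalType) (FF : set_system I) {FFF : Filter FF}
    (f : I -> U) (h : I -> V) (p : U) (q : V) : f @ FF --> p -> h @ FF --> q ->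
  (fun i => (f i, h i)) @ FF --> (p, q).
Proof. by move=> fp hq; apply: (cvg_pair (G := nbhs p) (H := nbhs q)). Qed.

Lemma near_cvg (I : Type) (FF : set_system I) {FFF : Filter FF} (U : topologicalType)
   (f : I -> U) (x : U) (A : set U) : f @ FF --> x -> nbhs x A -> \forall i \near FF, A (f i).
Proof. by move=> h nA; exact: h. Qed.

Lemma cvg_near_eq (I : Type) (FF : set_system I) {FFF : Filter FF} (U : topologicalType)
    (u v : I -> U) (l l' : U) : u @ FF --> l -> l' = l -> (\forall i \near FF, v i = u i) -> v @ FF --> l'.
Proof.
move=> h -> n; apply: cvg_trans h; apply: near_eq_cvg.
by apply: filterS n => i ->.
Qed.

Arguments cvg1 {I U V FF FFF f p}.
Arguments cvg2 {I U V FF FFF f p}.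
Arguments cvg_app {I U V FF FFF h f p}.

Section RealLimits.
Context {R : realType}.

Lemma cvg_sub0 (I : Type) (FF : set_system I) {FFF : Filter FF} (u : I -> R) (l : R) :
  u @ FF --> l -> (fun i => u i - l) @ FF --> (0 : R).
Proof.
move=> h; have : (fun i => u i - l) @ FF --> l - l by apply: cvgB; [exact: h|exact: cvg_cst].
by rewrite subrr.
Qed.

Lemma cvg_add0 (I : Type) (FF : set_system I) {FFF : Filter FF} (u v : I -> R) (l : R) :
  (fun i => u i - v i) @ FF --> (0 : R) -> v @ FF --> l -> u @ FF --> l.
Proof.
move=> h h'; have : (fun i => u i - v i + v i) @ FF --> 0 + l by apply: cvgD; [exact: h|exact: h'].
by rewrite add0r; under eq_fun do rewrite subrK.
Qed.

Lemma sum_sqr_cvg0 (I : Type) (FF : set_system I) {FFF : Filter FF} (n : nat) (d : I -> nat -> R) :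
  (forall k, (k < n)%N -> (fun i => d i k) @ FF --> (0 : R)) ->
  (fun i => \sum_(k < n) d i k ^+ 2) @ FF --> (0 : R).
Proof.
elim: n => [|n IH] h.
  by under eq_fun do rewrite big_ord0; exact: cvg_cst.
under eq_fun do rewrite big_ord_recr /=.
have h1 : (fun i => \sum_(k < n) d i k ^+ 2) @ FF --> (0 : R).
  by apply: IH => k kn; apply: h; rewrite ltnS ltnW.
have hn := h n (ltnSn n).
have h2 : (fun i => d i n * d i n) @ FF --> (0 * 0 : R) by exact: cvgM.
have h3 : (fun i => \sum_(k < n) d i k ^+ 2 + d i n * d i n) @ FF --> (0 + 0 * 0 : R) by exact: cvgD.
rewrite mulr0 addr0 in h3; exact: h3.
Qed.

Lemma sum_sqr_cvg0_comp (I : Type) (FF : set_system I) {FFF : Filter FF} (n : nat) (d : I -> nat -> R) :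
  (forall e : R, 0 < e -> \forall i \near FF, \sum_(k < n) d i k ^+ 2 <= e) ->
  forall k, (k < n)%N -> (fun i => d i k) @ FF --> (0 : R).
Proof.
move=> h k kn; apply/cvgrPdist_le => e e0.
have e20 : 0 < e ^+ 2 by rewrite exprn_gt0.
apply: filterS (h _ e20) => i le; rewrite sub0r normrN.
rewrite -(@ler_pXn2r _ 2) ?nnegrE ?(ltW e0) // real_normK ?num_real //.
apply: le_trans le; rewrite (bigD1 (Ordinal kn)) //= lerDl sumr_ge0 // => j _.
exact: sqr_ge0.
Qed.

End RealLimits.

(** * The horocycle flow of an action of SL(2, R) *)

Section SL2Action.
Context {R : realType} {X : topologicalType} (act : X -> R -> R -> R -> R -> X).

Hypothesis X_compact : compact [set: X].
Hypothesis X_hausdorff : hausdorff_space X.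
Hypothesis act1 : forall x, act x 1 0 0 1 = x.
Hypothesis actN1 : forall x, act x (- 1) 0 0 (- 1) = x.
Hypothesis actM : forall (x : X) (a b c d a' b' c' d' : R),
  a * d - b * c = 1 -> a' * d' - b' * c' = 1 ->
  act (act x a b c d) a' b' c' d' =
  act x (a * a' + b * c') (a * b' + b * d') (c * a' + d * c') (c * b' + d * d').
Hypothesis act_cvg : forall (I : Type) (F : set_system I) (FF : ProperFilter F)
    (x_ : I -> X) (a_ b_ c_ d_ : I -> R) (x : X) (a b c d : R),
  x_ @ F --> x -> a_ @ F --> a -> b_ @ F --> b -> c_ @ F --> c -> d_ @ F --> d ->
  (\forall i \near F, a_ i * d_ i - b_ i * c_ i = 1) ->
  (fun i => act (x_ i) (a_ i) (b_ i) (c_ i) (d_ i)) @ F --> act x a b c d.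
Hypothesis stab_discrete : forall x, exists2 e : R, 0 < e &
  forall a b c d : R, a * d - b * c = 1 -> act x a b c d = x ->
  `|a - 1| < e -> `|b| < e -> `|c| < e -> `|d - 1| < e ->
  b = 0.
Hypothesis stab_nontrivial : forall x, exists a b c d : R,
  [/\ a * d - b * c = 1, act x a b c d = x & 0 < `|b| + `|c| + `|a - d|].
Hypothesis orbits_dense : forall x (O : set X), open O -> O !=set0 ->
  exists a b c d : R, a * d - b * c = 1 /\ O (act x a b c d).

Definition fixes (x : X) (a b c d : R) := a * d - b * c = 1 /\ act x a b c d = x.

Lemma fixes_mul x a b c d a' b' c' d' : fixes x a b c d -> fixes x a' b' c' d' ->
  fixes x (a * a' + b * c') (a * b' + b * d') (c * a' + d * c') (c * b' + d * d').
Proof.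
move=> [h1 e1] [h2 e2]; split; last by rewrite -actM // e1.
transitivity ((a * d - b * c) * (a' * d' - b' * c')); first ring.
by rewrite h1 h2 mulr1.
Qed.

Lemma fixes_inv x a b c d : fixes x a b c d -> fixes x d (- b) (- c) a.
Proof.
move=> [h e]; split; first by rewrite -h; ring.
rewrite -{1}e actM //; last by rewrite -h; ring.
rewrite -[RHS]act1; congr act; rewrite -?h; ring.
Qed.

Lemma fixes_opp x a b c d : fixes x a b c d -> fixes x (- a) (- b) (- c) (- d).
Proof.
move=> [h e]; split; first by rewrite -h; ring.
have hN : (-1) * (-1) - 0 * 0 = 1 :> R by ring.
rewrite -{2}e -[in RHS](actN1 x) actM //; congr act; ring.
Qed.

(** Carrying a loop at x (p q; r s) back to x conjugates it. *)
Lemma fixes_act x (a b c d p q r s : R) : p * s - q * r = 1 ->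
  fixes (act x p q r s) a b c d ->
  fixes x ((p * a + q * c) * s - (p * b + q * d) * r)
          (- (p * a + q * c) * q + (p * b + q * d) * p)
          ((r * a + s * c) * s - (r * b + s * d) * r)
          (- (r * a + s * c) * q + (r * b + s * d) * p).
Proof.
move=> h [h1 e1]; split.
  transitivity ((p * s - q * r) ^+ 2 * (a * d - b * c)); first ring.
  by rewrite h h1; ring.
have hi : s * p - (- q) * (- r) = 1 by rewrite -h; ring.
have h2 : (p * a + q * c) * (r * b + s * d) - (p * b + q * d) * (r * a + s * c) = 1.
  transitivity ((p * s - q * r) * (a * d - b * c)); first ring.
  by rewrite h h1; ring.
have := congr1 (fun y => act y s (- q) (- r) p) e1.
rewrite (actM x h h1) (actM x h2 hi) (actM x h hi) => H.
transitivity (act x (p * s + q * - r) (p * - q + q * p) (r * s + s * - r) (r * - q + s * p)).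
  by rewrite -H; congr act; ring.
rewrite -[RHS]act1; congr act; rewrite -?h; ring.
Qed.

(** Conjugation in the other direction: a loop at x is carried to x (p q; r s). *)
Lemma fixes_conj x (a b c d p q r s : R) : p * s - q * r = 1 ->
  fixes x a b c d ->
  fixes (act x p q r s)
          (s * (a * p + b * r) - q * (c * p + d * r))
          (s * (a * q + b * s) - q * (c * q + d * s))
          (p * (c * p + d * r) - r * (a * p + b * r))
          (p * (c * q + d * s) - r * (a * q + b * s)).
Proof.
move=> h [h1 e1].
have h2 : (s * (a * p + b * r) - q * (c * p + d * r)) * (p * (c * q + d * s) - r * (a * q + b * s)) -
  (s * (a * q + b * s) - q * (c * q + d * s)) * (p * (c * p + d * r) - r * (a * p + b * r)) = 1.
  transitivity ((p * s - q * r) ^+ 2 * (a * d - b * c)); first ring.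
  by rewrite h h1; ring.
split=> //; rewrite (actM x h h2) -[in RHS]e1 (actM x h1 h); congr act.
- by transitivity ((p * s - q * r) * (a * p + b * r)); [ring | rewrite h mul1r].
- by transitivity ((p * s - q * r) * (a * q + b * s)); [ring | rewrite h mul1r].
- by transitivity ((p * s - q * r) * (c * p + d * r)); [ring | rewrite h mul1r].
- by transitivity ((p * s - q * r) * (c * q + d * s)); [ring | rewrite h mul1r].
Qed.

Lemma fixes_cvg (I : Type) (F : set_system I) (FF : ProperFilter F)
    (x_ : I -> X) (a_ b_ c_ d_ : I -> R) (x : X) (a b c d : R) :
  x_ @ F --> x -> a_ @ F --> a -> b_ @ F --> b -> c_ @ F --> c -> d_ @ F --> d ->
  (\forall i \near F, fixes (x_ i) (a_ i) (b_ i) (c_ i) (d_ i)) ->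
  fixes x a b c d.
Proof.
move=> xx aa bb cc dd fx.
have det1 : a * d - b * c = 1.
  have h : (fun i => a_ i * d_ i - b_ i * c_ i) @ F --> a * d - b * c.
    by apply: cvgB; apply: cvgM.
  apply: (cvg_unique (@Rhausdorff R) h); apply: cvg_near_cst.
  by apply: filterS fx => i [].
split=> //.
have fdet : \forall i \near F, a_ i * d_ i - b_ i * c_ i = 1.
  by apply: filterS fx => i [].
have h := act_cvg FF xx aa bb cc dd fdet.
have h' : (fun i => act (x_ i) (a_ i) (b_ i) (c_ i) (d_ i)) @ F --> x.
  apply: cvg_trans xx; apply: near_eq_cvg; apply: filterS fx => i [_ ->] //.
exact: (cvg_unique X_hausdorff h h').
Qed.

Lemma ultra_cvgX (I : Type) (U : set_system I) (UU : UltraFilter U) (x_ : I -> X) :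
  exists x : X, x_ @ U --> x.
Proof.
have PU := @ultra_proper _ _ UU.
have [|x _ xx] := @ultra_cvg _ U UU X setT x_ X_compact; last by exists x.
exact: filterT.
Qed.

Lemma fixes_bounded_cvg (I : Type) (U : set_system I) (UU : UltraFilter U)
    (x_ : I -> X) (a_ b_ c_ d_ : I -> R) (x : X) (N : R) :
  x_ @ U --> x ->
  (\forall i \near U, [/\ fixes (x_ i) (a_ i) (b_ i) (c_ i) (d_ i),
     `|a_ i| <= N, `|b_ i| <= N, `|c_ i| <= N & `|d_ i| <= N]) ->
  exists a b c d, [/\ fixes x a b c d, a_ @ U --> a, b_ @ U --> b,
    c_ @ U --> c & d_ @ U --> d].
Proof.
have PU := @ultra_proper _ _ UU.
move=> xx H.
have [|a _ aa] := @ultra_cvg_bounded _ U UU R a_ N.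
  by apply: filterS H => i [].
have [|b _ bb] := @ultra_cvg_bounded _ U UU R b_ N.
  by apply: filterS H => i [].
have [|c _ cc] := @ultra_cvg_bounded _ U UU R c_ N.
  by apply: filterS H => i [].
have [|d _ dd] := @ultra_cvg_bounded _ U UU R d_ N.
  by apply: filterS H => i [].
exists a, b, c, d; split=> //.
apply: (fixes_cvg _ xx aa bb cc dd).
by apply: filterS H => i [].
Qed.

(** The diagonal matrices contract unipotent ones: for r_n^2 = n!, the matrix (1 s/n!; 0 1) fixes x
    moved by the diagonal matrix of entries r_n, 1/r_n, and so does its power (1 s/j; 0 1) for
    j <= n. A limit of the moved points is fixed by (1 s/j; 0 1) for all j, which contradicts the
    discreteness of its stabilizer unless s = 0. *)
Lemma unipotent_stab x s : fixes x 1 s 0 1 -> s = 0.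
Proof.
move=> fs.
have det1 (r : R) : r != 0 -> r * r^-1 - 0 * 0 = 1.
  by move=> r0; rewrite mulfV //; ring.
have fac0 n : (n`!)%:R != 0 :> R by rewrite pnatr_eq0 -lt0n fact_gt0.
have fac_ge0 n : 0 <= (n`!)%:R :> R by rewrite ler0n.
pose r (n : nat) : R := Num.sqrt (n`!)%:R.
have r0 n : r n != 0 by rewrite sqrtr_eq0 -ltNge lt0r fac0 fac_ge0.
have rr n : r n * r n = (n`!)%:R by rewrite -expr2 sqr_sqrtr.
have [U [UU ooU]] := free_ultrafilter.
have PU := @ultra_proper _ _ UU.
have [y xy] := ultra_cvgX UU (fun n => act x (r n) 0 0 (r n)^-1).
have fpow z t k : fixes z 1 t 0 1 -> fixes z 1 (k%:R * t) 0 1.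
  move=> H; elim: k => [|k IH]; first by rewrite mul0r; split; [ring | exact: act1].
  have := fixes_mul H IH; rewrite [k.+1%:R]mulrS.
  by congr fixes; ring.
have fy (j : nat) : fixes y 1 (s / j.+1%:R) 0 1.
  apply: (fixes_cvg _ xy (cvg_cst _) (cvg_cst _) (cvg_cst _) (cvg_cst _)).
  apply: ooU; exists j.+1 => // n /= jn.
  have dj : (j.+1 %| n`!)%N by rewrite dvdn_fact.
  have H : fixes (act x (r n) 0 0 (r n)^-1) 1 (s / (n`!)%:R) 0 1.
    by have := fixes_conj (det1 _ (r0 n)) fs; congr fixes; rewrite -?rr; field; rewrite ?r0.
  have := fpow _ _ (n`! %/ j.+1)%N H.
  have q0 : (n`! %/ j.+1)%:R != 0 :> R.
    by rewrite pnatr_eq0 -lt0n divn_gt0 // dvdn_leq // fact_gt0.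
  congr fixes; rewrite -[in X in _ / X](divnK dj) natrM; field.
  by apply/andP; split; [rewrite nat1r pnatr_eq0 | exact: q0].
have [e e0 He] := stab_discrete y.
have [j _ Hj] : \forall j \near \oo, `|s / j.+1%:R| < e.
  have : (fun j : nat => s / j.+1%:R) @ \oo --> s * 0.
    by apply: cvgM; [exact: cvg_cst | exact: cvg_harmonic].
  by rewrite mulr0 => /cvgr0_norm_lt /(_ _ e0).
have := He 1 (s / j.+1%:R) 0 1 (proj1 (fy j)) (proj2 (fy j)).
rewrite subrr normr0 => /(_ e0 (Hj _ (leqnn j)) e0 e0) /eqP.
by rewrite mulf_eq0 invr_eq0 pnatr_eq0 orbF => /eqP.
Qed.

Lemma parabolic_stab x a b d : fixes x a b 0 d -> a = d -> b = 0.
Proof.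
move=> f ad; move: (f) => [h _]; rewrite -ad mulr0 subr0 in h f *.
have /eqP : a ^+ 2 = 1 by rewrite expr2.
rewrite sqrf_eq1 => /orP[] /eqP a1; rewrite a1 in f.
  exact: unipotent_stab f.
have := fixes_opp f; rewrite opprK oppr0 => /unipotent_stab /eqP.
by rewrite oppr_eq0 => /eqP.
Qed.

(** The commutator of the two matrices is unipotent. *)
Lemma diag_upper_stab x p p' q b q' : fixes x p 0 0 p' -> p != p' ->
  fixes x q b 0 q' -> b = 0.
Proof.
move=> fp pp' fq; have [hp _] := fp; have [hq _] := fq.
have := fixes_mul (fixes_mul fp fq) (fixes_mul (fixes_inv fp) (fixes_inv fq)).
have -> : fixes x ((p * q + 0 * 0) * (p' * q' + - 0 * - 0) +
     (p * b + 0 * q') * (- 0 * q' + p * - 0))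
    ((p * q + 0 * 0) * (p' * - b + - 0 * q) +
     (p * b + 0 * q') * (- 0 * - b + p * q))
    ((0 * q + p' * 0) * (p' * q' + - 0 * - 0) +
     (0 * b + p' * q') * (- 0 * q' + p * - 0))
    ((0 * q + p' * 0) * (p' * - b + - 0 * q) +
     (0 * b + p' * q') * (- 0 * - b + p * q)) = fixes x 1 (q * b * p * (p - p')) 0 1.
  congr fixes; last 3 first; try ring.
  - transitivity ((p * p' - 0 * 0) * (q * q' - b * 0)); first ring.
    by rewrite hp hq mul1r.
  - transitivity ((p * p' - 0 * 0) * (q * q' - b * 0)); first ring.
    by rewrite hp hq mul1r.
move/unipotent_stab/eqP; rewrite !mulf_eq0 subr_eq0 (negbTE pp') orbF.
have q0 : q != 0.
  by apply/eqP => q0; move/eqP: hq; rewrite q0 mul0r mulr0 subr0 eq_sym oner_eq0.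
have p0 : p != 0.
  by apply/eqP => p0; move/eqP: hp; rewrite p0 !mul0r subr0 eq_sym oner_eq0.
by rewrite (negbTE q0) (negbTE p0) /= orbF => /eqP.
Qed.

(** The sum |b| + |c| + |a - d| measures the distance from the matrix to 1 and -1: it vanishes
    exactly at the scalar matrices. *)
Definition bounded_loop (N : R) x a b c d :=
  [/\ fixes x a b c d, `|a| <= N, `|b| <= N, `|c| <= N & `|d| <= N] /\
  1 <= N * (`|b| + `|c| + `|a - d|).

Definition has_loop N x := exists a b c d, bounded_loop N x a b c d.

(** Entries of bounded loops converge along the ultrafilter, and the lower bound passes to the limit. *)
Lemma has_loop_limit (I : Type) (U : set_system I) (UU : UltraFilter U)
    (x_ : I -> X) x N : x_ @ U --> x -> (\forall i \near U, has_loop N (x_ i)) ->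
  exists (a_ b_ c_ d_ : I -> R) a b c d,
   [/\ (\forall i \near U, bounded_loop N (x_ i) (a_ i) (b_ i) (c_ i) (d_ i)),
    bounded_loop N x a b c d &
    [/\ a_ @ U --> a, b_ @ U --> b, c_ @ U --> c & d_ @ U --> d]].
Proof.
have PU := @ultra_proper _ _ UU.
move=> xx H.
have [f Hf] : exists f : I -> R * R * R * R, forall i, has_loop N (x_ i) ->
    bounded_loop N (x_ i) (f i).1.1.1 (f i).1.1.2 (f i).1.2 (f i).2.
  suff /choice [f Hf] : forall i, exists f : R * R * R * R, has_loop N (x_ i) ->
      bounded_loop N (x_ i) f.1.1.1 f.1.1.2 f.1.2 f.2 by exists f.
  move=> i.
  have [[a [b [c [d h]]]]|nh] := pselect (has_loop N (x_ i)).
    by exists (a, b, c, d).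
  by exists (0, 0, 0, 0).
exists (fun i => (f i).1.1.1), (fun i => (f i).1.1.2), (fun i => (f i).1.2), (fun i => (f i).2).
have {}H : \forall i \near U,
    bounded_loop N (x_ i) (f i).1.1.1 (f i).1.1.2 (f i).1.2 (f i).2.
  by apply: filterS H => i /Hf.
have [|a [b [c [d [fx aa bb cc dd]]]]] := @fixes_bounded_cvg _ _ UU x_ (fun i => (f i).1.1.1)
  (fun i => (f i).1.1.2) (fun i => (f i).1.2) (fun i => (f i).2) x N xx.
  by apply: filterS H => i [].
have nle (u : I -> R) (l M : R) : u @ U --> l -> (\forall i \near U, `|u i| <= M) -> `|l| <= M.
  move=> ul uM; apply: (@closed_cvg _ _ U _ (fun i => `|u i|) [set t | t <= M] _ uM `|l|).
    exact: closed_le.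
  exact: cvg_norm.
exists a, b, c, d; split=> //; split.
  split=> //.
  - by apply: (nle _ _ _ aa); apply: filterS H => i [[]].
  - by apply: (nle _ _ _ bb); apply: filterS H => i [[]].
  - by apply: (nle _ _ _ cc); apply: filterS H => i [[]].
  - by apply: (nle _ _ _ dd); apply: filterS H => i [[]].
apply: (@closed_cvg _ _ U _ (fun i => N * (`|(f i).1.1.2| + `|(f i).1.2| +
  `|(f i).1.1.1 - (f i).2|)) [set t | 1 <= t]).
- exact: closed_ge.
- by apply: filterS H => i [].
- apply: cvgM; first exact: cvg_cst.
  by apply: cvgD; [apply: cvgD; apply: cvg_norm | apply: cvg_norm; apply: cvgB].
Qed.

Lemma closed_has_loop N : closed [set x | has_loop N x].
Proof.
move=> x clx.
have PF : ProperFilter (within [set x | has_loop N x] (nbhs x)).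
  apply: Build_ProperFilter_ex => A; rewrite /within /= => nA.
  by have [y [hy Ay]] := clx _ nA; exists y; exact: Ay.
have [U [UU sU]] := ultraFilterLemma PF.
have PU := @ultra_proper _ _ UU.
have [||? [? [? [? [a [b [c [d [_ h _]]]]]]]]] := @has_loop_limit _ U UU id x N.
- by move=> A nA; apply: sU; rewrite /within /=; apply: filterS nA.
- by apply: sU; rewrite /within /=; apply: filterE.
- by exists a, b, c, d.
Qed.

Lemma summands_le (a b c d e : R) : 0 <= a -> 0 <= b -> 0 <= c -> 0 <= d -> 0 <= e ->
  let s := a + b + c + d + e in
  [/\ a <= s, b <= s, c <= s, d <= s & e <= s].
Proof. by move=> a0 b0 c0 d0 e0 s; rewrite /s; split; lra. Qed.

Lemma has_some_loop x : exists n : nat, has_loop n%:R x.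
Proof.
have [a [b [c [d [h e k]]]]] := stab_nontrivial x.
pose kk : R := `|b| + `|c| + `|a - d|.
rewrite -/kk in k.
pose M : R := `|a| + `|b| + `|c| + `|d| + kk^-1.
have M0 : 0 <= M by rewrite !addr_ge0 // invr_ge0 ltW.
have /andP[_ nM] := truncn_itv M0.
exists (Num.truncn M).+1, a, b, c, d; split.
  have k0 : 0 <= kk^-1 by rewrite invr_ge0 ltW.
  have [] := summands_le (normr_ge0 a) (normr_ge0 b) (normr_ge0 c) (normr_ge0 d) k0.
  by rewrite -/M => *; split=> //; apply: le_trans (ltW nM).
have kn : kk^-1 <= (Num.truncn M).+1%:R.
  by apply: le_trans (ltW nM); rewrite /M lerDr !addr_ge0.
by rewrite -/kk -ler_pdivrMr // div1r.
Qed.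

(** Baire's theorem for the closed sets of points having a loop bounded by n, which cover the space;
    the point common to a decreasing sequence of open sets is obtained as a limit along an
    ultrafilter. *)
Lemma has_loop_interior (x0 : X) :
  exists n : nat, exists O : set X, [/\ open O, O !=set0 & O `<=` has_loop n%:R].
Proof.
apply: contrapT => nex.
have step (n : nat) (O : set X) : exists O' : set X, open O -> O !=set0 ->
    [/\ open O', O' !=set0 & closure O' `<=` O `\` has_loop n%:R].
  have [[oO O0]|nO] := pselect (open O /\ O !=set0); last first.
    by exists setT => oO O0; case: nO.
  have [y [Oy ny]] : O `\` has_loop n%:R !=set0.
    apply: contrapT => H; apply: nex; exists n, O; split=> // y Oy.
    by apply: contrapT => ny; apply: H; exists y.
  have nb : nbhs y (O `\` has_loop n%:R).
    apply: open_nbhs_nbhs; split; last by split.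
    by rewrite setDE; apply: openI => //; apply: closed_openC; exact: closed_has_loop.
  have [B nB clB] := compact_regular X_hausdorff X_compact (filterT : nbhs y setT) nb.
  exists B° => _ _; split; first exact: open_interior.
    by exists y.
  by apply: subset_trans clB; apply: closureS; exact: interior_subset.
have {step} /choice [g Hg] : forall nO : nat * set X, exists O' : set X,
    open nO.2 -> nO.2 !=set0 ->
    [/\ open O', O' !=set0 & closure O' `<=` nO.2 `\` has_loop nO.1%:R].
  by move=> [n O]; exact: step.
pose f := fix f n := if n is m.+1 then g (m, f m) else setT.
have fP n : open (f n) /\ f n !=set0.
  elim: n => [|n [opn nne]]; first by split; [exact: openT | exists x0].
  by have [] := Hg (n, f n) opn nne.
have fS n : closure (f n.+1) `<=` f n `\` has_loop n%:R.
  by have [] := Hg (n, f n) (proj1 (fP n)) (proj2 (fP n)).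
have fD n m : (n <= m)%N -> f m `<=` f n.
  elim: m => [|m IH]; first by rewrite leqn0 => /eqP ->.
  rewrite leq_eqVlt => /orP[/eqP -> //|]; rewrite ltnS => /IH; apply: subset_trans.
  by move=> y /(@subset_closure _ _ _) /fS [].
have /choice [u Hu] : forall n, exists y, f n y by move=> n; exact: (proj2 (fP n)).
have [U [UU ooU]] := free_ultrafilter.
have PU := @ultra_proper _ _ UU.
have [x ux] := ultra_cvgX UU u.
have [n hn] := has_some_loop x.
have : closure (f n.+1) x.
  move=> B nB; have : U ((u @^-1` f n.+1) `&` (u @^-1` B)).
    apply: filterI; last exact: ux.
    by apply: ooU; exists n.+1 => // m /= nm; exact: (fD _ _ nm).
  by move=> /filter_ex [m [? ?]]; exists (u m).
by move/fS => [].
Qed.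

(** Otherwise there are points u_m without loops bounded by m, converging to some x. A translate of x
    lies in the open set given by [has_loop_interior]; the bounded loops found at the translates of
    u_m, carried back to u_m by a fixed matrix, remain bounded. *)
Lemma uniform_loops : exists2 N : R, 0 < N & forall x, has_loop N x.
Proof.
have [x0|nX] := pselect (exists x0 : X, True); last first.
  by exists 1 => // x; case: nX; exists x.
have {x0} [x0 _] := x0.
have [n [W [oO O0 On]]] := has_loop_interior x0.
apply: contrapT => nex.
have /choice [u Hu] : forall m : nat, exists x, ~ has_loop m.+1%:R x.
  move=> m; apply: contrapT => H; apply: nex; exists m.+1%:R; first by rewrite ltr0n.
  by move=> x; apply: contrapT => hx; apply: H; exists x.
have [U [UU ooU]] := free_ultrafilter.
have PU := @ultra_proper _ _ UU.
have [x ux] := ultra_cvgX UU u.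
have [p [q [r [s [h Ox]]]]] := orbits_dense x oO O0.
pose v m := act (u m) p q r s.
have vx : v @ U --> act x p q r s.
  apply: (act_cvg _ ux (cvg_cst _) (cvg_cst _) (cvg_cst _) (cvg_cst _)).
  exact: filterE.
have [|a_ [b_ [c_ [d_ [a [b [c [d [L [[fx _ _ _ _] k] [aa bb cc dd]]]]]]]]]] :=
    @has_loop_limit _ U UU v _ n%:R vx.
  have : \forall m \near U, W (v m) by apply: vx; exact: open_nbhs_nbhs.
  by apply: filterS => m /On.
pose a' i := (p * a_ i + q * c_ i) * s - (p * b_ i + q * d_ i) * r.
pose b' i : R := - (p * a_ i + q * c_ i) * q + (p * b_ i + q * d_ i) * p.
pose c' i := (r * a_ i + s * c_ i) * s - (r * b_ i + s * d_ i) * r.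
pose d' i : R := - (r * a_ i + s * c_ i) * q + (r * b_ i + s * d_ i) * p.
have L' : \forall i \near U, fixes (u i) (a' i) (b' i) (c' i) (d' i).
  by apply: filterS L => i [[+ _ _ _ _] _]; exact: fixes_act.
have cM (t : R) (f : nat -> R) (l : R) : f @ U --> l -> (fun i => t * f i) @ U --> t * l.
  by move=> fl; apply: cvgM; [exact: cvg_cst|].
have cM' (t : R) (f : nat -> R) (l : R) : f @ U --> l -> (fun i => f i * t) @ U --> l * t.
  by move=> fl; apply: cvgM; [|exact: cvg_cst].
have a'l : a' @ U --> (p * a + q * c) * s - (p * b + q * d) * r.
  by apply: cvgB; apply: cM'; apply: cvgD; apply: cM.
have b'l : b' @ U --> - (p * a + q * c) * q + (p * b + q * d) * p.
  by apply: cvgD; apply: cM'; [apply: cvgN|]; apply: cvgD; apply: cM.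
have c'l : c' @ U --> (r * a + s * c) * s - (r * b + s * d) * r.
  by apply: cvgB; apply: cM'; apply: cvgD; apply: cM.
have d'l : d' @ U --> - (r * a + s * c) * q + (r * b + s * d) * p.
  by apply: cvgD; apply: cM'; [apply: cvgN|]; apply: cvgD; apply: cM.
set al := _ - _ in a'l; set be := _ + _ in b'l; set ga := _ - _ in c'l; set de := _ + _ in d'l.
have h2 : (p * s - q * r) * (p * s - q * r) = 1 by rewrite h mulr1.
have eb : b = s * (al * q + be * s) - q * (ga * q + de * s).
  by rewrite -[LHS]mul1r -h2 /al /be /ga /de; ring.
have ec : c = p * (ga * p + de * r) - r * (al * p + be * r).
  by rewrite -[LHS]mul1r -h2 /al /be /ga /de; ring.
have ead : a - d = (al - de) * (p * s + q * r) + (be + be) * r * s - (ga + ga) * q * p.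
  by rewrite -[LHS]mul1r -h2 /al /be /ga /de; ring.
clearbody al be ga de.
pose kk : R := `|be| + `|ga| + `|al - de|.
have kk0 : 0 < kk.
  rewrite lt0r !addr_ge0 // andbT; apply/negP => /eqP kk0.
  have [be0 ga0 alde] : [/\ be = 0, ga = 0 & al = de].
    move/eqP: kk0; rewrite paddr_eq0 ?addr_ge0 // paddr_eq0 // !normr_eq0 subr_eq0.
    by move=> /andP[/andP[/eqP -> /eqP ->] /eqP ->].
  move: k; rewrite ead eb ec be0 ga0 alde subrr !(mul0r, mulr0, addr0, subr0).
  rewrite (_ : _ - _ = 0); last by ring.
  rewrite (_ : _ - _ = 0); last by ring.
  by rewrite normr0 !addr0 mulr0 ler10.
have kl : (fun i => `|b' i| + `|c' i| + `|a' i - d' i|) @ U --> kk.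
  by apply: cvgD; [apply: cvgD; apply: cvg_norm | apply: cvg_norm; apply: cvgB].
have bnd (f : nat -> R) (l : R) : f @ U --> l -> \forall i \near U, `|f i| <= `|l| + 1.
  move=> /cvg_norm fl; have l1 : `|l| < `|l| + 1 by rewrite ltrDl.
  by apply: filterS (cvgr_lt _ fl _ l1) => i /ltW.
pose M : R := (`|al| + 1) + (`|be| + 1) + (`|ga| + 1) + (`|de| + 1) + (kk / 2)^-1.
have M0 : 0 <= M by rewrite !addr_ge0 // invr_ge0 divr_ge0 // ltW.
have k20 : 0 < kk / 2 by rewrite divr_gt0.
have big : \forall m \near U, M <= m.+1%:R.
  apply: ooU; have /andP[_ nM] := truncn_itv M0.
  exists (Num.truncn M) => // m /= hm; apply: (le_trans (ltW nM)).
  by rewrite ler_nat ltnS.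
have kbig : \forall i \near U, kk / 2 <= `|b' i| + `|c' i| + `|a' i - d' i|.
  have kk2 : kk / 2 < kk by rewrite ltr_pdivrMr // mulr_natr mulr2n ltrDl.
  by apply: filterS (cvgr_gt _ kl _ kk2) => i /ltW.
have i0 : 0 <= (kk / 2)^-1 by rewrite invr_ge0 ltW.
have [la lb lc ld _] : [/\ `|al| + 1 <= M, `|be| + 1 <= M, `|ga| + 1 <= M, `|de| + 1 <= M & (kk / 2)^-1 <= M].
  by apply: summands_le => //; rewrite addr_ge0.
have : \forall m \near U, has_loop m.+1%:R (u m).
  near=> m; exists (a' m), (b' m), (c' m), (d' m).
  have Mm : M <= m.+1%:R by near: m.
  split; first split.
  - by near: m.
  - by apply: le_trans Mm; apply: le_trans la; near: m; exact: bnd.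
  - by apply: le_trans Mm; apply: le_trans lb; near: m; exact: bnd.
  - by apply: le_trans Mm; apply: le_trans lc; near: m; exact: bnd.
  - by apply: le_trans Mm; apply: le_trans ld; near: m; exact: bnd.
  have km : kk / 2 <= `|b' m| + `|c' m| + `|a' m - d' m| by near: m.
  have Mi : (kk / 2)^-1 <= m.+1%:R by apply: le_trans Mm; rewrite /M lerDr !addr_ge0.
  apply: le_trans (ler_pM i0 (ltW k20) Mi km).
  by rewrite mulVf // gt_eqF.
by move=> /filter_ex [m]; exact: Hu.
Unshelve. all: by end_near. Qed.

Definition hor_invariant (A : set X) := forall x s, A x -> A (act x 1 s 0 1).

Lemma det_hor (s : R) : 1 * 1 - s * 0 = 1.
Proof. by ring. Qed.

Lemma det_diag (r : R) : r != 0 -> r * r^-1 - 0 * 0 = 1.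
Proof. by move=> r0; rewrite mulfV //; ring. Qed.

(** Suppose that every point of Om has an upper triangular loop. Sliding along the horocycle, one
    finds y in Om with a diagonal loop. The upper triangular loop at y (1 n; 0 1) must become
    diagonal when carried back to y, by [diag_upper_stab], so it is (q, n (q - q'); 0, q'). As its
    entries are bounded, q - q' tends to 0, and the limit loop is parabolic: this is impossible by
    [parabolic_stab]. *)
Lemma exists_nontriangular_loops N (Om : set X) : 0 < N -> (forall x, has_loop N x) ->
  Om !=set0 -> hor_invariant Om ->
  exists2 y, Om y & forall a b c d, bounded_loop N y a b c d -> c != 0.
Proof.
move=> N0 loops [y0 Oy0] inv; apply: contrapT => nex.
have tri y : Om y -> exists a b d, bounded_loop N y a b 0 d.
  move=> Oy; apply: contrapT => H; apply: nex; exists y => // a b c d L.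
  by apply/eqP => c0; apply: H; exists a, b, d; rewrite -c0.
have tri_neq y a b d : bounded_loop N y a b 0 d -> a != d.
  move=> [[f _ _ _ _] k]; apply/eqP => ad; move: k.
  by rewrite (parabolic_stab f ad) ad subrr normr0 !addr0 mulr0 ler10.
have [a [b [d L]]] := tri _ Oy0.
have ad := tri_neq _ _ _ _ L.
have [[f _ _ _ _] _] := L.
have da : d - a != 0 by rewrite subr_eq0 eq_sym.
pose y := act y0 1 (b / (d - a)) 0 1.
have fy : fixes y a 0 0 d.
  have := fixes_conj (det_hor (b / (d - a))) f; congr fixes; try ring.
  by field; rewrite da.
have Oy : Om y by exact: inv.
have H (n : nat) : exists q bb q', [/\ bounded_loop N (act y 1 n.+1%:R 0 1) q bb 0 q',
   bb = n.+1%:R * (q - q') & q != q'].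
  have [q [bb [q' Ln]]] := tri _ (inv _ n.+1%:R Oy).
  exists q, bb, q'; split=> //; last exact: tri_neq Ln.
  have [[fn _ _ _ _] _] := Ln.
  have h := fixes_act (det_hor n.+1%:R) fn.
  have {}h : fixes y q (bb - n.+1%:R * (q - q')) 0 q' by move: h; congr fixes; ring.
  by apply/eqP; rewrite -subr_eq0; apply/eqP; exact: diag_upper_stab fy ad h.
have /choice [q Hq] : forall n : nat, exists q : R * R * R,
  [/\ bounded_loop N (act y 1 n.+1%:R 0 1) q.1.1 q.1.2 0 q.2,
   q.1.2 = n.+1%:R * (q.1.1 - q.2) & q.1.1 != q.2].
  by move=> n; have [u [v [w h]]] := H n; exists (u, v, w).
have [U [UU ooU]] := free_ultrafilter.
have PU := @ultra_proper _ _ UU.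
have [z yz] := ultra_cvgX UU (fun n : nat => act y 1 n.+1%:R 0 1).
have [|a1 [b1 [c1 [d1 [f1 a1l b1l c1l d1l]]]]] := @fixes_bounded_cvg _ _ UU
   (fun n : nat => act y 1 n.+1%:R 0 1)
   (fun n => (q n).1.1) (fun n => (q n).1.2) (fun n => 0) (fun n => (q n).2) z N yz.
  by apply: filterE => n; have [[]] := Hq n.
have c10 : c1 = 0 by apply: (cvg_unique (@Rhausdorff R) c1l); exact: cvg_cst.
have ad1 : a1 = d1.
  apply/eqP; rewrite -subr_eq0; apply/eqP.
  have adl : (fun n => (q n).1.1 - (q n).2) @ U --> a1 - d1 by exact: cvgB.
  apply: (cvg_unique (@Rhausdorff R) adl).
  rewrite -(mulr0 b1).
  have hl : (fun n => (q n).1.2 * n.+1%:R^-1) @ U --> b1 * 0.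
    by apply: cvgM => // A nA; apply: ooU; exact: cvg_harmonic nA.
  apply: cvg_trans hl; apply: near_eq_cvg; apply: filterE => n.
  have [_ -> _] := Hq n; field.
  by rewrite nat1r pnatr_eq0.
rewrite c10 in f1.
have b10 := parabolic_stab f1 ad1.
have : 1 <= N * (`|b1| + `|a1 - d1|).
  apply: (@closed_cvg _ _ U _ (fun n => N * (`|(q n).1.2| + `|(q n).1.1 - (q n).2|)) [set t | 1 <= t]).
  - exact: closed_ge.
  - by apply: filterE => n; have [[_]] := Hq n; rewrite normr0 addr0.
  - apply: cvgM; first exact: cvg_cst.
    by apply: cvgD; apply: cvg_norm => //; apply: cvgB.
by rewrite b10 ad1 subrr normr0 addr0 mulr0 ler10.
Qed.

(** Zorn's lemma on the complements; the union of a chain of complements does not cover Z because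
    Z is compact. *)
Lemma exists_minimal (Z : set X) : closed Z -> Z !=set0 -> hor_invariant Z ->
  exists A : set X, [/\ closed A, A !=set0, hor_invariant A, A `<=` Z &
    forall B : set X, closed B -> B !=set0 -> hor_invariant B -> B `<=` A -> A `<=` B].
Proof.
move=> cZ [z0 Zz0] iZ.
pose P (W : set X) := [/\ open W, hor_invariant (~` W) & (Z `\` W) !=set0] \/ W = set0.
have [|W [PW maxW]] := @Zorn_bigcup X P.
  move=> F FP tot.
  have [nF|/set0P [W0 FW0]] := eqVneq (\bigcup_(W in F) W) set0.
    by right.
  left.
  have opF W : F W -> open W by move=> /FP [[]//|->]; exact: open0.
  have invF W : F W -> hor_invariant (~` W) by move=> /FP [[]//|->] x s _ [].
  split.
  - exact: bigcup_open.
  - move=> x s nx [W FW Wx]; apply: (invF _ FW x s) => // Wx'.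
    by apply: nx; exists W.
  apply: contrapT => H.
  have cov x : Z x -> exists2 W, F W & W x.
    move=> Zx; apply: contrapT => nW; apply: H; exists x; split=> //.
  have cptZ : compact Z by apply: subclosed_compact X_compact _.
  have [W1 FW1 _] := cov _ Zz0.
  (* the complements of the members of the chain generate a filter *)
  pose G := filter_from F (fun W => Z `\` W).
  have FG : ProperFilter G.
    apply: filter_from_proper; last first.
      move=> W FW; have [[_ _ //]|->] := FP _ FW.
      by exists z0; split.
    apply: filter_from_filter; first by exists W1.
    move=> W W' FW FW'; have [WW|WW] := tot _ _ FW FW'.
      by exists W' => // x [Zx nW]; split; split=> // /WW.
    by exists W => // x [Zx nW]; split; split=> // /WW.
  have [|x [Zx clx]] := cptZ G FG.
    by exists W1 => // x [].
  have [W FW Wx] := cov _ Zx.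
  have nW : nbhs x W by apply: open_nbhs_nbhs; split=> //; exact: opF.
  have GW : G (Z `\` W) by exists W.
  by have [y [[_ nWy] Wy]] := clx _ _ GW nW.
have {}PW : [/\ open W, hor_invariant (~` W) & (Z `\` W) !=set0].
  case: PW => // ->; split; [exact: open0 | by move=> x s _ [] | by exists z0; split].
case: PW => oW iW neW; exists (Z `\` W); split=> //.
- by rewrite setDE; apply: closedI => //; exact: open_closedC.
- by move=> x s [Zx Wx]; split; [exact: iZ | exact: iW].
move=> B cB [b Bb] iB BZ x [Zx nWx]; apply: contrapT => nBx.
have sub : W `<=` ~` B by move=> y Wy /BZ [].
apply: (maxW (~` B)); first by split=> //; move=> /(_ x nBx).
left; split; first exact: closed_openC.
  by rewrite setCK.
by exists b; split=> //; have [] := BZ _ Bb.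
Qed.

Lemma act_diag_hor x (r s : R) : r != 0 ->
  act (act x 1 s 0 1) r 0 0 r^-1 = act (act x r 0 0 r^-1) 1 (s / r ^+ 2) 0 1.
Proof.
move=> r0; rewrite (actM _ (det_hor _) (det_diag r0)) (actM _ (det_diag r0) (det_hor _)).
by congr act; field.
Qed.

Lemma act_continuous (a b c d : R) : a * d - b * c = 1 -> continuous (fun x => act x a b c d).
Proof.
move=> h x; apply: (act_cvg _ cvg_id (cvg_cst _) (cvg_cst _) (cvg_cst _) (cvg_cst _)).
exact: filterE.
Qed.

(** A diagonal matrix normalizes the horocycle flow, so the points of A that it keeps in A form a
    closed invariant subset of A. *)
Lemma minimal_diag (A : set X) (r : R) x : r != 0 -> closed A -> hor_invariant A ->
  (forall B : set X, closed B -> B !=set0 -> hor_invariant B -> B `<=` A -> A `<=` B) ->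
  A x -> A (act x r 0 0 r^-1) -> forall y, A y -> A (act y r 0 0 r^-1).
Proof.
move=> r0 cA iA minA Ax Axr y Ay.
suff /(_ y Ay) [] : A `<=` (A `&` [set z | A (act z r 0 0 r^-1)]) by [].
apply: minA.
- apply: closedI => //; apply: closed_comp => // z _.
  exact: act_continuous (det_diag r0) z.
- by exists x.
- move=> z s [Az Azr]; split; first exact: iA.
  by rewrite /= act_diag_hor //; exact: iA.
- by move=> z [].
Qed.

Lemma sqrt_scale n : let r := Num.sqrt n.+1%:R : R in r != 0 /\ r ^+ 2 = n.+1%:R.
Proof.
have h : (0 : R) < n.+1%:R by rewrite ltr0n.
split; last by rewrite sqr_sqrtr // ltW.
by rewrite sqrtr_eq0 -ltNge.
Qed.

(** Among the limits of points of A pushed by the diagonal matrices of entries r_n, 1/r_n, choose one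
    whose loop (a b; c d) has c different from 0. At the points x_n of A the loops read
    (a_n, b_n r_n^2; c_n / r_n^2, d_n), and after sliding x_n by (a - l) r_n^2 / c along its horocycle
    the upper left entry tends to l and the lower left one to 0. Multiplied by a
    unipotent matrix, such a loop becomes lower triangular and maps a point of A to a point of its
    horocycle; in the limit, the diagonal matrix of entries l, 1/l maps a point of A into A. *)
Lemma minimal_diag_invariant (A : set X) : closed A -> A !=set0 -> hor_invariant A ->
  (forall B : set X, closed B -> B !=set0 -> hor_invariant B -> B `<=` A -> A `<=` B) ->
  forall x r, r != 0 -> A x -> A (act x r 0 0 r^-1).
Proof.
move=> cA [x0 Ax0] iA minA.
have [N N0 loops] := uniform_loops.
have [U [UU ooU]] := free_ultrafilter.
have PU := @ultra_proper _ _ UU.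
pose r n : R := Num.sqrt n.+1%:R.
have r0 n : r n != 0 by have [] := sqrt_scale n.
have rr n : r n ^+ 2 = n.+1%:R by have [] := sqrt_scale n.
pose Om : set X := [set y : X | exists2 x_ : nat -> X, (forall n, A (x_ n)) &
   (fun n => act (x_ n) (r n) 0 0 (r n)^-1) @ U --> y].
have [||y [x_ Ax_ xy] Ly] := @exists_nontriangular_loops N Om N0 loops.
- have [y xy] := ultra_cvgX UU (fun n => act x0 (r n) 0 0 (r n)^-1).
  by exists y, (fun=> x0).
- move=> y s [x_ Ax_ xy].
  exists (fun n => act (x_ n) 1 (s * r n ^+ 2) 0 1); first by move=> n; exact: iA.
  have : (fun n => act (act (x_ n) (r n) 0 0 (r n)^-1) 1 s 0 1) @ U --> act y 1 s 0 1.
    apply: (act_cvg _ xy (cvg_cst _) (cvg_cst _) (cvg_cst _) (cvg_cst _)).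
    by apply: filterE => n; exact: det_hor.
  apply: cvg_trans; apply: near_eq_cvg; apply: filterE => n /=.
  by rewrite act_diag_hor // mulfK // expf_neq0.
have [|a_ [b_ [c_ [d_ [a [b [c [d [L Lyk [aa bb cc dd]]]]]]]]]] :=
    @has_loop_limit _ U UU _ _ N xy.
  exact: filterE.
have c0 := Ly _ _ _ _ Lyk.
move=> x l l0 Ax.
pose sg := (a - l) / c.
pose x'_ n := act (x_ n) 1 (sg * r n ^+ 2) 0 1.
have Ax'_ n : A (x'_ n) by exact: iA.
pose al n := a_ n - sg * c_ n.
pose ga n := c_ n / n.+1%:R.
have fx' : \forall n \near U, exists be de, fixes (x'_ n) (al n) be (ga n) de.
  apply: filterS L => n [[f _ _ _ _] _].
  have f1 := fixes_act (det_diag (r0 n)) f.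
  have f2 := fixes_conj (det_hor (sg * r n ^+ 2)) f1.
  eexists; eexists; move: f2; congr fixes; rewrite /al /ga -?rr; field; exact: r0.
have all : al @ U --> l.
  rewrite (_ : l = a - sg * c); last by rewrite /sg; field.
  by apply: cvgB => //; apply: cvgM => //; exact: cvg_cst.
have gal : ga @ U --> 0.
  rewrite -(mulr0 c); apply: cvgM => // B nB; apply: ooU; exact: cvg_harmonic nB.
have al0 : \forall n \near U, al n != 0 by exact: (cvgr_neq0 l all).
have [x' x'l] := ultra_cvgX UU x'_.
have Ax' : A x' by apply: (@closed_cvg _ _ U _ x'_ A cA _ _ x'l); exact: filterE.
have Ax'l : A (act x' l 0 0 l^-1).
  have alV : (fun n => (al n)^-1) @ U --> l^-1 by exact: cvgV.
  have hl : (fun n => act (x'_ n) (al n) 0 (ga n) (al n)^-1) @ U --> act x' l 0 0 l^-1.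
    apply: (act_cvg _ x'l all (cvg_cst 0) gal alV).
    by apply: filterS al0 => m h; rewrite mulfV // mul0r subr0.
  apply: (@closed_cvg _ _ U _ _ A cA _ _ hl).
  apply: filterS2 al0 fx' => n an0 [be [de [hdet hf]]].
  have : A (act (x'_ n) 1 (- be / al n) 0 1) by exact: iA.
  rewrite -{1}hf (actM _ hdet (det_hor _)).
  rewrite (_ : _ * (- be / al n) + _ = 0); last by field.
  rewrite (_ : _ * (- be / al n) + _ = (al n)^-1); last first.
    by apply: (mulfI an0); rewrite mulfV // -[RHS]hdet; field.
  by rewrite !mulr1 !mulr0 !addr0.
exact: minimal_diag Ax' Ax'l _ Ax.
Qed.

Definition diag_invariant (A : set X) :=
  forall x r, r != 0 -> A x -> A (act x r 0 0 r^-1).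

(** By the Bruhat decomposition, a loop with c different from 0 is the product of (1 a/c; 0 1), of
    (0 -1; 1 0) and of an upper triangular matrix T; the point in question is therefore x T^-1. *)
Lemma fixes_weyl (A : set X) x a b c d : hor_invariant A -> diag_invariant A ->
  A x -> fixes x a b c d -> c != 0 -> A (act (act x 1 (a / c) 0 1) 0 (- 1) 1 0).
Proof.
move=> iA dA Ax [h e] c0.
have detw : 0 * 0 - (- 1) * 1 = 1 :> R by ring.
have -> : act (act x 1 (a / c) 0 1) 0 (- 1) 1 0 = act (act x 1 (- d / c) 0 1) c^-1 0 0 c^-1^-1.
  rewrite -{2}e.
  rewrite (actM _ (det_hor _) detw) (actM _ h (det_hor _)).
  rewrite actM; last first.
  - by rewrite det_diag // invr_neq0.
  - by rewrite -[RHS]h; field.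
  congr act; try by field.
  by transitivity (- (a * d - b * c)); [rewrite h; ring | field].
by apply: dA; [rewrite invr_neq0 | exact: iA].
Qed.

Lemma act_hor_cvg (x : X) (U : set_system nat) (PU : ProperFilter U) (s_ : nat -> R) (s : R) :
  s_ @ U --> s -> (fun n => act (act x 1 (s_ n) 0 1) 0 (- 1) 1 0) @ U --> act (act x 1 s 0 1) 0 (-1) 1 0.
Proof.
move=> sl.
apply: (act_cvg _ _ (cvg_cst _) (cvg_cst _) (cvg_cst _) (cvg_cst _)); last first.
  by apply: filterE => n; ring.
apply: (act_cvg _ (cvg_cst _) (cvg_cst _) sl (cvg_cst _) (cvg_cst _)).
by apply: filterE => n; exact: det_hor.
Qed.

Lemma lower_pow x a c d n : fixes x a 0 c d -> a != d ->
  fixes x (a ^+ n) 0 (c * (a ^+ n - d ^+ n) / (a - d)) (d ^+ n).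
Proof.
move=> f ad; have ad0 : a - d != 0 by rewrite subr_eq0.
elim: n => [|n IH].
  by rewrite !expr0 subrr mulr0 mul0r; split; [ring | exact: act1].
have := fixes_mul f IH; congr fixes; rewrite ?exprS; try ring.
by field.
Qed.

(** Pushing x by the diagonal matrices of entries r_n, 1/r_n with r_n^2 = 1/(n+1) gives at x loops
    (a_n, b_n / (n+1); c_n (n+1), d_n). By [fixes_weyl] it suffices to find loops (a b; c d) at x
    with a/c arbitrarily small. If c_n (n+1) is unbounded, these loops do. If it is bounded, the limit
    is a lower triangular loop, not diagonal by assumption, and its powers do. *)
Lemma weyl_invariant_nodiag (A : set X) x : closed A -> hor_invariant A ->
  diag_invariant A -> A x -> (forall p p', fixes x p 0 0 p' -> p = p') ->
  A (act x 0 (- 1) 1 0).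
Proof.
move=> cA iA dA Ax nodiag.
have [N N0 loops] := uniform_loops.
have [U [UU ooU]] := free_ultrafilter.
have PU := @ultra_proper _ _ UU.
pose r n : R := (Num.sqrt n.+1%:R)^-1.
have r0 n : r n != 0 by have [] := sqrt_scale n; rewrite invr_eq0.
have rr n : r n ^+ 2 = n.+1%:R^-1 by have [_] := sqrt_scale n; rewrite exprVn => ->.
have nE n : n.+1%:R = (r n ^+ 2)^-1 by rewrite rr invrK.
clearbody r.
have [y xy] := ultra_cvgX UU (fun n => act x (r n) 0 0 (r n)^-1).
have [|a_ [b_ [c_ [d_ [a [b [c [d [L Ly [aa bb cc dd]]]]]]]]]] :=
    @has_loop_limit _ U UU _ _ N xy.
  exact: filterE.
pose ga n := c_ n * n.+1%:R.
pose be n := b_ n / n.+1%:R.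
have fx n : bounded_loop N (act x (r n) 0 0 (r n)^-1) (a_ n) (b_ n) (c_ n) (d_ n) ->
    fixes x (a_ n) (be n) (ga n) (d_ n).
  move=> [[f _ _ _ _] _]; have := fixes_act (det_diag (r0 n)) f.
  congr fixes; rewrite /be /ga ?nE; field; exact: r0.
have closing (s_ : nat -> R) : s_ @ U --> 0 ->
    (\forall n \near U, A (act (act x 1 (s_ n) 0 1) 0 (- 1) 1 0)) -> A (act x 0 (- 1) 1 0).
  move=> s0 As; have h := @act_hor_cvg x U PU _ 0 s0.
  by rewrite act1 in h; exact: (closed_cvg _ cA As _ h).
have [bdd|unb] := pselect (exists K, \forall n \near U, `|ga n| <= K); last first.
  apply: (closing (fun n => a_ n / ga n)).
    apply/cvgr0Pnorm_le => /= e e0.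
    have : \forall n \near U, ~ (`|ga n| <= N / e).
      by case: (in_ultra_setVsetC [set n | `|ga n| <= N / e] UU) => // h; case: unb; exists (N / e).
    apply: filterS2 L => n [[_ an _ _ _] _] /negP; rewrite -ltNge => lt.
    have g0 : 0 < `|ga n| by apply: le_lt_trans lt; rewrite divr_ge0 // ltW.
    rewrite normrM normfV ler_pdivrMr //; apply: le_trans an _.
    by rewrite -ler_pdivrMl // mulrC ltW.
  have : \forall n \near U, ~ (`|ga n| <= 0).
    by case: (in_ultra_setVsetC [set n | `|ga n| <= 0] UU) => // h; case: unb; exists 0.
  apply: filterS2 L => n /fx f /negP; rewrite normr_le0 => g0.
  exact: fixes_weyl f g0.
case: bdd => K bdd.
have [C _ gaC] := @ultra_cvg_bounded _ U UU R ga K bdd.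
have be0 : be @ U --> 0.
  rewrite -(mulr0 b); apply: cvgM => // B nB; apply: ooU; exact: cvg_harmonic nB.
have flim : fixes x a 0 C d.
  apply: (fixes_cvg _ (cvg_cst x) aa be0 gaC dd).
  by apply: filterS L => n /fx.
have c0 : c = 0.
  apply: (cvg_unique (@Rhausdorff R) cc); rewrite -(mulr0 C).
  have hl : (fun n => ga n * n.+1%:R^-1) @ U --> C * 0.
    by apply: cvgM => // B nB; apply: ooU; exact: cvg_harmonic nB.
  apply: cvg_trans hl; apply: near_eq_cvg; apply: filterE => n.
  by rewrite /ga mulfK // pnatr_eq0.
have ad : a != d.
  have [[fy _ _ _ _] k] := Ly; apply/eqP => ad; rewrite c0 in fy.
  move: k; rewrite (parabolic_stab fy ad) c0 ad subrr !normr0 !addr0 mulr0.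
  by rewrite ler10.
have [C0|C0] := eqVneq C 0.
  by rewrite C0 in flim; move: ad; rewrite (nodiag _ _ flim) eqxx.
have [h _] := flim; rewrite mul0r subr0 in h.
have a0 : a != 0 by apply/eqP => a0; move/eqP: h; rewrite a0 mul0r eq_sym oner_eq0.
have d0 : d != 0 by apply/eqP => d0; move/eqP: h; rewrite d0 mulr0 eq_sym oner_eq0.
(* of the loop and its inverse, one has an upper left entry of norm < 1 *)
have [al [de [ga' [f hl g0 al1]]]] : exists al de ga', [/\ fixes x al 0 ga' de,
   al * de = 1, ga' != 0 & `|al| < 1].
  have [a1|a1] := ltP `|a| 1; first by exists a, d, C.
  exists d, a, (- C); split.
  - by have := fixes_inv flim; rewrite oppr0.
  - by rewrite mulrC.
  - by rewrite oppr_eq0.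
  have e1 : `|a| * `|d| = 1 by rewrite -normrM h normr1.
  rewrite ltNge; apply/negP => d1.
  have a1' : `|a| = 1.
    apply/eqP; rewrite eq_le a1 andbT -e1 -{1}[`|a|]mulr1 ler_wpM2l //.
  have : a ^+ 2 = 1 by rewrite -real_normK ?num_real // a1' expr1n.
  rewrite expr2 -h => /(mulfI a0) /eqP; by rewrite (negbTE ad).
have al0 : al != 0 by apply/eqP => al0; move/eqP: hl; rewrite al0 mul0r eq_sym oner_eq0.
have alde : al != de.
  apply/eqP => ee; have /eqP : `|al| * `|al| = 1 by rewrite -normrM {2}ee hl normr1.
  rewrite lt_eqF // -[ltRHS](mulr1 1) ltr_pM //.
have deE : de = al^-1 by apply: (mulfI al0); rewrite hl mulfV.
have ad0 : al - de != 0 by rewrite subr_eq0.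
have aln0 (n : nat) : al ^+ n != 0 by rewrite expf_neq0.
have aln1 (n : nat) : (0 < n)%N -> al ^+ (n * 2) - 1 != 0.
  move=> n0; rewrite subr_eq0; apply/eqP => e1.
  have : `|al| ^+ (n * 2) < 1 by rewrite exprn_ilt1 // muln_eq0 negb_or -lt0n n0.
  by rewrite -normrX e1 normr1 ltxx.
(* the quotient of the entries of the first column of the n-th power of the loop *)
apply: (closing (fun n => al ^+ (n * 2) * (al - de) / (ga' * (al ^+ (n * 2) - 1)))); last first.
  apply: ooU; exists 1%N => // n /= n1.
  have fn := lower_pow n f alde.
  have an1 := aln1 n n1; rewrite exprM in an1.
  have an0 := aln0 n.
  have deN : de ^+ n = (al ^+ n)^-1 by rewrite deE exprVn.
  rewrite deN in fn.
  have := fixes_weyl iA dA Ax fn.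
  have t0 : al ^+ n - (al ^+ n)^-1 != 0.
    rewrite (_ : _ - _ = (al ^+ n ^+ 2 - 1) / al ^+ n); last by field.
    by rewrite mulf_neq0 // invr_neq0.
  have gn0 : ga' * (al ^+ n - (al ^+ n)^-1) / (al - de) != 0.
    by rewrite !mulf_neq0 // invr_neq0.
  move=> /(_ gn0).
  rewrite (_ : al ^+ n / _ = al ^+ (n * 2) * (al - de) / (ga' * (al ^+ (n * 2) - 1))) //.
  rewrite exprM; field.
  rewrite an1 g0 ad0 /= ?andbT; by rewrite ?an0 ?an1.
have al2 : (fun n => al ^+ (n * 2)) @ U --> 0.
  have h2 : `|al ^+ 2| < 1 by rewrite normrX exprn_ilt1.
  rewrite (_ : (fun n => _) = (fun n => (al ^+ 2) ^+ n)); last first.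
    by apply/funext => n; rewrite mulnC exprM.
  by move=> B nB; apply: ooU; exact: (cvg_expr h2) nB.
rewrite -(mul0r ((al - de) / (ga' * (0 - 1)))).
under eq_fun do rewrite -mulrA.
apply: cvgM => //; apply: cvgM; first exact: cvg_cst.
apply: cvgV; first by rewrite sub0r mulrN1 oppr_eq0.
apply: cvgM; first exact: cvg_cst.
by apply: cvgB => //; exact: cvg_cst.
Qed.

(** If x has a diagonal loop, then x (1 s; 0 1) has none for s different from 0, by
    [diag_upper_stab]; let s tend to 0. *)
Lemma weyl_invariant (A : set X) : closed A -> hor_invariant A ->
  diag_invariant A -> forall x, A x -> A (act x 0 (- 1) 1 0).
Proof.
move=> cA iA dA x Ax.
have [nodiag|] := pselect (forall p p', fixes x p 0 0 p' -> p = p').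
  exact: weyl_invariant_nodiag.
move=> /existsNP[p /existsNP[p' /not_implyP[fp /eqP pp']]].
have [U [UU ooU]] := free_ultrafilter.
have PU := @ultra_proper _ _ UU.
have s0 : (fun n : nat => n.+1%:R^-1 : R) @ U --> 0.
  by move=> B nB; apply: ooU; exact: cvg_harmonic nB.
have := @act_hor_cvg x U PU _ 0 s0; rewrite act1 => h.
apply: (closed_cvg A cA _ _ h); apply: filterE => n.
apply: weyl_invariant_nodiag => //; first exact: iA.
move=> q q' fq; have := fixes_act (det_hor n.+1%:R^-1) fq.
move=> fq'; have {}fq' : fixes x q (n.+1%:R^-1 * (q' - q)) 0 q'.
  by move: fq'; congr fixes; ring.
have /eqP := diag_upper_stab fp pp' fq'.
by rewrite mulf_eq0 invr_eq0 pnatr_eq0 /= subr_eq0 => /eqP ->.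
Qed.

(** By the Bruhat decomposition, these matrices generate SL(2, R). *)
Lemma diag_hor_act_invariant (A : set X) : hor_invariant A -> diag_invariant A ->
  (forall x, A x -> A (act x 0 (- 1) 1 0)) ->
  forall x a b c d, a * d - b * c = 1 -> A x -> A (act x a b c d).
Proof.
move=> iA dA wA x a b c d h Ax.
have detw : 0 * 0 - (- 1) * 1 = 1 :> R by ring.
have [c0|c0] := eqVneq c 0.
  have hd : a * d = 1 by rewrite -h c0; ring.
  have a0 : a != 0 by apply/eqP => a0; move/eqP: hd; rewrite a0 mul0r eq_sym oner_eq0.
  have := iA _ (b / a) (dA _ _ a0 Ax).
  rewrite (actM _ (det_diag a0) (det_hor _)) c0.
  have dE : d = a^-1 by apply: (mulfI a0); rewrite hd mulfV.
  by congr A; congr act; rewrite ?dE; field.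
have := iA _ (d / c) (dA _ _ c0 (wA _ (iA _ (a / c) Ax))).
rewrite (actM _ (det_hor _) detw) actM ?det_diag //; [|by ring..].
rewrite actM ?det_hor //; [|by field..].
congr A; congr act; try by field.
by rewrite (_ : b = (a * d - 1) / c); [field | rewrite -h; field].
Qed.

Theorem horocycle_orbits_dense x (W : set X) : open W -> W !=set0 ->
  exists s, W (act x 1 s 0 1).
Proof.
move=> oW W0.
pose Z := closure [set act x 1 s 0 1 | s in [set: R]].
have [|||A [cA A0 iA AZ minA]] := @exists_minimal Z.
- exact: closed_closure.
- by exists (act x 1 0 0 1); apply: subset_closure; exists 0.
- move=> y s Zy B nB.
  have nB' : nbhs y ((fun z => act z 1 s 0 1) @^-1` B).
    exact: (act_continuous (det_hor s)).
  have [_ [[t _ <-] Bt]] := Zy _ nB'.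
  exists (act x 1 (t + s) 0 1); split; first by exists (t + s).
  move: Bt; rewrite /= (actM _ (det_hor _) (det_hor _)).
  by congr B; congr act; ring.
have dA : diag_invariant A by move=> y r r0; exact: minimal_diag_invariant.
have wA := weyl_invariant cA iA dA.
have [y Ay] := A0.
have [a [b [c [d [h Wy]]]]] := orbits_dense y oW W0.
have Zy : Z (act y a b c d) by apply: AZ; exact: diag_hor_act_invariant.
have [_ [[s _ <-] Ws]] := Zy W (open_nbhs_nbhs (conj oW Wy)).
by exists s.
Qed.

End SL2Action.

(** * Differential calculus *)

Section Calculus.
Context {R : realType}.

Lemma is_derive_line (V W : normedModType R) (f : V -> W) (z v : V) (s : R) df :
  is_derive (z + s *: v) v f df ->
  is_derive s (1 : R) (fun t : R => f (z + t *: v)) df.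
Proof.
have e : (fun h : R => h^-1 *: (((fun t : R => f (z + t *: v)) \o shift s) (h *: 1) - f (z + s *: v)))
   = (fun h : R => h^-1 *: ((f \o shift (z + s *: v)) (h *: v) - f (z + s *: v))).
  apply/funext => h /=; rewrite /shift /= scaler1.
  by rewrite scalerDl addrCA.
move=> [d1 d2]; split; first by rewrite /derivable e; exact: d1.
by rewrite /derive e; exact: d2.
Qed.

Lemma MVT_line (V : normedModType R) (f : V -> R) (z v : V) (k : R) :
  (forall s : R, `|s| <= `|k| -> derivable f (z + s *: v) v) ->
  exists2 s : R, `|s| <= `|k| & f (z + k *: v) - f z = k * 'D_v f (z + s *: v).
Proof.
move=> H.
have D s : `|s| <= `|k| -> is_derive s (1 : R) (fun t : R => f (z + t *: v)) ('D_v f (z + s *: v)).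
  by move=> /H /derivableP /is_derive_line.
have C (a b : R) : (forall s, a <= s <= b -> `|s| <= `|k|) ->
    {within `[a, b], continuous (fun t : R => f (z + t *: v))}.
  move=> ab; apply: derivable_within_continuous => s; rewrite in_itv /= => /ab /D [] //.
have [k0|k0] := leP 0 k.
  have kk s : 0 <= s <= k -> `|s| <= `|k|.
    by move=> /andP[s0 sk]; rewrite !ger0_norm.
  have [||s] := @MVT_segment R (fun t : R => f (z + t *: v)) (fun s => 'D_v f (z + s *: v)) 0 k k0.
  - by move=> s; rewrite in_itv /= => /andP[/ltW s0 /ltW sk]; apply: D; apply: kk; rewrite s0.
  - exact: C.
  rewrite in_itv /= => /kk sk; rewrite scale0r addr0 subr0 mulrC => e.
  by exists s.
have kk s : k <= s <= 0 -> `|s| <= `|k|.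
  by move=> /andP[s0 sk]; rewrite !ler0_norm ?(ltW k0) // lerN2.
have [||s] := @MVT_segment R (fun t : R => f (z + t *: v)) (fun s => 'D_v f (z + s *: v)) k 0 (ltW k0).
- by move=> s; rewrite in_itv /= => /andP[/ltW s0 /ltW sk]; apply: D; apply: kk; rewrite s0.
- exact: C.
rewrite in_itv /= => /kk sk; rewrite scale0r addr0 sub0r mulrN => /eqP; rewrite -eqr_oppLR opprB mulrC => /eqP e.
by exists s => //; rewrite -[LHS]opprB -e opprK.
Qed.

Lemma increment_le (f f' : R -> R) (s C : R) : 0 <= s ->
  (forall r, 0 <= r <= s -> is_derive r (1 : R) f (f' r)) ->
  (forall r, 0 <= r <= s -> `|f' r| <= C) -> `|f s - f 0| <= C * s.
Proof.
move=> s0 d b.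
have [||c] := @MVT_segment R f f' 0 s s0.
- by move=> r; rewrite in_itv /= => /andP[/ltW r0 /ltW rs]; apply: d; rewrite r0.
- apply: derivable_within_continuous => r; rewrite in_itv /= => rs.
  by have [] := d _ rs.
rewrite in_itv /= subr0 => cs ->.
by rewrite normrM (ger0_norm s0) ler_wpM2r // b.
Qed.

Lemma differentiable_eps (V W : normedModType R) (f : V -> W) (x : V) (df : {linear V -> W}) :
  continuous df ->
  (forall e : R, 0 < e -> \forall h \near (0 : V), `|f (h + x) - f x - df h| <= e * `|h|) ->
  differentiable f x /\ 'd f x = df :> (V -> W).
Proof.
move=> cdf H.
have E : f \o shift x = cst (f x) + df +o_ (0 : V) id.
  apply/eqaddoP => e e0; have := H e e0; apply: filterS => h /=.
  by rewrite opprD addrA.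
have dE := diff_unique cdf E.
by split=> //; apply/diff_locallyP; rewrite dE.
Qed.

Lemma differentiable_nearW (V W : normedModType R) (f : V -> W) (x : V) :
  differentiable f x -> forall e : R, 0 < e ->
  \forall h \near (0 : V), `|f (h + x) - f x - 'd f x h| <= e * `|h|.
Proof.
move=> /diff_locallyP [_ /eqaddoP H] e e0; have := H e e0; apply: filterS => h /=.
by rewrite opprD addrA.
Qed.

Lemma near_eq_differentiable (V W : normedModType R) (f g : V -> W) (z : V) :
  (\forall y \near z, f y = g y) -> differentiable f z ->
  differentiable g z /\ 'd g z = 'd f z :> (V -> W).
Proof.
move=> fg df; apply: differentiable_eps.
  by apply: diff_continuous.
move=> e e0; have H := differentiable_nearW df e0.
have fz : f z = g z by exact: nbhs_singleton fg.
have fg' : \forall h \near (0 : V), f (h + z) = g (h + z).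
  have : (fun h : V => h + z) @ (0 : V) --> 0 + z.
    by apply: cvgD; [exact: cvg_id|exact: cvg_cst].
  by rewrite add0r => hz; exact: (hz _ fg).
by apply: filterS2 H fg' => h; rewrite fz => + <-.
Qed.

Lemma diff_is_derive (V W : normedModType R) (f : V -> W) (z v : V) :
  differentiable f z -> is_derive z v f ('D_v f z).
Proof. by move=> df; apply: derivableP; exact: diff_derivable. Qed.

Lemma is_derive_translate (V W : normedModType R) (f : V -> W) (y w u : V) (df : W) :
  is_derive (y + w) u f df -> is_derive y u (fun x => f (x + w)) df.
Proof.
have e : (fun h : R => h^-1 *: (((fun x => f (x + w)) \o shift y) (h *: u) - f (y + w)))
   = (fun h : R => h^-1 *: ((f \o shift (y + w)) (h *: u) - f (y + w))).
  by apply/funext => h /=; rewrite addrA.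
move=> [d1 d2]; split; first by rewrite /derivable e; exact: d1.
by rewrite /derive e; exact: d2.
Qed.

Lemma is_derive_proj (V W W' : normedModType R) (pr : {linear W -> W'}) (f : V -> W) (z v : V) (df : W) :
  continuous pr -> is_derive z v f df -> is_derive z v (pr \o f) (pr df).
Proof.
move=> cpr [d1 d2].
have h : (fun h : R => h^-1 *: ((f \o shift z) (h *: v) - f z)) @ 0^' --> df.
  by rewrite -d2; exact: d1.
have {}h : (fun h : R => h^-1 *: (((pr \o f) \o shift z) (h *: v) - (pr \o f) z)) @ 0^' --> pr df.
  rewrite (_ : (fun h => _) = pr \o (fun h : R => h^-1 *: ((f \o shift z) (h *: v) - f z))).
    by apply: continuous_cvg h; exact: cpr.
  by apply/funext => t; rewrite /comp -linearB -linearZ.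
by split; [apply/cvg_ex; exists (pr df) | exact: (cvg_lim _ h)].
Qed.

Lemma is_derive_comp_diff (V W W' : normedModType R) (g : W -> W') (f : V -> W) (z v : V) :
  differentiable g (f z) -> differentiable f z ->
  is_derive z v (g \o f) ('D_('D_v f z) g (f z)).
Proof.
move=> dg df; split; first by apply: diff_derivable; exact: differentiable_comp.
rewrite deriveE; last exact: differentiable_comp.
by rewrite diff_comp // /= -!deriveE.
Qed.

Lemma is_derive_mul (V : normedModType R) (f g : V -> R) (z v : V) (df dg : R) :
  is_derive z v f df -> is_derive z v g dg ->
  is_derive z v (fun x => f x * g x) (f z * dg + g z * df).
Proof. by move=> H1 H2; exact: is_deriveM. Qed.

Lemma is_derive_add (V : normedModType R) (f g : V -> R) (z v : V) (df dg : R) :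
  is_derive z v f df -> is_derive z v g dg ->
  is_derive z v (fun x => f x + g x) (df + dg).
Proof. by move=> H1 H2; exact: is_deriveD. Qed.

Lemma is_derive_inv (V : normedModType R) (f : V -> R) (z v : V) (df : R) :
  f z != 0 -> is_derive z v f df -> is_derive z v (fun x => (f x)^-1) (- (f z)^-1 * (f z)^-1 * df).
Proof.
move=> f0 [d1 d2]; split; first exact: derivableV.
by rewrite deriveV // d2 /GRing.scale /= expr2 invfM; ring.
Qed.

Section Pointwise.
Context {V : normedModType R} (z : V).

Lemma diffM (u v : V -> R) : differentiable u z -> differentiable v z ->
  differentiable (fun y => u y * v y) z.
Proof. by move=> du dv; exact: (differentiableM du dv). Qed.

Lemma diffD (u v : V -> R) : differentiable u z -> differentiable v z ->
  differentiable (fun y => u y + v y) z.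
Proof. by move=> du dv; exact: (differentiableD du dv). Qed.

Lemma diffN (u : V -> R) : differentiable u z -> differentiable (fun y => - u y) z.
Proof. by move=> du; exact: (differentiableN du). Qed.

Lemma diffC (k : R) : differentiable (fun _ : V => k) z.
Proof. exact: differentiable_cst. Qed.

End Pointwise.

End Calculus.

Section PlaneCalculus.
Context {R : realType}.
Local Notation e1 := ((1, 0) : plane R).
Local Notation e2 := ((0, 1) : plane R).

Lemma plane_decomp (v : plane R) : v = v.1 *: e1 + v.2 *: e2.
Proof.
by case: v => a b; apply: injective_projections; rewrite /= /GRing.scale /= !(mulr1, mulr0, addr0, add0r).
Qed.

Lemma derive_plane (W : normedModType R) (f : plane R -> W) (z v : plane R) :
  differentiable f z -> 'D_v f z = v.1 *: 'D_e1 f z + v.2 *: 'D_e2 f z.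
Proof.
by move=> df; rewrite !deriveE // {1}(plane_decomp v) linearD !linearZ.
Qed.

Lemma norm_plane (h : plane R) : `|h| = Num.max `|h.1| `|h.2|.
Proof. by []. Qed.

Lemma norm_fst_le (h : plane R) : `|h.1| <= `|h|.
Proof. by rewrite norm_plane le_max lexx. Qed.

Lemma norm_snd_le (h : plane R) : `|h.2| <= `|h|.
Proof. by rewrite norm_plane le_max lexx orbT. Qed.

Definition lin2 (W : normedModType R) (a b : W) (h : plane R) : W := h.1 *: a + h.2 *: b.

Lemma lin2_linear (W : normedModType R) (a b : W) : linear (lin2 a b).
Proof.
move=> k u v; rewrite /lin2 /= scalerDr !scalerDl !scalerA addrACA //.
Qed.

HB.instance Definition _ (W : normedModType R) (a b : W) :=
  GRing.isLinear.Build R (plane R) W *:%R (lin2 a b) (lin2_linear a b).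

Lemma lin2_continuous (W : normedModType R) (a b : W) : continuous (lin2 a b).
Proof.
by move=> h; apply: cvgD; apply: cvgZr_tmp || apply: cvgZl; solve [exact: cvg_fst|exact: cvg_snd].
Qed.

Lemma planeE (a b : R) : a *: e1 + b *: e2 = (a, b).
Proof. by rewrite [RHS]plane_decomp. Qed.

Lemma linear_error (h1 h2 k e d1 d1' d2 d2' c : R) : `|h1| <= k -> `|h2| <= k ->
  `|d1' - d1| <= e / 2 -> `|d2' - d2| <= e / 2 ->
  `|h2 * d2' + (h1 * d1' + c) - c - (h1 *: d1 + h2 *: d2)| <= e * k.
Proof.
move=> h1k h2k b1 b2; rewrite /GRing.scale /=.
rewrite (_ : _ - _ - _ = h1 * (d1' - d1) + h2 * (d2' - d2)); last by ring.
apply: le_trans (ler_normD _ _) _; rewrite !normrM.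
by rewrite [in leRHS](splitr e) mulrDl; apply: lerD; rewrite mulrC; exact: ler_pM.
Qed.

(** The mean value theorem is applied along the two sides of a rectangle. *)
Lemma differentiable_C1 (f : plane R -> R) (x : plane R) :
  (\forall y \near x, derivable f y e1) -> (\forall y \near x, derivable f y e2) ->
  {for x, continuous ('D_e1 f)} -> {for x, continuous ('D_e2 f)} ->
  differentiable f x.
Proof.
move=> d1 d2 c1 c2.
have [|//] := @differentiable_eps R _ _ f x (lin2 ('D_e1 f x) ('D_e2 f x)) (@lin2_continuous _ _ _).
move=> e e0.
have e20 : 0 < e / 2 by rewrite divr_gt0.
have near_all : \forall y \near x, [/\ derivable f y e1, derivable f y e2,
    `|'D_e1 f y - 'D_e1 f x| <= e / 2 & `|'D_e2 f y - 'D_e2 f x| <= e / 2].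
  have h1 : \forall y \near x, `|'D_e1 f y - 'D_e1 f x| <= e / 2.
    by move/cvgrPdist_le : c1 => /(_ _ e20); apply: filterS => y; rewrite distrC.
  have h2 : \forall y \near x, `|'D_e2 f y - 'D_e2 f x| <= e / 2.
    by move/cvgrPdist_le : c2 => /(_ _ e20); apply: filterS => y; rewrite distrC.
  by apply: filterS2 (filterI d1 d2) (filterI h1 h2) => y [? ?] [? ?].
move/nbhs_normP : near_all => [d /= d0 Hd].
apply/nbhs_normP; exists d => //= h; rewrite /ball_ /= sub0r normrN => hd.
have inb (a b : R) : `|a| <= `|h.1| -> `|b| <= `|h.2| -> ball_ Num.norm x d (x + a *: e1 + b *: e2).
  move=> ah bh; rewrite /ball_ /= -addrA opprD addNKr normrN.
  rewrite planeE norm_plane /= gt_max.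
  by rewrite (le_lt_trans ah (le_lt_trans (norm_fst_le h) hd)) (le_lt_trans bh (le_lt_trans (norm_snd_le h) hd)).
have inb1 (a : R) : `|a| <= `|h.1| -> ball_ Num.norm x d (x + a *: e1).
  move=> ah; rewrite -[x + _]addr0 -(scale0r e2); apply: inb => //.
  by rewrite (normr0 R).
have [|s sh E1] := @MVT_line R _ f x e1 h.1.
  move=> s /inb1 /Hd [H1 _ _ _]; exact H1.
have [|t th E2] := @MVT_line R _ f (x + h.1 *: e1) e2 h.2.
  move=> t th; have [_ H1 _ _] := Hd _ (inb h.1 t (lexx _) th); exact H1.
have [_ _ B1 _] := Hd _ (inb1 s sh).
have [_ _ _ B2] := Hd _ (inb h.1 t (lexx _) th).
have hx : h + x = x + h.1 *: e1 + h.2 *: e2 by rewrite -addrA -plane_decomp addrC.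
rewrite hx (canRL (subrK _) E2) (canRL (subrK _) E1).
exact: (linear_error (f x) (norm_fst_le h) (norm_snd_le h) B1 B2).
Qed.

Lemma second_difference (V : normedModType R) (f : V -> R) (z u v : V) :
  (\forall y \near z, differentiable f y) -> differentiable ('D_u f) z ->
  forall e : R, 0 < e -> \forall h \near (0 : R),
  `|f (z + h *: u + h *: v) - f (z + h *: u) - (f (z + h *: v) - f z)
    - h ^+ 2 * 'D_v ('D_u f) z| <= e * h ^+ 2.
Proof.
move=> df ddf e e0.
(* s u + t v has norm at most M |h| when |s| and |t| are at most |h| *)
pose M := `|u| + `|v| + 1.
have M0 : 0 < M by rewrite ltr_wpDl // addr_ge0.
have e20 : 0 < e / (M + M) by rewrite divr_gt0 // addr_gt0.
have N1 := differentiable_nearW ddf e20.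
have N2 : \forall k \near (0 : V), differentiable f (k + z).
  by have := df; rewrite (near_shift (0 : V) z) /= subr0; apply: filterS => k; rewrite /= .
have [d /= d0 Hd] := iffLR (nbhs_normP _ _) (filterI N1 N2).
have dM : 0 < d / M by rewrite divr_gt0.
apply/nbhs_normP; exists (d / M) => //= h; rewrite /ball_ /= sub0r normrN => hd.
have inb (s t : R) : `|s| <= `|h| -> `|t| <= `|h| -> `|s *: u + t *: v| <= `|h| * M /\ `|s *: u + t *: v| < d.
  move=> sh th.
  have le : `|s *: u + t *: v| <= `|h| * M.
    apply: le_trans (ler_normD _ _) _; rewrite !normrZ /M !mulrDr mulr1.
    rewrite -[leLHS]addr0; apply: lerD => //; apply: lerD; exact: ler_wpM2r.
  by split=> //; apply: le_lt_trans le _; rewrite -ltr_pdivlMr.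
have inb' (s t : R) : `|s| <= `|h| -> `|t| <= `|h| ->
   `|'D_u f (z + s *: u + t *: v) - 'D_u f z - 'd ('D_u f) z (s *: u + t *: v)| <= e / (M + M) * (`|h| * M)
   /\ differentiable f (z + s *: u + t *: v).
  move=> sh th; have [le lt] := inb s t sh th.
  have [|A B] := Hd (s *: u + t *: v); first by rewrite /ball_ /= sub0r normrN.
  have -> : z + s *: u + t *: v = s *: u + t *: v + z by rewrite -addrA addrC.
  split; last exact: B.
  by apply: le_trans A _; rewrite ler_wpM2l // ltW.
have n0 : `|0 : R| <= `|h| by rewrite normr0.
pose g (y : V) := f (y + h *: v) - f y.
have Dg s : `|s| <= `|h| -> is_derive (z + s *: u) u g ('D_u f (z + s *: u + h *: v) - 'D_u f (z + s *: u)).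
  move=> sh; have [_ D1] := inb' s h sh (lexx _); have [_ D2] := inb' s 0 sh n0.
  rewrite scale0r addr0 in D2.
  apply: is_deriveB; last by apply: derivableP; apply: diff_derivable; exact: D2.
  by apply: is_derive_translate; apply: derivableP; apply: diff_derivable; exact: D1.
have [|s sh] := @MVT_line R V g z u h.
  by move=> s /Dg [].
have [_ ->] := Dg s sh.
rewrite /g => E.
rewrite [X in `|X - _|]E.
have [B1 _] := inb' s h sh (lexx _).
have [B2 _] := inb' s 0 sh n0.
rewrite scale0r !addr0 in B2.
have ddE : 'd ('D_u f) z (s *: u + h *: v) = 'd ('D_u f) z (s *: u) + h * 'D_v ('D_u f) z.
  by rewrite (deriveE _ ddf) linearD; congr (_ + _); rewrite linearZ.
rewrite ddE in B1.
move: B1 B2.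
set p := 'D_u f (_ + _ + _); set q := 'D_u f (_ + _); set r := 'D_u f z.
set L := 'd _ _ _; set D := 'D_v _ _.
move=> B1 B2.
rewrite (_ : _ - _ = h * ((p - r - (L + h * D)) - (q - r - L))); last by ring.
rewrite normrM.
have -> : e * h ^+ 2 = `|h| * (e / (M + M) * (`|h| * M) + e / (M + M) * (`|h| * M)).
  by rewrite -real_normK ?num_real //; field; rewrite -mulr2n mulrn_eq0 /= gt_eqF.
rewrite ler_wpM2l //; apply: le_trans (ler_normB _ _) _; exact: lerD.
Qed.

(** Both mixed derivatives are limits of the same second difference, estimated by the mean value
    theorem and by the linear parts of the first derivatives at the point. *)
Lemma derive_sym (V : normedModType R) (f : V -> R) (z u v : V) :
  (\forall y \near z, differentiable f y) -> differentiable ('D_u f) z ->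
  differentiable ('D_v f) z -> 'D_v ('D_u f) z = 'D_u ('D_v f) z.
Proof.
move=> df du dv; apply/eqP; rewrite -subr_eq0 -normr_le0; apply/ler_addgt0Pr => e e0.
rewrite add0r.
have e20 : 0 < e / 2 by rewrite divr_gt0.
have A := second_difference v df du e20; have B := second_difference u df dv e20.
have [d /= d0 Hd] := iffLR (nbhs_normP _ _) (filterI A B).
have d20 : 0 < d / 2 by rewrite divr_gt0.
have [|{}A {}B] := Hd (d / 2).
  by rewrite /ball_ /= sub0r normrN gtr0_norm // ltr_pdivrMr // mulr_natr mulr2n ltrDl.
move: A B; set h := d / 2.
rewrite (addrAC z (h *: v) (h *: u)).
set F := f (_ + _ + _); set p := f (_ + _); set q := f (_ + _); set r := f z.
set X := 'D_v _ _; set Y := 'D_u _ _ => A B.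
have : `|(F - p - (q - r) - h ^+ 2 * X) - (F - q - (p - r) - h ^+ 2 * Y)| <= e * h ^+ 2.
  apply: le_trans (ler_normB _ _) _; rewrite (splitr e) mulrDl.
  exact: (lerD A B).
rewrite (_ : _ - _ = h ^+ 2 * (Y - X)); last by ring.
by rewrite distrC normrM normrX gtr0_norm // mulrC ler_pM2r // exprn_gt0.
Qed.

Lemma is_derive_fst (V : normedModType R) (f : V -> plane R) (z v : V) (df : plane R) :
  is_derive z v f df -> is_derive z v (fun x => (f x).1) df.1.
Proof. by apply: (@is_derive_proj R _ _ _ (@fst R R)) => x; exact: cvg_fst. Qed.

Lemma is_derive_snd (V : normedModType R) (f : V -> plane R) (z v : V) (df : plane R) :
  is_derive z v f df -> is_derive z v (fun x => (f x).2) df.2.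
Proof. by apply: (@is_derive_proj R _ _ _ (@snd R R)) => x; exact: cvg_snd. Qed.

Lemma differentiable_fst (V : normedModType R) (f : V -> plane R) (z : V) :
  differentiable f z -> differentiable (fun x => (f x).1) z.
Proof.
move=> df; apply: (differentiable_comp df).
by apply: (@linear_differentiable _ _ _ (@fst R R)) => x; exact: cvg_fst.
Qed.

Lemma differentiable_snd (V : normedModType R) (f : V -> plane R) (z : V) :
  differentiable f z -> differentiable (fun x => (f x).2) z.
Proof.
move=> df; apply: (differentiable_comp df).
by apply: (@linear_differentiable _ _ _ (@snd R R)) => x; exact: cvg_snd.
Qed.

Lemma diff_id1 (z : plane R) : differentiable (fun y : plane R => y.1) z.
Proof. by apply: differentiable_fst; exact: ex_diff. Qed.

Lemma diff_id2 (z : plane R) : differentiable (fun y : plane R => y.2) z.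
Proof. by apply: differentiable_snd; exact: ex_diff. Qed.

Lemma differentiable_C1_plane (f : plane R -> plane R) (x : plane R) :
  (\forall y \near x, derivable f y e1) -> (\forall y \near x, derivable f y e2) ->
  {for x, continuous ('D_e1 f)} -> {for x, continuous ('D_e2 f)} ->
  differentiable f x.
Proof.
move=> d1 d2 c1 c2.
have H (pr : {linear plane R -> R}) : continuous pr -> differentiable (pr \o f) x.
  move=> cpr.
  have E1 v : (\forall y \near x, derivable f y v) ->
      \forall y \near x, derivable (pr \o f) y v /\ pr ('D_v f y) = 'D_v (pr \o f) y.
    by apply: filterS => y /derivableP /(is_derive_proj cpr) [A ->].
  have E2 v : (\forall y \near x, derivable f y v) -> {for x, continuous ('D_v f)} ->
      {for x, continuous ('D_v (pr \o f))}.
    move=> dv cv; have n := E1 v dv.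
    have e : 'D_v (pr \o f) x = pr ('D_v f x) by have [_ ->] := nbhs_singleton n.
    have h : (pr \o 'D_v f) @ x --> pr ('D_v f x) by apply: continuous_cvg; [exact: cpr|exact: cv].
    rewrite -e in h; apply: cvg_trans h; apply: near_eq_cvg.
    by apply: filterS n => y [_].
  apply: differentiable_C1; [| |exact: E2|exact: E2].
  - by apply: filterS (E1 _ d1) => y [].
  - by apply: filterS (E1 _ d2) => y [].
have := differentiable_pair (H (@fst R R) _) (H (@snd R R) _).
rewrite (_ : (fun y => _) = f); last by apply/funext => y /=; case: (f y).
by apply => y; [exact: cvg_fst | exact: cvg_snd].
Qed.

Lemma derive_sym_plane (f : plane R -> plane R) (z u v : plane R) :
  (\forall y \near z, differentiable f y) -> differentiable ('D_u f) z ->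
  differentiable ('D_v f) z -> 'D_v ('D_u f) z = 'D_u ('D_v f) z.
Proof.
move=> df du dv.
have pr1 w : \forall y \near z, ('D_w f y).1 = 'D_w (fun x => (f x).1) y.
  apply: filterS df => y /(diff_is_derive w) /is_derive_fst [_ ->] //.
have pr2 w : \forall y \near z, ('D_w f y).2 = 'D_w (fun x => (f x).2) y.
  apply: filterS df => y /(diff_is_derive w) /is_derive_snd [_ ->] //.
have df1 : \forall y \near z, differentiable (fun x => (f x).1) y.
  by apply: filterS df => y; exact: differentiable_fst.
have df2 : \forall y \near z, differentiable (fun x => (f x).2) y.
  by apply: filterS df => y; exact: differentiable_snd.
have D1 w w' : differentiable ('D_w f) z -> ('D_w' ('D_w f) z).1 = 'D_w' ('D_w (fun x => (f x).1)) z.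
  move=> dw; have /(diff_is_derive w') /is_derive_fst H := dw.
  have H2 := near_eq_is_derive (pr1 w) H.
  by have [_ ->] := H2.
have D2 w w' : differentiable ('D_w f) z -> ('D_w' ('D_w f) z).2 = 'D_w' ('D_w (fun x => (f x).2)) z.
  move=> dw; have /(diff_is_derive w') /is_derive_snd H := dw.
  have H2 := near_eq_is_derive (pr2 w) H.
  by have [_ ->] := H2.
have E1 w : differentiable ('D_w f) z -> differentiable ('D_w (fun x => (f x).1)) z.
  by move=> /differentiable_fst /(near_eq_differentiable (pr1 w)) [].
have E2 w : differentiable ('D_w f) z -> differentiable ('D_w (fun x => (f x).2)) z.
  by move=> /differentiable_snd /(near_eq_differentiable (pr2 w)) [].
have S1 := derive_sym df1 (E1 u du) (E1 v dv).
have S2 := derive_sym df2 (E2 u du) (E2 v dv).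
apply: injective_projections.
  exact: (etrans (D1 u v du) (etrans S1 (esym (D1 v u dv)))).
exact: (etrans (D2 u v du) (etrans S2 (esym (D2 v u dv)))).
Qed.

Lemma is_derive_inv_sq (z k : plane R) (c : R) : z.2 != 0 ->
  is_derive z k (fun y : plane R => c / y.2 ^+ 2)
    (c * (- (1 + 1) * (z.2^-1 * z.2^-1 * z.2^-1) * k.2)).
Proof.
move=> z0; have h2 := is_derive_snd (is_derive_id z k).
have hi := is_derive_inv z0 h2.
have h := is_derive_mul (is_derive_cst c z k) (is_derive_mul hi hi).
rewrite (_ : (fun y : plane R => _) = (fun y : plane R => cst c y * (y.2^-1 * y.2^-1))); last first.
  by apply/funext => y; rewrite expr2 invfM.
apply: (is_derive_eq h); rewrite /cst /=; ring.
Qed.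

Lemma derive_comp_plane (A : plane R -> R) (f : plane R -> plane R) (z k : plane R) :
  differentiable A (f z) -> differentiable f z ->
  is_derive z k (fun y => A (f y)) ('D_e1 A (f z) * ('D_k f z).1 + 'D_e2 A (f z) * ('D_k f z).2).
Proof.
move=> dA df; apply: (is_derive_eq (is_derive_comp_diff k dA df)).
by rewrite derive_plane // /GRing.scale /= mulrC [X in _ + X]mulrC.
Qed.

Lemma slice_near (T : topologicalType) (Om : set (plane R * T)) (p : plane R * T) :
  nbhs p Om -> \forall y \near p.1, Om (y, p.2).
Proof.
case: p => x t n.
have H : (fun y : plane R => (y, t)) @ x --> (x, t).
  by apply: (cvg_pair (G := nbhs x)); [exact: cvg_id | exact: cvg_cst].
exact: H.
Qed.

(** Smoothness is stated by directional derivatives; joint continuity of all of them makes each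
    iterated derivative differentiable. *)
Lemma smooth_family_diff_plane (T : topologicalType) (Om : set (plane R * T))
    (f : plane R -> T -> plane R) (p : plane R * T) (vs : seq (plane R)) :
  open Om -> smooth_family Om f -> Om p -> differentiable (iter_derive vs (f^~ p.2)) p.1.
Proof.
move=> oOm sm Op.
have n : \forall y \near p.1, Om (y, p.2) by apply: slice_near; apply: open_nbhs_nbhs.
have c v : {for p.1, continuous ('D_v (iter_derive vs (f^~ p.2)))}.
  have [_ c] := sm (v :: vs) p Op.
  have H : (fun y : plane R => (y, p.2)) @ p.1 --> (p.1, p.2).
    by apply: (cvg_pair (G := nbhs p.1)); [exact: cvg_id | exact: cvg_cst].
  rewrite -surjective_pairing in H.
  exact: (cvg_comp _ _ H c).
apply: differentiable_C1_plane => //; apply: filterS n => y Oy; have [d _] := sm vs (y, p.2) Oy; exact: d.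
Qed.

Lemma smooth_family_diff_real (T : topologicalType) (Om : set (plane R * T))
    (f : plane R -> T -> R) (p : plane R * T) (vs : seq (plane R)) :
  open Om -> smooth_family Om f -> Om p -> differentiable (iter_derive vs (f^~ p.2)) p.1.
Proof.
move=> oOm sm Op.
have n : \forall y \near p.1, Om (y, p.2) by apply: slice_near; apply: open_nbhs_nbhs.
have c v : {for p.1, continuous ('D_v (iter_derive vs (f^~ p.2)))}.
  have [_ c] := sm (v :: vs) p Op.
  have H : (fun y : plane R => (y, p.2)) @ p.1 --> (p.1, p.2).
    by apply: (cvg_pair (G := nbhs p.1)); [exact: cvg_id | exact: cvg_cst].
  rewrite -surjective_pairing in H.
  exact: (cvg_comp _ _ H c).
apply: differentiable_C1 => //; apply: filterS n => y Oy; have [d _] := sm vs (y, p.2) Oy; exact: d.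
Qed.

Lemma smooth_on_diff_plane (Om : set (plane R)) (f : plane R -> plane R) (x : plane R)
    (vs : seq (plane R)) : open Om -> smooth_on Om f -> Om x -> differentiable (iter_derive vs f) x.
Proof.
move=> oO sf Ox; apply: differentiable_C1_plane.
- by apply: filterS (open_nbhs_nbhs (conj oO Ox)) => y Oy; have [d _] := sf vs y Oy; exact: d.
- by apply: filterS (open_nbhs_nbhs (conj oO Ox)) => y Oy; have [d _] := sf vs y Oy; exact: d.
- by have [_ c] := sf (e1 :: vs) x Ox; exact: c.
- by have [_ c] := sf (e2 :: vs) x Ox; exact: c.
Qed.

Lemma lin_bound (k l c d K : R) : `|c| <= K -> `|d| <= K ->
  `|k *: c + l *: d| <= K * (`|k| + `|l|).
Proof.
move=> cK dK; apply: le_trans (ler_normD _ _) _; rewrite /GRing.scale /= !normrM mulrDr.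
by apply: lerD; rewrite mulrC; apply: ler_wpM2r.
Qed.

Lemma line_in_ball (c x x' : plane R) (r s : R) : 0 <= s <= 1 -> `|x - c| <= r -> `|x' - c| <= r ->
  `|x + s *: (x' - x) - c| <= r.
Proof.
move=> /andP[s0 s1] h h'.
have -> : x + s *: (x' - x) - c = (1 - s) *: (x - c) + s *: (x' - c).
  by apply: injective_projections => /=; rewrite /GRing.scale /=; ring.
apply: le_trans (ler_normD _ _) _; rewrite !normrZ (ger0_norm s0) ger0_norm ?subr_ge0 //.
rewrite (_ : r = (1 - s) * r + s * r); last by ring.
by apply: lerD; apply: ler_wpM2l => //; rewrite subr_ge0.
Qed.

Lemma square_compact (c : plane R) (r : R) : compact [set x : plane R | `|x - c| <= r].
Proof.
rewrite (_ : [set x | _] = `[c.1 - r, c.1 + r]%classic `*` `[c.2 - r, c.2 + r]%classic).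
  by apply: compact_setX; exact: segment_compact.
apply/seteqP; split => x; rewrite /= norm_plane ge_max !in_itv /=.
  by move=> /andP[]; rewrite !ler_distl => -> ->.
by move=> [h1 h2]; rewrite !ler_distl h1 h2.
Qed.

Lemma sphere_compact (c : plane R) (r : R) : compact [set x : plane R | `|x - c| = r].
Proof.
apply: (subclosed_compact _ (@square_compact c r)); last by move=> x /= ->.
have cn : continuous (fun x : plane R => `|x - c|).
  by move=> x; apply: cvg_norm; apply: cvgB; [exact: cvg_id|exact: cvg_cst].
rewrite (_ : [set x | _] = (fun x : plane R => `|x - c|) @^-1` [set r]) //.
by apply: closed_comp => [x _|]; [exact: cn|exact: closed_eq].
Qed.

Definition sqn (x : plane R) : R := x.1 * x.1 + x.2 * x.2.

Lemma sqn_ge0 x : 0 <= sqn x.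
Proof. by rewrite addr_ge0 // -expr2 sqr_ge0. Qed.

Lemma sqn_eq0 x : sqn x = 0 -> x = 0.
Proof.
case: x => x y; rewrite /sqn /= -!expr2 => /eqP; rewrite paddr_eq0 ?sqr_ge0 // !sqrf_eq0.
by move=> /andP[/eqP -> /eqP ->].
Qed.

Lemma sqn_sub (x y : plane R) : sqn x / 2 - sqn y <= sqn (x - y).
Proof.
rewrite /sqn /=; case: x y => [x1 x2] [y1 y2] /=.
rewrite -subr_ge0 (_ : _ - _ = ((x1 - 2 * y1) ^+ 2 + (x2 - 2 * y2) ^+ 2) / 2); last by field.
by rewrite divr_ge0 // addr_ge0 // sqr_ge0.
Qed.

Lemma sqn_cvg (I : Type) (FF : set_system I) {FFF : Filter FF} (u : I -> plane R) (l : plane R) :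
  u @ FF --> l -> (fun i => sqn (u i)) @ FF --> sqn l.
Proof.
by move=> h; apply: cvgD; apply: cvgM; solve [exact: cvg1 h|exact: cvg2 h].
Qed.

(** A point x close to f z is attained: at the point of the square where the distance from f w to x
    is smallest, which is interior because f avoids f z on the boundary, the vector f w - x is
    orthogonal to the image of the differential. *)
Lemma local_open (f : plane R -> plane R) (z : plane R) (r : R) : 0 < r ->
  (forall w, `|w - z| <= r -> differentiable f w) ->
  (forall w x, `|w - z| <= r -> (forall v, x.1 * ('D_v f w).1 + x.2 * ('D_v f w).2 = 0) -> x = 0) ->
  (forall w, `|w - z| = r -> f w <> f z) ->
  nbhs (f z) [set x | exists2 w, `|w - z| <= r & f w = x].
Proof.
move=> r0 df nd bd.
have fc w : `|w - z| <= r -> f y @[y --> w] --> f w.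
  by move=> wr; exact: (differentiable_continuous (df w wr)).
have wc (A : set (plane R)) x : A `<=` [set w | `|w - z| <= r] -> {within A, continuous (fun w => sqn (f w - x))}.
  move=> Ar; apply: continuous_in_subspaceT => w; rewrite inE => Aw.
  apply: sqn_cvg; apply: cvgB; [exact: (fc w (Ar w Aw))|exact: cvg_cst].
have [w1 w1S min1] : exists2 w, w \in [set w : plane R | `|w - z| = r] &
    forall t, t \in [set w : plane R | `|w - z| = r] -> sqn (f w - f z) <= sqn (f t - f z).
  apply: compact_EVT_min; last by apply: wc => w /= ->.
    exists (z + (r, 0)); rewrite /= addrC addKr norm_plane /= normr0 gtr0_norm //.
    by rewrite max_l // ltW.
  exact: sphere_compact.
pose d := sqn (f w1 - f z).
have d0 : 0 < d.
  rewrite lt_neqAle sqn_ge0 andbT eq_sym; apply/eqP => /sqn_eq0 /eqP; rewrite subr_eq0 => /eqP.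
  by apply: bd; rewrite inE in w1S.
have n : \forall x \near f z, sqn (x - f z) < d / 4.
  have c : (fun x => sqn (x - f z)) @ f z --> (0 : R).
    have -> : (0 : R) = sqn (f z - f z) by rewrite subrr /sqn /= mulr0 addr0.
    by apply: sqn_cvg; apply: cvgB; [exact: cvg_id|exact: cvg_cst].
  by apply: (cvgr_lt _ c); rewrite divr_gt0.
apply: filterS n => x hx.
have [w0 w0K min0] : exists2 w, w \in [set w : plane R | `|w - z| <= r] &
    forall t, t \in [set w : plane R | `|w - z| <= r] -> sqn (f w - x) <= sqn (f t - x).
  apply: compact_EVT_min; last by apply: wc.
    by exists z; rewrite /= subrr normr0 ltW.
  exact: square_compact.
rewrite inE /= in w0K.
have hz : sqn (f z - x) = sqn (x - f z) by rewrite /sqn /= -(opprB x.1) -(opprB x.2) !mulrNN.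
have zK : z \in [set w : plane R | `|w - z| <= r] by rewrite inE /= subrr normr0 ltW.
have w0r : `|w0 - z| < r.
  rewrite lt_neqAle w0K andbT; apply/eqP => e.
  have h1 := min1 w0; rewrite inE /= in h1; have {}h1 := h1 e.
  have h2 := sqn_sub (f w0 - f z) (x - f z).
  rewrite opprB addrA subrK in h2.
  have h3 := min0 z zK; rewrite hz in h3; rewrite -/d in h1.
  move: (sqn (x - f z)) (sqn (f w0 - f z)) (sqn (f w0 - x)) (d) hx h1 h2 h3 d0 => A B C D; lra.
exists w0; first exact: w0K.
apply/eqP; rewrite -subr_eq0; apply/eqP; apply: (nd w0 _ w0K) => v.
have cl : continuous (fun s : R => w0 + s *: v).
  by move=> s; apply: cvgD; [exact: cvg_cst|apply: cvgZr_tmp; exact: cvg_id].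
have near0 : \forall s \near (0 : R), `|w0 + s *: v - z| < r.
  have c : (fun s : R => `|w0 + s *: v - z|) @ (0 : R) --> `|w0 + 0 *: v - z|.
    by apply: cvg_norm; apply: cvgB; [exact: cl|exact: cvg_cst].
  apply: (cvgr_lt _ c); by rewrite scale0r addr0.
have [e /= e0 He] := iffLR (nbhs_normP _ _) near0.
have inI s : s \in `]- e, e[ -> `|w0 + s *: v - z| < r.
  by rewrite in_itv /= => h; apply: He; rewrite /ball_ /= sub0r normrN ltr_norml.
have D s : s \in `]- e, e[ -> is_derive s (1 : R) (fun s : R => sqn (f (w0 + s *: v) - x))
   (2 * ((f (w0 + s *: v) - x).1 * ('D_v f (w0 + s *: v)).1 + (f (w0 + s *: v) - x).2 * ('D_v f (w0 + s *: v)).2)).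
  move=> /inI /ltW lt; have d1 := is_derive_line (diff_is_derive v (df _ lt)).
  have k1 := is_derive_add (is_derive_fst d1) (is_derive_cst (- x.1) s (1 : R)).
  have k2 := is_derive_add (is_derive_snd d1) (is_derive_cst (- x.2) s (1 : R)).
  have k := is_derive_add (is_derive_mul k1 k1) (is_derive_mul k2 k2).
  by apply: (is_derive_eq k); rewrite /=; ring.
have zI : (0 : R) \in `]- e, e[ by rewrite in_itv /= oppr_lt0 e0.
have ee : - e <= e by rewrite ge0_cp // ltW.
have [||| _ E] := @derive1_at_min R (fun s : R => sqn (f (w0 + s *: v) - x)) (- e) e 0 ee.
- by move=> t /D [].
- exact: zI.
- move=> t /inI lt; rewrite scale0r addr0; apply: min0; rewrite inE /=; exact: ltW.
have [_ E2] := D 0 zI; rewrite E2 scale0r addr0 in E.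
move/eqP: E; rewrite mulf_eq0 pnatr_eq0 /= => /eqP; exact.
Qed.

End PlaneCalculus.

(** * Dependence of solutions of differential equations on their data *)

Section Gronwall.
Context {R : realType}.

Lemma sqr_sum_le (n : nat) (x : 'I_n -> R) :
  (\sum_i `|x i|) ^+ 2 <= n%:R * \sum_i x i ^+ 2.
Proof.
rewrite expr2 big_distrl /=.
have : \sum_i \sum_j (`|x i| * `|x j|) <= \sum_(i < n) \sum_(j < n) ((x i ^+ 2 + x j ^+ 2) / 2).
  apply: ler_sum => i _; apply: ler_sum => j _.
  rewrite -[x i ^+ 2]real_normK ?num_real // -[x j ^+ 2]real_normK ?num_real //.
  have := sqr_ge0 (`|x i| - `|x j|); nra.
rewrite (eq_bigr (fun i => `|x i| * \sum_j `|x j|)); last by move=> i _; rewrite big_distrr.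
move=> /le_trans; apply.
set Q := \sum_(i < n) x i ^+ 2.
rewrite (eq_bigr (fun i => (n%:R * x i ^+ 2 + Q) / 2)); last first.
  move=> i _; rewrite -mulr_suml big_split /= sumr_const card_ord.
  by rewrite -[_ *+ n]mulr_natl.
rewrite -mulr_suml big_split /= sumr_const card_ord -mulr_sumr -/Q.
by rewrite -[Q *+ n]mulr_natl; lra.
Qed.

(** The sum of squares is differentiable, unlike a norm; multiplied by the exponential of - K s,
    it decreases. The term eta accounts for the error between two equations. *)
Lemma gronwall (n : nat) (D D' : 'I_n -> R -> R) (C eta : R) : 0 <= C -> 0 <= eta ->
  (forall (s : R) i, 0 <= s <= 1 -> is_derive s (1 : R) (D i) (D' i s)) ->
  (forall (s : R) i, 0 <= s <= 1 -> `|D' i s| <= C * (\sum_j `|D j s| + eta)) ->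
  \sum_i D i 1 ^+ 2 <= expR (C * (3 * n + 1)%:R) * (\sum_i D i 0 ^+ 2 + eta ^+ 2).
Proof.
move=> C0 eta0 HD HD'.
pose K := C * (3 * n + 1)%:R.
pose E (s : R) := \sum_i D i s ^+ 2 + eta ^+ 2.
pose E' s := \sum_i (D i s * D' i s) *+ 2.
have dE (s : R) : 0 <= s <= 1 -> is_derive s (1 : R) E (E' s).
  move=> s01.
  have h i : is_derive s (1 : R) (D i ^+ 2) ((2%:R * D i s ^+ 1) *: D' i s).
    by have := HD s i s01 => H; exact: is_deriveX.
  have := is_deriveD (is_derive_sum h) (is_derive_cst (eta ^+ 2) s (1 : R)).
  rewrite (_ : _ + _ = E); last first.
    by apply/funext => t; rewrite /E /= fct_sumE.
  move=> H; apply: is_derive_eq; rewrite addr0 /E'; apply: eq_bigr => i _.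
  by rewrite expr1 /GRing.scale /= -mulrA mulr_natl.
have E'E (s : R) : 0 <= s <= 1 -> E' s <= K * E s.
  move=> s01; pose S : R := \sum_j `|D j s|.
  have S0 : 0 <= S by apply: sumr_ge0.
  have : E' s <= (C * (S + eta) * S) *+ 2.
    rewrite /E' sumrMnl lerMn2r /= mulr_sumr; apply: ler_sum => i _.
    apply: le_trans (ler_norm _) _; rewrite normrM mulrC ler_wpM2r //.
    exact: HD'.
  move=> /le_trans; apply.
  have := sqr_sum_le (fun i => D i s); rewrite -/S /E /K.
  set Q : R := \sum_i _ => SQ.
  have Q0 : 0 <= Q by apply: sumr_ge0 => i _; exact: sqr_ge0.
  have n0 : 0 <= n%:R :> R by [].
  have : (S + eta) * S *+ 2 <= (3 * n + 1)%:R * (Q + eta ^+ 2).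
    rewrite natrD natrM; have := sqr_ge0 (S - eta).
    have : 0 <= n%:R * eta ^+ 2 by rewrite mulr_ge0 // sqr_ge0.
    by move: SQ; set m := n%:R; nra.
  move=> H; apply: (@le_trans _ _ (C * ((S + eta) * S *+ 2))).
    by rewrite mulrnAr mulrA.
  by rewrite -(mulrA C (3 * n + 1)%:R); apply: ler_wpM2l.
pose G (s : R) := E s * expR (- K * s).
have dG (s : R) : 0 <= s <= 1 -> is_derive s (1 : R) G ((E' s - K * E s) * expR (- K * s)).
  move=> s01; have H1 := dE s s01.
  have H2 : is_derive s (1 : R) (fun t => expR (- K * t)) (expR (- K * s) * - K).
    apply: (@is_derive1_comp R expR (fun t => - K * t)).
    have H : is_derive s (1 : R) ((- K) \*: (id : R -> R)) ((- K) *: (1 : R)).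
      exact: is_deriveZ.
    by apply: is_derive_eq; rewrite /GRing.scale /= mulr1.
  apply: (is_derive_eq (is_deriveM H1 H2)).
  by rewrite /GRing.scale /=; ring.
have : G 1 <= G 0.
  have dG' (s : R) : s \in `]0, 1[ -> derivable G s 1 /\ 'D_1 G s <= 0.
    rewrite in_itv /= => /andP[/ltW s0 /ltW s1].
    have s01 : 0 <= s <= 1 by rewrite s0.
    have [H1 ->] := dG s s01; split=> //.
    by rewrite mulr_le0_ge0 ?expR_ge0 // subr_le0 E'E.
  apply: (@ler0_derive1_nincr R G 0 1) => //.
  - by move=> s /dG' [].
  - by move=> s /dG' [_]; rewrite derive1E.
  - apply: derivable_within_continuous => s; rewrite in_itv /= => s01.
    by have [] := dG s s01.
rewrite /G mulr0 expR0 mulr1 mulr1 expRN => H.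
have : E 1 <= expR K * E 0.
  by move: H; rewrite ler_pdivrMr ?expR_gt0 // mulrC.
rewrite /E => HH; apply: le_trans HH; by rewrite lerDl sqr_ge0.
Qed.

End Gronwall.

Section LipschitzPolynomials.
Context {R : realType} (N : R) (m : nat).

Definition box (u : nat -> R) := forall i, (i < m)%N -> `|u i| <= N.

(** This class of functions is closed under ring operations, so that polynomial vector fields are
    Lipschitz on boxes. *)
Definition box_lipschitz (F : (nat -> R) -> R) := exists2 C : R, 0 <= C &
  forall u u', box u -> box u' ->
    `|F u| <= C /\ `|F u - F u'| <= C * \sum_(i < m) `|u i - u' i|.

Lemma box_lipschitz_var i : (i < m)%N -> box_lipschitz (fun u => u i).
Proof.
move=> im; exists (`|N| + 1); first by rewrite addr_ge0.
move=> u u' bu bu'; split.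
  by apply: le_trans (bu i im) _; apply: le_trans (ler_norm _) _; rewrite lerDl.
rewrite -[leLHS]mul1r ler_pM //; first by rewrite lerDr.
by rewrite (bigD1 (Ordinal im)) //= lerDl sumr_ge0.
Qed.

Lemma box_lipschitz_cst c : box_lipschitz (fun=> c).
Proof.
exists `|c| => // u u' _ _; split=> //.
by rewrite subrr normr0 mulr_ge0 // sumr_ge0.
Qed.

Lemma box_lipschitzD F G : box_lipschitz F -> box_lipschitz G ->
  box_lipschitz (fun u => F u + G u).
Proof.
move=> [C C0 HC] [D D0 HD]; exists (C + D); first exact: addr_ge0.
move=> u u' bu bu'; have [F1 F2] := HC u u' bu bu'; have [G1 G2] := HD u u' bu bu'.
split; first by apply: le_trans (ler_normD _ _) _; exact: lerD.
rewrite (_ : _ - _ = (F u - F u') + (G u - G u')); last by ring.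
by apply: le_trans (ler_normD _ _) _; rewrite mulrDl; exact: lerD.
Qed.

Lemma box_lipschitzM F G : box_lipschitz F -> box_lipschitz G ->
  box_lipschitz (fun u => F u * G u).
Proof.
move=> [C C0 HC] [D D0 HD]; exists (C * D + C * D); first by rewrite addr_ge0 ?mulr_ge0.
move=> u u' bu bu'; have [F1 F2] := HC u u' bu bu'; have [G1 G2] := HD u u' bu bu'.
have [F3 _] := HC u' u bu' bu.
split.
  by rewrite normrM; apply: le_trans (ler_pM _ _ F1 G1) _ => //; rewrite lerDl mulr_ge0.
rewrite (_ : _ - _ = (F u - F u') * G u + F u' * (G u - G u')); last by ring.
apply: le_trans (ler_normD _ _) _; rewrite !normrM mulrDl; apply: lerD.
  by rewrite mulrAC; exact: ler_pM.
by rewrite -mulrA; exact: ler_pM.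
Qed.

Lemma box_lipschitzN F : box_lipschitz F -> box_lipschitz (fun u => - F u).
Proof.
move=> [C C0 HC]; exists C => // u u' bu bu'; have [F1 F2] := HC u u' bu bu'.
have -> : - F u - - F u' = - (F u - F u') by ring.
by rewrite !normrN.
Qed.

End LipschitzPolynomials.

Section RealInduction.
Context {R : realType}.

(** Connectedness of the unit interval in the form of an induction principle. *)
Lemma real_induction (P : R -> Prop) :
  P 0 ->
  (forall s : R, 0 <= s < 1 -> (forall s', 0 <= s' <= s -> P s') -> \forall s' \near s, P s') ->
  (forall s : R, 0 < s <= 1 -> (forall s', 0 <= s' < s -> P s') -> P s) ->
  forall s : R, 0 <= s <= 1 -> P s.
Proof.
move=> P0 Popen Pclosed.
pose T := [set s : R | 0 <= s <= 1 /\ forall s', 0 <= s' <= s -> P s'].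
have T0 : T 0.
  by split; [rewrite lexx ler01 | move=> s' ; rewrite -eq_le => /eqP <-].
have Tsup : has_sup T.
  by split; [exists 0 | exists 1 => s [/andP[]]].
pose sg := sup T.
have sg0 : 0 <= sg by apply: ub_le_sup => //; case: Tsup.
have sg1 : sg <= 1 by apply: ge_sup => [|s [/andP[]]]; [exists 0|].
have below s' : 0 <= s' < sg -> P s'.
  move=> /andP[s0 slt].
  have [|t Tt lt] := @sup_adherent _ T (sg - s') _ Tsup; first by rewrite subr_gt0.
  rewrite subKr in lt; case: Tt => _; apply; by rewrite s0 ltW.
have Psg : P sg.
  move: (sg0); rewrite le_eqVlt => /orP[/eqP <- //|sgp].
  by apply: Pclosed => //; rewrite sgp.
have upto s' : 0 <= s' <= sg -> P s'.
  by rewrite [s' <= _]le_eqVlt andb_orr => /orP[/andP[_ /eqP ->]//|]; exact: below.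
move: sg1; rewrite le_eqVlt => /orP[/eqP e|lt].
  by move=> s s01; apply: upto; rewrite e.
have := Popen sg _ upto; rewrite sg0 lt => /(_ isT) /nbhs_ballP [d /= d0 Hd].
pose e := Num.min (d / 2) (1 - sg).
have e0 : 0 < e by rewrite lt_min divr_gt0 //= subr_gt0.
have : T (sg + e).
  split.
    by rewrite addr_ge0 ?(ltW e0) //= -lerBrDl ge_min lexx orbT.
  move=> s' /andP[s0 s1]; have [le|gt] := leP s' sg; first by apply: upto; rewrite s0.
  apply: Hd; rewrite /ball /= distrC gtr0_norm ?subr_gt0 // ltrBlDl.
  apply: le_lt_trans s1 _; rewrite ltrD2l /e; apply: (@le_lt_trans _ _ (d / 2)).
    by rewrite ge_min lexx.
  by rewrite ltr_pdivrMr // mulr_natr mulr2n ltrDl.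
move=> /(ub_le_sup (proj2 Tsup)); rewrite -/sg gerDl => le.
by move: (lt_le_trans e0 le); rewrite ltxx.
Qed.

End RealInduction.

(** * Jets of local isometries of the upper half plane *)

Section Koszul.
Context {R : realType}.
Local Notation e1 := ((1, 0) : plane R).
Local Notation e2 := ((0, 1) : plane R).

(** The derivative in the direction k of the scalar product of the fixed vectors i and j, if u 6,
    u 7 are the partial derivatives of the coefficient A of the metric, and similarly for B and C. *)
Definition cubic (u : nat -> R) (k1 k2 i1 i2 j1 j2 : R) : R :=
  (u 6 * k1 + u 7 * k2) * (i1 * j1) + (u 8 * k1 + u 9 * k2) * (i1 * j2 + i2 * j1) +
  (u 10 * k1 + u 11 * k2) * (i2 * j2).

(** The equation satisfied by the 1-jet of a local isometry f along a line of direction (w1, w2).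
    Here p and q are the derivatives of f along the two axes; by the Koszul formula, rp is the scalar
    product of the second derivative r = f_xx with p, and so on for s = f_xy, t = f_yy and for q. As
    p / |p| and q / |q| form an orthonormal basis and |p|^2 = |q|^2 = y^-2, these products determine
    r, s and t. *)
Definition jet_field (u : nat -> R) (i : nat) : R :=
  let p1 := u 2 in let p2 := u 3 in let q1 := u 4 in let q2 := u 5 in
  let y := u 12 in let h' := - (1 + 1) * (u 13 * u 13 * u 13) in
  let w1 := u 14 in let w2 := u 15 in
  let rp := - cubic u p1 p2 p1 p2 p1 p2 * 2^-1 in
  let sp := (h' + - cubic u q1 q2 p1 p2 p1 p2) * 2^-1 in
  let rq := - cubic u p1 p2 p1 p2 q1 q2 + - sp in
  let sq := - cubic u p1 p2 q1 q2 q1 q2 * 2^-1 in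
  let tq := (h' + - cubic u q1 q2 q1 q2 q1 q2) * 2^-1 in
  let tp := - cubic u q1 q2 p1 p2 q1 q2 + - sq in
  match i with
  | 0%N => w1 * p1 + w2 * q1
  | 1%N => w1 * p2 + w2 * q2
  | 2%N => y * y * ((w1 * rp + w2 * sp) * p1 + (w1 * rq + w2 * sq) * q1)
  | 3%N => y * y * ((w1 * rp + w2 * sp) * p2 + (w1 * rq + w2 * sq) * q2)
  | 4%N => y * y * ((w1 * sp + w2 * tp) * p1 + (w1 * sq + w2 * tq) * q1)
  | _ => y * y * ((w1 * sp + w2 * tp) * p2 + (w1 * sq + w2 * tq) * q2)
  end.

Lemma jet_field_lipschitz (N : R) i : box_lipschitz N 16 (jet_field ^~ i).
Proof.
have V k : (k < 16)%N -> box_lipschitz N 16 (fun u => u k) by exact: box_lipschitz_var.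
have K c : box_lipschitz N 16 (fun=> c : R) by exact: box_lipschitz_cst.
have D F G := @box_lipschitzD R N 16 F G; have T F G := @box_lipschitzM R N 16 F G.
have O F := @box_lipschitzN R N 16 F.
have L a b c d : (a < 16)%N -> (b < 16)%N -> (c < 16)%N -> (d < 16)%N ->
    box_lipschitz N 16 (fun u => u a * u b + u c * u d).
  by move=> *; exact: D (T _ _ (V _ _) (V _ _)) (T _ _ (V _ _) (V _ _)).
have Q a1 a2 b1 b2 c1 c2 : (a1 < 16)%N -> (a2 < 16)%N -> (b1 < 16)%N -> (b2 < 16)%N -> (c1 < 16)%N -> (c2 < 16)%N ->
    box_lipschitz N 16 (fun u => cubic u (u a1) (u a2) (u b1) (u b2) (u c1) (u c2)).
  move=> *; apply: (D _ _ (D _ _ (T _ _ _ _) (T _ _ _ _)) (T _ _ _ _)); try exact: L; exact: T (V _ _) (V _ _).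
have h' : box_lipschitz N 16 (fun u => - (1 + 1) * (u 13 * u 13 * u 13)).
  by apply: (T _ _ (K _) (T _ _ (T _ _ (V 13 _) (V 13 _)) (V 13 _))).
pose p1 := 2%N; pose p2 := 3%N; pose q1 := 4%N; pose q2 := 5%N.
have rp := T _ _ (O _ (Q p1 p2 p1 p2 p1 p2 isT isT isT isT isT isT)) (K 2^-1).
have sp := T _ _ (D _ _ h' (O _ (Q q1 q2 p1 p2 p1 p2 isT isT isT isT isT isT))) (K 2^-1).
have rq := D _ _ (O _ (Q p1 p2 p1 p2 q1 q2 isT isT isT isT isT isT)) (O _ sp).
have sq := T _ _ (O _ (Q p1 p2 q1 q2 q1 q2 isT isT isT isT isT isT)) (K 2^-1).
have tq := T _ _ (D _ _ h' (O _ (Q q1 q2 q1 q2 q1 q2 isT isT isT isT isT isT))) (K 2^-1).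
have tp := D _ _ (O _ (Q q1 q2 p1 p2 q1 q2 isT isT isT isT isT isT)) (O _ sq).
have y2 := T _ _ (V 12 isT) (V 12 isT).
have W F G k l (hF : box_lipschitz N 16 F) (hG : box_lipschitz N 16 G) (hk : (k < 16)%N) (hl : (l < 16)%N) :=
  T _ _ y2 (D _ _ (T _ _ hF (V k hk)) (T _ _ hG (V l hl))).
have Z F G (hF : box_lipschitz N 16 F) (hG : box_lipschitz N 16 G) :=
  D _ _ (T _ _ (V 14 isT) hF) (T _ _ (V 15 isT) hG).
move: i => [|[|[|[|[|i]]]]].
- exact: (Z _ _ (V p1 isT) (V q1 isT)).
- exact: (Z _ _ (V p2 isT) (V q2 isT)).
- exact: (W _ _ p1 q1 (Z _ _ rp sp) (Z _ _ rq sq) isT isT).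
- exact: (W _ _ p2 q2 (Z _ _ rp sp) (Z _ _ rq sq) isT isT).
- exact: (W _ _ p1 q1 (Z _ _ sp tp) (Z _ _ sq tq) isT isT).
- exact: (W _ _ p2 q2 (Z _ _ sp tp) (Z _ _ sq tq) isT isT).
Qed.

(** Entries 0 to 5 are the unknowns of the equation, entries 6 to 11 the derivatives of the metric
    at f z, and entries 12 to 15 only depend on the point and on the direction. *)
Definition jet (A B C : plane R -> R) (f : plane R -> plane R) (w z : plane R) (i : nat) : R :=
  nth 0 [:: (f z).1; (f z).2; ('D_e1 f z).1; ('D_e1 f z).2; ('D_e2 f z).1; ('D_e2 f z).2;
    'D_e1 A (f z); 'D_e2 A (f z); 'D_e1 B (f z); 'D_e2 B (f z);
    'D_e1 C (f z); 'D_e2 C (f z); z.2; z.2^-1; w.1; w.2] i.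

Lemma jet6 (A B C A' B' C' : plane R -> R) f (w w' z : plane R) k : (k < 6)%N ->
  jet A B C f w z k = jet A' B' C' f w' z k.
Proof. by rewrite /jet; move: k => [|[|[|[|[|[|]]]]]]. Qed.

(** Near z, the map f pulls the metric A dx^2 + 2 B dx dy + C dy^2 back to the hyperbolic metric. *)
Record hyp_isometry (A B C : plane R -> R) (f : plane R -> plane R) (z : plane R) : Prop :=
 HypIsometry {
  hi_gt0 : 0 < z.2;
  hi_diff : \forall y \near z, differentiable f y;
  hi_diff2 : forall v, differentiable ('D_v f) z;
  hi_A : differentiable A (f z);
  hi_B : differentiable B (f z);
  hi_C : differentiable C (f z);
  hi_eq : forall v w, (v = e1 \/ v = e2) -> (w = e1 \/ w = e2) -> \forall y \near z,
    A (f y) * (('D_v f y).1 * ('D_w f y).1) +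
    B (f y) * (('D_v f y).1 * ('D_w f y).2 + ('D_v f y).2 * ('D_w f y).1) +
    C (f y) * (('D_v f y).2 * ('D_w f y).2) = (v.1 * w.1 + v.2 * w.2) / y.2 ^+ 2
 }.

Lemma gram_expand (a b c p1 p2 q1 q2 h w1 w2 : R) : h != 0 ->
  a * (p1 * p1) + b * (p1 * p2 + p2 * p1) + c * (p2 * p2) = h ->
  a * (p1 * q1) + b * (p1 * q2 + p2 * q1) + c * (p2 * q2) = 0 ->
  a * (q1 * q1) + b * (q1 * q2 + q2 * q1) + c * (q2 * q2) = h ->
  let P := a * (w1 * p1) + b * (w1 * p2 + w2 * p1) + c * (w2 * p2) in
  let Q := a * (w1 * q1) + b * (w1 * q2 + w2 * q1) + c * (w2 * q2) in
  w1 = h^-1 * (P * p1 + Q * q1) /\ w2 = h^-1 * (P * p2 + Q * q2).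
Proof.
move=> h0 hp hpq hq P Q.
pose u1 := a * p1 + b * p2; pose u2 := b * p1 + c * p2.
pose v1 := a * q1 + b * q2; pose v2 := b * q1 + c * q2.
pose dl := p1 * q2 - p2 * q1.
have U1 : u1 * dl = h * q2.
  transitivity (h * q2 - p2 * 0); last by ring.
  by rewrite -hpq -hp /u1 /dl; ring.
have U2 : u2 * dl = - h * q1.
  transitivity (- h * q1 + p1 * 0); last by ring.
  by rewrite -hpq -hp /u2 /dl; ring.
have V1 : v1 * dl = - h * p2.
  transitivity (q2 * 0 - h * p2); last by ring.
  by rewrite -hpq -hq /v1 /dl; ring.
have V2 : v2 * dl = h * p1.
  transitivity (h * p1 - q1 * 0); last by ring.
  by rewrite -hpq -hq /v2 /dl; ring.
have dl0 : dl != 0.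
  apply/eqP => dl0; move: U1 U2; rewrite dl0 !mulr0 => /esym/eqP + /esym/eqP.
  rewrite !mulf_eq0 oppr_eq0 (negbTE h0) /= => /eqP q20 /eqP q10.
  by move: hq h0; rewrite q20 q10 => <-; rewrite !(mulr0, addr0) eqxx.
have EP : P = u1 * w1 + u2 * w2 by rewrite /P /u1 /u2; ring.
have EQ : Q = v1 * w1 + v2 * w2 by rewrite /Q /v1 /v2; ring.
split; apply: (mulfI h0); rewrite mulrA mulfV // mul1r; apply: (mulIf dl0).
  transitivity ((u1 * dl * w1 + u2 * dl * w2) * p1 + (v1 * dl * w1 + v2 * dl * w2) * q1).
    by rewrite U1 U2 V1 V2 /dl; ring.
  by rewrite EP EQ; ring.
transitivity ((u1 * dl * w1 + u2 * dl * w2) * p2 + (v1 * dl * w1 + v2 * dl * w2) * q2).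
  by rewrite U1 U2 V1 V2 /dl; ring.
by rewrite EP EQ; ring.
Qed.

Lemma quadratic_derive (V : normedModType R) (a b c v1 v2 w1 w2 : V -> R)
    (da db dc dv1 dv2 dw1 dw2 : R) (z k : V) :
  is_derive z k a da -> is_derive z k b db -> is_derive z k c dc ->
  is_derive z k v1 dv1 -> is_derive z k v2 dv2 ->
  is_derive z k w1 dw1 -> is_derive z k w2 dw2 ->
  is_derive z k (fun y => a y * (v1 y * w1 y) + b y * (v1 y * w2 y + v2 y * w1 y) +
      c y * (v2 y * w2 y))
   (da * (v1 z * w1 z) + db * (v1 z * w2 z + v2 z * w1 z) + dc * (v2 z * w2 z)
   + (a z * (dv1 * w1 z) + b z * (dv1 * w2 z + dv2 * w1 z) + c z * (dv2 * w2 z))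
   + (a z * (dw1 * v1 z) + b z * (dw1 * v2 z + dw2 * v1 z) + c z * (dw2 * v2 z))).
Proof.
move=> DA DB DC V1 V2 W1 W2.
have H := is_derive_add (is_derive_add (is_derive_mul DA (is_derive_mul V1 W1))
   (is_derive_mul DB (is_derive_add (is_derive_mul V1 W2) (is_derive_mul V2 W1))))
   (is_derive_mul DC (is_derive_mul V2 W2)).
by apply: (is_derive_eq H); ring.
Qed.

(** The six hypotheses before the conclusion are the derivatives of the three scalar products of p and q
    along the two axes; as s appears in both families, this linear system determines the products
    of r, s, t with p, q. *)
Lemma koszul_solve (a b c p1 p2 q1 q2 r1 r2 s1 s2 t1 t2 y w1 w2 : R) (u : nat -> R) :
  0 < y -> u 2 = p1 -> u 3 = p2 -> u 4 = q1 -> u 5 = q2 -> u 12 = y -> u 13 = y^-1 ->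
  u 14 = w1 -> u 15 = w2 ->
  let dot v1 v2 w1 w2 := a * (v1 * w1) + b * (v1 * w2 + v2 * w1) + c * (v2 * w2) in
  dot p1 p2 p1 p2 = y^-1 ^+ 2 -> dot p1 p2 q1 q2 = 0 -> dot q1 q2 q1 q2 = y^-1 ^+ 2 ->
  cubic u p1 p2 p1 p2 p1 p2 + dot r1 r2 p1 p2 + dot r1 r2 p1 p2 = 0 ->
  cubic u p1 p2 p1 p2 q1 q2 + dot r1 r2 q1 q2 + dot s1 s2 p1 p2 = 0 ->
  cubic u p1 p2 q1 q2 q1 q2 + dot s1 s2 q1 q2 + dot s1 s2 q1 q2 = 0 ->
  cubic u q1 q2 p1 p2 p1 p2 + dot s1 s2 p1 p2 + dot s1 s2 p1 p2 =
    - (1 + 1) * (y^-1 * y^-1 * y^-1) ->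
  cubic u q1 q2 p1 p2 q1 q2 + dot s1 s2 q1 q2 + dot t1 t2 p1 p2 = 0 ->
  cubic u q1 q2 q1 q2 q1 q2 + dot t1 t2 q1 q2 + dot t1 t2 q1 q2 =
    - (1 + 1) * (y^-1 * y^-1 * y^-1) ->
  [/\ w1 * r1 + w2 * s1 = jet_field u 2, w1 * r2 + w2 * s2 = jet_field u 3,
      w1 * s1 + w2 * t1 = jet_field u 4 & w1 * s2 + w2 * t2 = jet_field u 5].
Proof.
move=> y0 u2 u3 u4 u5 u12 u13 u14 u15 dot hp hpq hq E1 E2 E3 E4 E5 E6.
have h0 : y^-1 ^+ 2 != 0 by rewrite expf_neq0 // invr_neq0 // gt_eqF.
have hy : (y^-1 ^+ 2)^-1 = y * y by rewrite exprVn invrK expr2.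
have [R1 R2] := gram_expand r1 r2 h0 hp hpq hq.
have [S1 S2] := gram_expand s1 s2 h0 hp hpq hq.
have [T1 T2] := gram_expand t1 t2 h0 hp hpq hq.
rewrite /jet_field u2 u3 u4 u5 u12 u13 u14 u15.
move: E1 E2 E3 E4 E5 E6 R1 R2 S1 S2 T1 T2.
rewrite hy -!/(dot _ _ _ _).
move: (dot r1 r2 p1 p2) (dot r1 r2 q1 q2) (dot s1 s2 p1 p2) (dot s1 s2 q1 q2)
  (dot t1 t2 p1 p2) (dot t1 t2 q1 q2) => rp rq sp sq tp tq.
move: (cubic u p1 p2 p1 p2 p1 p2) (cubic u p1 p2 p1 p2 q1 q2) (cubic u p1 p2 q1 q2 q1 q2)
 (cubic u q1 q2 p1 p2 p1 p2) (cubic u q1 q2 p1 p2 q1 q2) (cubic u q1 q2 q1 q2 q1 q2)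
 (- (1 + 1) * (y^-1 * y^-1 * y^-1)) => c1 c2 c3 c4 c5 c6 h'.
move=> E1 E2 E3 E4 E5 E6.
have -> : - c1 * 2^-1 = rp by lra.
have -> : (h' + - c4) * 2^-1 = sp by lra.
have -> : - c2 + - sp = rq by lra.
have -> : - c3 * 2^-1 = sq by lra.
have -> : (h' + - c6) * 2^-1 = tq by lra.
have -> : - c5 + - sq = tp by lra.
move=> -> -> -> -> -> ->; split; ring.
Qed.

Lemma koszul_jet (A B C : plane R -> R) (f : plane R -> plane R) (z w : plane R) :
  hyp_isometry A B C f z -> let u := jet A B C f w z in
  'D_w ('D_e1 f) z = (jet_field u 2, jet_field u 3) /\
  'D_w ('D_e2 f) z = (jet_field u 4, jet_field u 5).
Proof.
move=> [z0 df df2 hA hB hC Heq] u.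
have dfz : differentiable f z by exact: nbhs_singleton df.
have zn : z.2 != 0 by rewrite gt_eqF.
have F k v v' dV dV' (hv : v = e1 \/ v = e2) (hv' : v' = e1 \/ v' = e2) :
  'D_k ('D_v f) z = dV -> 'D_k ('D_v' f) z = dV' ->
  cubic u ('D_k f z).1 ('D_k f z).2 ('D_v f z).1 ('D_v f z).2 ('D_v' f z).1 ('D_v' f z).2
  + (A (f z) * (dV.1 * ('D_v' f z).1) +
     B (f z) * (dV.1 * ('D_v' f z).2 + dV.2 * ('D_v' f z).1) +
     C (f z) * (dV.2 * ('D_v' f z).2))
  + (A (f z) * (dV'.1 * ('D_v f z).1) +
     B (f z) * (dV'.1 * ('D_v f z).2 + dV'.2 * ('D_v f z).1) +
     C (f z) * (dV'.2 * ('D_v f z).2))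
  = (v.1 * v'.1 + v.2 * v'.2) * (- (1 + 1) * (z.2^-1 * z.2^-1 * z.2^-1) * k.2).
  move=> <- <-.
  have H := quadratic_derive (derive_comp_plane k hA dfz) (derive_comp_plane k hB dfz)
    (derive_comp_plane k hC dfz)
    (is_derive_fst (diff_is_derive k (df2 v))) (is_derive_snd (diff_is_derive k (df2 v)))
    (is_derive_fst (diff_is_derive k (df2 v'))) (is_derive_snd (diff_is_derive k (df2 v'))).
  have [_ H1] := near_eq_is_derive (Heq v v' hv hv') H.
  have [_ H2] := is_derive_inv_sq k (v.1 * v'.1 + v.2 * v'.2) zn.
  by rewrite -H2 H1.
have o1 : e1 = e1 \/ e1 = e2 by left.
have o2 : e2 = e1 \/ e2 = e2 by right.
have G v v' (hv : v = e1 \/ v = e2) (hv' : v' = e1 \/ v' = e2) := nbhs_singleton (Heq v v' hv hv').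
have sym : 'D_e1 ('D_e2 f) z = 'D_e2 ('D_e1 f) z by apply: derive_sym_plane.
pose r := 'D_e1 ('D_e1 f) z; pose s := 'D_e2 ('D_e1 f) z; pose t := 'D_e2 ('D_e2 f) z.
have F111 := F e1 _ _ r r o1 o1 (erefl _) (erefl _).
have F112 := F e1 _ _ r s o1 o2 (erefl _) sym.
have F122 := F e1 _ _ s s o2 o2 sym sym.
have F211 := F e2 _ _ s s o1 o1 (erefl _) (erefl _).
have F212 := F e2 _ _ s t o1 o2 (erefl _) (erefl _).
have F222 := F e2 _ _ t t o2 o2 (erefl _) (erefl _).
have G11 := G _ _ o1 o1; have G12 := G _ _ o1 o2; have G22 := G _ _ o2 o2.
clear F G Heq.
have Kp : 'D_w ('D_e1 f) z = w.1 *: r + w.2 *: s by exact: derive_plane.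
have Kq : 'D_w ('D_e2 f) z = w.1 *: s + w.2 *: t.
  exact: (etrans (derive_plane w (df2 e2)) (congr1 (fun x => w.1 *: x + w.2 *: t) sym)).
rewrite /= ?(mulr0, mulr1, mul0r, mul1r, addr0, add0r) -?exprVn in G11 G12 G22 F111 F112 F122 F211 F212 F222.
have [K2 K3 K4 K5] := koszul_solve z0 (erefl (u 2)) (erefl (u 3)) (erefl (u 4)) (erefl (u 5))
   (erefl (u 12)) (erefl (u 13)) (erefl (u 14)) (erefl (u 15)) G11 G12 G22
   F111 F112 F122 F211 F212 F222.
split; [apply: (etrans Kp) | apply: (etrans Kq)]; apply: injective_projections.
- exact: K2.
- exact: K3.
- exact: K4.
- exact: K5.
Qed.

Lemma jet_line (A B C : plane R -> R) (f : plane R -> plane R) (z0 w : plane R) (s : R) (i : nat) :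
  (i < 6)%N -> hyp_isometry A B C f (z0 + s *: w) ->
  is_derive s (1 : R) (fun t : R => jet A B C f w (z0 + t *: w) i)
    (jet_field (jet A B C f w (z0 + s *: w)) i).
Proof.
move=> i6 H; have [_ df df2 _ _ _ _] := H.
have dfz : differentiable f (z0 + s *: w) by exact: nbhs_singleton df.
have [K1 K2] := koszul_jet w H.
have Kf := derive_plane w dfz.
have D0 := is_derive_eq (diff_is_derive w dfz) Kf.
have D1 := is_derive_eq (diff_is_derive w (df2 e1)) K1.
have D2 := is_derive_eq (diff_is_derive w (df2 e2)) K2.
case: i i6 => [|[|[|[|[|[|]]]]]] // _.
- exact: (is_derive_line (is_derive_fst D0)).
- exact: (is_derive_line (is_derive_snd D0)).
- exact: (is_derive_line (is_derive_fst D1)).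
- exact: (is_derive_line (is_derive_snd D1)).
- exact: (is_derive_line (is_derive_fst D2)).
- exact: (is_derive_line (is_derive_snd D2)).
Qed.

Lemma jet_field_lipschitz_all (N : R) : exists2 K : R, 0 <= K &
  forall u u', box N 16 u -> box N 16 u' -> forall i, (i < 6)%N ->
  `|jet_field u i - jet_field u' i| <= K * \sum_(j < 16) `|u j - u' j|.
Proof.
have /choice [K HK] : forall i : nat, exists K : R, 0 <= K /\ forall u u', box N 16 u -> box N 16 u' ->
  `|jet_field u i - jet_field u' i| <= K * \sum_(j < 16) `|u j - u' j|.
  by move=> i; have [K K0 H] := jet_field_lipschitz N i; exists K; split=> // u u' bu bu'; have [] := H u u' bu bu'.
exists (\sum_(i < 6) K i); first by apply: sumr_ge0 => i _; have [] := HK i.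
move=> u u' bu bu' i i6; have [_ H] := HK i; apply: le_trans (H _ _ bu bu') _.
apply: ler_wpM2r; first exact: sumr_ge0.
rewrite (bigD1 (Ordinal i6)) //= lerDl sumr_ge0 // => j _.
by have [] := HK j.
Qed.

(** Two isometries for two metrics are compared. The derivatives of both metrics are only known to
    be close when taken at the same point, hence the Lipschitz term with constant L. *)
Lemma jet_gronwall (N L : R) : 0 <= L -> exists2 K : R, 0 <= K &
  forall (A B C A' B' C' : plane R -> R) (f f' : plane R -> plane R) (z0 w : plane R) (eta : R),
  0 <= eta ->
  (forall s : R, 0 <= s <= 1 -> let z := z0 + s *: w in
    [/\ hyp_isometry A B C f z, hyp_isometry A' B' C' f' z,
     box N 16 (jet A B C f w z), box N 16 (jet A' B' C' f' w z) &
     forall j, (6 <= j < 12)%N -> `|jet A B C f w z j - jet A' B' C' f' w z j| <=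
       L * (`|(f z).1 - (f' z).1| + `|(f z).2 - (f' z).2|) + eta]) ->
  \sum_(i < 6) (jet A B C f w (z0 + w) i - jet A' B' C' f' w (z0 + w) i) ^+ 2 <=
  K * (\sum_(i < 6) (jet A B C f w z0 i - jet A' B' C' f' w z0 i) ^+ 2 + eta ^+ 2).
Proof.
move=> L0; have [Q Q0 HQ] := jet_field_lipschitz_all N.
exists (expR (Q * (7 + 6 * L) * (3 * 6 + 1)%:R)); first exact: expR_ge0.
move=> A B C A' B' C' f f' z0 w eta eta0 H.
pose u (s : R) := jet A B C f w (z0 + s *: w).
pose u' (s : R) := jet A' B' C' f' w (z0 + s *: w).
pose D (i : 'I_6) (s : R) := u s i - u' s i.
pose D' (i : 'I_6) (s : R) := jet_field (u s) i - jet_field (u' s) i.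
have := @gronwall R 6 D D' (Q * (7 + 6 * L)) eta.
rewrite /D /u /u' !scale1r !scale0r !addr0; apply=> //.
- by rewrite mulr_ge0 // addr_ge0 // mulr_ge0.
- move=> s i s01; have [h1 h2 _ _ _] := H s s01.
  exact: (is_deriveB (jet_line (ltn_ord i) h1) (jet_line (ltn_ord i) h2)).
- move=> s i s01; have [_ _ h1 h2 h3] := H s s01.
  apply: le_trans (HQ _ _ h1 h2 i (ltn_ord i)) _; rewrite -mulrA; apply: ler_wpM2l => //.
  set v := jet A B C f w _ in h3 *; set v' := jet A' B' C' f' w _ in h3 *.
  have e12 : v 12 = v' 12 by [].
  have e13 : v 13 = v' 13 by [].
  have e14 : v 14 = v' 14 by [].
  have e15 : v 15 = v' 15 by [].
  have k6 := h3 6 isT; have k7 := h3 7 isT; have k8 := h3 8 isT.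
  have k9 := h3 9 isT; have k10 := h3 10 isT; have k11 := h3 11 isT.
  clear h3; move: k6 k7 k8 k9 k10 k11.
  rewrite -[(f _).1]/(v 0%N) -[(f' _).1]/(v' 0%N) -[(f _).2]/(v 1%N) -[(f' _).2]/(v' 1%N).
  clearbody v v'.
  rewrite !big_ord_recl !big_ord0 /= /bump /=.
  rewrite !add1n e12 e13 e14 e15 !subrr !normr0.
  have n0 := normr_ge0 (v 0 - v' 0); have n1 := normr_ge0 (v 1%N - v' 1%N).
  have n2 := normr_ge0 (v 2 - v' 2); have n3 := normr_ge0 (v 3 - v' 3).
  have n4 := normr_ge0 (v 4 - v' 4); have n5 := normr_ge0 (v 5 - v' 5).
  move: n0 n1 n2 n3 n4 n5.
  move: (`|v 0 - v' 0|) (`|v 1%N - v' 1%N|) (`|v 2 - v' 2|) (`|v 3 - v' 3|) (`|v 4 - v' 4|) (`|v 5 - v' 5|)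
    (`|v 6 - v' 6|) (`|v 7 - v' 7|) (`|v 8 - v' 8|) (`|v 9 - v' 9|) (`|v 10 - v' 10|) (`|v 11 - v' 11|).
  clear -L0 eta0.
  move=> d0 d1 d2 d3 d4 d5 d6 d7 d8 d9 d10 d11 n0 n1 n2 n3 n4 n5 k6 k7 k8 k9 k10 k11.
  have m2 : 0 <= L * d2 by apply: mulr_ge0.
  have m3 : 0 <= L * d3 by apply: mulr_ge0.
  have m4 : 0 <= L * d4 by apply: mulr_ge0.
  have m5 : 0 <= L * d5 by apply: mulr_ge0.
  have m6 : 0 <= L * eta by apply: mulr_ge0.
  nra.
Qed.

End Koszul.

(** * Moebius transformations *)

Section Moebius.
Context {R : realType}.
Local Notation e1 := ((1, 0) : plane R).
Local Notation e2 := ((0, 1) : plane R).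
Local Notation base := ((0, 1) : plane R).
Local Notation H := (@upper_half_plane R).

Lemma upper_half_plane_open : open H.
Proof.
rewrite openE => z zp.
have c : (fun y : plane R => y.2) @ z --> z.2 by exact: cvg_snd.
exact: (cvgr_gt _ c _ zp).
Qed.

Lemma base_in_H : H base.
Proof. exact: ltr01. Qed.

Lemma segment_H (z w : plane R) (s : R) : H z -> H w -> 0 <= s <= 1 -> H (z + s *: (w - z)).
Proof.
move=> Hz Hw /andP[s0 s1]; rewrite /H /= /GRing.scale /=.
have h1 : 0 < z.2 by exact: Hz. have h2 : 0 < w.2 by exact: Hw.
by move: (z.2) (w.2) h1 h2 => x y x0 y0; nra.
Qed.

Definition mx2 (a b c d : R) : 'M[R]_2 := \matrix_(i, j) (if i == 0 then (if j == 0 then a else b) else (if j == 0 then c else d)).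

Lemma mx2E (a b c d : R) : [/\ mx2 a b c d 0 0 = a, mx2 a b c d 0 1 = b, mx2 a b c d 1 0 = c & mx2 a b c d 1 1 = d].
Proof. by split; rewrite mxE. Qed.

Lemma mx2_eta (A : 'M[R]_2) : A = mx2 (A 0 0) (A 0 1) (A 1 0) (A 1 1).
Proof.
by apply/matrixP => i j; rewrite mxE; case: (unliftP 0 i) => [i' ->|->]; case: (unliftP 0 j) => [j' ->|->] //=;
  rewrite ?(ord1 i') ?(ord1 j'); congr (A _ _); apply/val_inj.
Qed.

Lemma det_mx2 (a b c d : R) : \det (mx2 a b c d) = a * d - b * c.
Proof. by rewrite (expand_det_row _ 0) !big_ord_recl big_ord0 /cofactor !det_mx11 !mxE /=; rewrite /bump /=; ring. Qed.

Lemma det2 (A : 'M[R]_2) : \det A = A 0 0 * A 1 1 - A 0 1 * A 1 0.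
Proof. by rewrite {1}(mx2_eta A) det_mx2. Qed.

Lemma mx2M (a b c d a' b' c' d' : R) : mx2 a b c d * mx2 a' b' c' d' =
  mx2 (a * a' + b * c') (a * b' + b * d') (c * a' + d * c') (c * b' + d * d').
Proof.
rewrite [LHS]mx2_eta; congr mx2; rewrite -mulmxE mxE !big_ord_recl big_ord0 !mxE /= addr0 //.
Qed.

Lemma mx21 : 1 = mx2 1 0 0 1.
Proof. by rewrite [LHS]mx2_eta; congr mx2; rewrite mxE. Qed.

Lemma mx2N1 : - 1 = mx2 (-1) 0 0 (-1).
Proof. by rewrite [LHS]mx2_eta; congr mx2; rewrite !mxE ?oppr0. Qed.

Lemma unit_det (A : 'M[R]_2) : \det A = 1 -> A \is a GRing.unit.
Proof. by move=> dA; rewrite (_ : _ \is a _ = (A \in unitmx)) // unitmxE dA unitr1. Qed.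

Lemma det_inv1 (A : 'M[R]_2) : \det A = 1 -> \det A^-1 = 1.
Proof. by move=> dA; rewrite (_ : A^-1 = invmx A) // det_inv dA invr1. Qed.

Definition mden (A : 'M[R]_2) (z : plane R) : R := (A 1 0 * z.1 + A 1 1) ^+ 2 + (A 1 0 * z.2) ^+ 2.

Lemma mden_gt0 A z : \det A = 1 -> H z -> 0 < mden A z.
Proof.
rewrite det2 /mden => dA Hz; have z0 : 0 < z.2 by exact: Hz.
move: z0.
move: (A 1 0) (A 1 1) dA (z.1) (z.2) => c d dA x y y0.
rewrite lt_neqAle addr_ge0 ?sqr_ge0 // andbT eq_sym paddr_eq0 ?sqr_ge0 // !sqrf_eq0 mulf_eq0 (gt_eqF y0) orbF.
apply/negP => /andP[/eqP e /eqP c0]; move: e dA; rewrite c0 mul0r add0r => ->.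
by rewrite !mulr0 subrr => /eqP; rewrite eq_sym oner_eq0.
Qed.

Lemma moebius_H A z : \det A = 1 -> H z -> H (moebius A z).
Proof.
move=> dA Hz; have q0 := mden_gt0 dA Hz; rewrite /moebius /H /=; apply: divr_gt0; [exact: Hz|exact: q0].
Qed.

Lemma moebius_1 (z : plane R) : moebius 1 z = z.
Proof.
case: z => x y; rewrite /moebius !mxE /=.
have -> : (0 * x + 1) ^+ 2 + (0 * y) ^+ 2 = 1 by ring.
by rewrite !divr1; congr pair; ring.
Qed.

Lemma moebius_N (A : 'M[R]_2) z : moebius (- A) z = moebius A z.
Proof.
rewrite /moebius !mxE; set a := A 0 0; set b := A 0 1; set c := A 1 0; set d := A 1 1.
have -> : (- c * z.1 + - d) ^+ 2 + (- c * z.2) ^+ 2 = (c * z.1 + d) ^+ 2 + (c * z.2) ^+ 2 by ring.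
by congr (_ / _, _); ring.
Qed.

(** The determinant of the second matrix is kept as a factor of Y, so that the identities hold for
    all real values. *)
Lemma moebius_M_algebra (a b c d a' b' c' d' x y : R) :
  let Q1 := (c' * x + d') ^+ 2 + (c' * y) ^+ 2 in
  let X := ((a' * x + b') * (c' * x + d') + a' * c' * y ^+ 2) / Q1 in
  let Y := (a' * d' - b' * c') * y / Q1 in
  let Q2 := (c * X + d) ^+ 2 + (c * Y) ^+ 2 in
  let A := a * a' + b * c' in let B := a * b' + b * d' in
  let C := c * a' + d * c' in let D := c * b' + d * d' in
  let Q3 := (C * x + D) ^+ 2 + (C * y) ^+ 2 in
  Q1 != 0 -> Q3 = Q1 * Q2 /\
   (A * x + B) * (C * x + D) + A * C * y ^+ 2 = Q1 * ((a * X + b) * (c * X + d) + a * c * Y ^+ 2).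
Proof.
move=> Q1 X Y Q2 A B C D Q3 Q10.
by rewrite /Q2 /Y /X /Q3 /C /D /A /B; rewrite /Q1 in Q10 *; split; field.
Qed.

Lemma moebius_M A B z : \det A = 1 -> \det B = 1 -> H z ->
  moebius (A * B) z = moebius A (moebius B z).
Proof.
move=> dA dB Hz; have dAB : \det (A * B) = 1 by rewrite det_mulmx dA dB mulr1.
have q1 := mden_gt0 dB Hz; have q2 := mden_gt0 dA (moebius_H dB Hz); have q3 := mden_gt0 dAB Hz.
move: q1 q2 q3; rewrite /mden.
have dB' := dB; rewrite det2 in dB'.
have AB : A * B = mx2 (A 0 0 * B 0 0 + A 0 1 * B 1 0) (A 0 0 * B 0 1 + A 0 1 * B 1 1)
   (A 1 0 * B 0 0 + A 1 1 * B 1 0) (A 1 0 * B 0 1 + A 1 1 * B 1 1).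
  by rewrite -mx2M -!mx2_eta.
have [E1 E2 E3 E4] := mx2E (A 0 0 * B 0 0 + A 0 1 * B 1 0) (A 0 0 * B 0 1 + A 0 1 * B 1 1) (A 1 0 * B 0 0 + A 1 1 * B 1 0) (A 1 0 * B 0 1 + A 1 1 * B 1 1).
rewrite -AB in E1 E2 E3 E4; rewrite /moebius E1 E2 E3 E4 /=.
move: (A 0 0) (A 0 1) (A 1 0) (A 1 1) (B 0 0) (B 0 1) (B 1 0) (B 1 1) dB' (z.1) (z.2) Hz => a b c d a' b' c' d' dB' x y y0 q1 q2 q3.
have := @moebius_M_algebra a b c d a' b' c' d' x y; rewrite /= dB' mul1r => h.
have [h1 h2] := h (lt0r_neq0 q1).
have aux (P Q : R) : y / (P * Q) = y / P / Q by rewrite invfM mulrA.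
rewrite h1 h2; congr pair; first by rewrite -mulf_div divff ?mul1r // lt0r_neq0.
exact: aux.
Qed.

(** The derivative of a Moebius transformation is the multiplication by the complex number
    1 / (c z + d)^2. *)
Definition mobder (A : 'M[R]_2) (z : plane R) : plane R :=
  let c := A 1 0 in let d := A 1 1 in
  (((c * z.1 + d) ^+ 2 - (c * z.2) ^+ 2) / mden A z ^+ 2,
   - (2 * (c * z.1 + d) * (c * z.2)) / mden A z ^+ 2).

Definition cmul (m v : plane R) : plane R := (m.1 * v.1 - m.2 * v.2, m.2 * v.1 + m.1 * v.2).

Lemma mobder_norm A z : \det A = 1 -> H z ->
  (mobder A z).1 ^+ 2 + (mobder A z).2 ^+ 2 = (mden A z ^+ 2)^-1.
Proof.
move=> dA Hz; have := mden_gt0 dA Hz; rewrite /mobder /= {1 2 3}/mden.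
set p := _ + A 1 1; set q := _ * z.2; set D := mden A z => D0.
have DE : D = p ^+ 2 + q ^+ 2 by [].
have Dn : D != 0 by rewrite lt0r_neq0.
by rewrite DE; rewrite DE in Dn; field.
Qed.

Lemma moebiusE A (z : plane R) : moebius A z =
  (((A 0 0 * z.1 + A 0 1) * (A 1 0 * z.1 + A 1 1) + A 0 0 * A 1 0 * (z.2 * z.2)) * (mden A z)^-1,
   z.2 * (mden A z)^-1).
Proof. by []. Qed.

Lemma diff_mden A (z : plane R) : differentiable (mden A) z.
Proof.
rewrite (_ : mden A = fun y => (A 1 0 * y.1 + A 1 1) * (A 1 0 * y.1 + A 1 1) + (A 1 0 * y.2) * (A 1 0 * y.2)); last first.
  by apply/funext => y; rewrite /mden !expr2.
have h : differentiable (fun y : plane R => A 1 0 * y.1 + A 1 1) z.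
  by apply: diffD; [apply: diffM; [exact: diffC|exact: diff_id1]|exact: diffC].
have h' : differentiable (fun y : plane R => A 1 0 * y.2) z.
  by apply: diffM; [exact: diffC|exact: diff_id2].
by apply: diffD; apply: diffM.
Qed.

Lemma diff_moebius A (z : plane R) : mden A z != 0 -> differentiable (moebius A) z.
Proof.
move=> q0.
have hi : differentiable (fun y => (mden A y)^-1) z by apply: differentiableV => //; exact: diff_mden.
have h k l : differentiable (fun y : plane R => k * y.1 + l) z.
  by apply: diffD; [apply: diffM; [exact: diffC|exact: diff_id1]|exact: diffC].
have e : moebius A = fun z : plane R =>
  (((A 0 0 * z.1 + A 0 1) * (A 1 0 * z.1 + A 1 1) + A 0 0 * A 1 0 * (z.2 * z.2)) * (mden A z)^-1,
   z.2 * (mden A z)^-1) by [].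
rewrite e; apply: differentiable_pair; last by apply: diffM; [exact: diff_id2|exact: hi].
apply: diffM; last exact: hi.
apply: diffD; first by apply: diffM.
by apply: diffM; [exact: diffC|apply: diffM; exact: diff_id2].
Qed.

Lemma diff_mobder A (z : plane R) : mden A z != 0 ->
  differentiable (fun y => (mobder A y).1) z /\ differentiable (fun y => (mobder A y).2) z.
Proof.
move=> q0.
have hi : differentiable (fun y => (mden A y)^-1) z by apply: differentiableV => //; exact: diff_mden.
have e y : (mobder A y).1 = ((A 1 0 * y.1 + A 1 1) * (A 1 0 * y.1 + A 1 1) + - ((A 1 0 * y.2) * (A 1 0 * y.2))) * ((mden A y)^-1 * (mden A y)^-1).
  by rewrite /mobder /= -invfM -!expr2.
have e' y : (mobder A y).2 = - ((2 * (A 1 0 * y.1 + A 1 1)) * (A 1 0 * y.2)) * ((mden A y)^-1 * (mden A y)^-1).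
  by rewrite /mobder /= -invfM -!expr2.
have h : differentiable (fun y : plane R => A 1 0 * y.1 + A 1 1) z.
  by apply: diffD; [apply: diffM; [exact: diffC|exact: diff_id1]|exact: diffC].
have h' : differentiable (fun y : plane R => A 1 0 * y.2) z.
  by apply: diffM; [exact: diffC|exact: diff_id2].
have hi2 : differentiable (fun y => (mden A y)^-1 * (mden A y)^-1) z by apply: diffM.
split.
  rewrite (funext e); apply: diffM; last exact: hi2.
  by apply: diffD; [exact: diffM|apply: diffN; exact: diffM].
rewrite (funext e'); apply: diffM; last exact: hi2.
by apply: diffN; apply: diffM; [apply: diffM; [exact: diffC|exact: h]|exact: h'].
Qed.

Lemma is_derive_moebius A (z v : plane R) : \det A = 1 -> H z ->
  is_derive z v (moebius A) (cmul (mobder A z) v).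
Proof.
move=> dA Hz; have q0 := mden_gt0 dA Hz; have qn : mden A z != 0 by rewrite lt0r_neq0.
have dm := diff_moebius qn.
have dx : is_derive z v (fun y : plane R => y.1) v.1 by apply: is_derive_fst; exact: is_derive_id.
have dy : is_derive z v (fun y : plane R => y.2) v.2 by apply: is_derive_snd; exact: is_derive_id.
have cst (k : R) : is_derive z v (fun y : plane R => k) 0 by exact: is_derive_cst.
have dL k l : is_derive z v (fun y : plane R => k * y.1 + l) (k * v.1).
  have := is_derive_add (is_derive_mul (cst k) dx) (cst l).
  by rewrite mulr0 !addr0.
have dU k : is_derive z v (fun y : plane R => k * y.2) (k * v.2).
  by have := is_derive_mul (cst k) dy; rewrite mulr0 addr0.
have dq := is_derive_add (is_derive_mul (dL (A 1 0) (A 1 1)) (dL (A 1 0) (A 1 1))) (is_derive_mul (dU (A 1 0)) (dU (A 1 0))).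
have e : (fun y : plane R => (A 1 0 * y.1 + A 1 1) * (A 1 0 * y.1 + A 1 1) + (A 1 0 * y.2) * (A 1 0 * y.2)) = mden A.
  by apply/funext => y; rewrite /mden !expr2.
rewrite e in dq.
have di := is_derive_inv qn dq.
have d2 := is_derive_mul dy di.
have d1 := is_derive_mul (is_derive_add (is_derive_mul (dL (A 0 0) (A 0 1)) (dL (A 1 0) (A 1 1))) (is_derive_mul (cst (A 0 0 * A 1 0)) (is_derive_mul dy dy))) di.
have [_ E1] := is_derive_fst (diff_is_derive v dm).
have [_ E2] := is_derive_snd (diff_is_derive v dm).
have [_ E3] := d1. have [_ E4] := d2.
have E5 := etrans (esym E1) E3; have E6 := etrans (esym E2) E4.
have -> : cmul (mobder A z) v = 'D_v (moebius A) z.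
  rewrite [RHS]surjective_pairing E5 E6 /cmul /mobder.
  rewrite det2 in dA; move: qn; rewrite /mden /=.
  move: (A 0 0) (A 0 1) (A 1 0) (A 1 1) dA (z.1) (z.2) (v.1) (v.2) => a b c d dA x y v1 v2.
  move=> qn; congr pair; last by field.
  have k (X Y : R) : X * (a * d - b * c) = Y -> X = Y by rewrite dA mulr1.
  by apply: k; field.
exact: diff_is_derive.
Qed.

Lemma moebius_continuous B z : \det B = 1 -> H z -> {for z, continuous (moebius B)}.
Proof.
move=> dB Hz; have q0 : mden B z != 0 by rewrite lt0r_neq0 // mden_gt0.
exact: (differentiable_continuous (diff_moebius q0)).
Qed.

Lemma moebius_transitive z : H z -> exists A, \det A = 1 /\ moebius A base = z.
Proof.
case: z => x y Hz; have y0 : 0 < y by exact: Hz.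
pose r := Num.sqrt y; have r0 : r != 0 by rewrite gt_eqF // sqrtr_gt0.
have rr : r ^+ 2 = y by rewrite sqr_sqrtr // ltW.
exists (mx2 r (x / r) 0 r^-1); split; first by rewrite det_mx2 mulr0 subr0 divff.
have [E1 E2 E3 E4] := mx2E r (x / r) 0 r^-1.
rewrite moebiusE /mden E1 E2 E3 E4 /= -rr; congr pair; by field.
Qed.

(** The numbers p, q are the cosine and the sine of half the angle; the formula with p in a
    denominator fails at the angle pi only. *)
Lemma half_angle (al be : R) : al ^+ 2 + be ^+ 2 = 1 ->
  exists p q, [/\ p * p + q * q = 1, - (2 * p * q) = al & p * p - q * q = be].
Proof.
move=> h; have [b1|b1] := eqVneq be (-1).
  exists 0, 1; split; rewrite ?b1; try by ring.
  have : al ^+ 2 = 0 by move: h; rewrite b1 sqrrN expr1n; move: (al ^+ 2) => x; lra.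
  by move/eqP; rewrite sqrf_eq0 => /eqP ->; ring.
have be1 : -1 <= be.
  have : be ^+ 2 <= 1 by rewrite -h lerDr sqr_ge0.
  move=> b2; rewrite leNgt; apply/negP => lt.
  have : 0 < (- 1 - be) * (1 - be) by rewrite mulr_gt0; lra.
  by rewrite (_ : _ * _ = be ^+ 2 - 1); [rewrite subr_gt0 ltNge b2|ring].
have b0 : 0 < (1 + be) / 2.
  by rewrite divr_gt0 // -ltrBlDl sub0r lt_neqAle eq_sym b1.
pose p := Num.sqrt ((1 + be) / 2).
have p0 : p != 0 by rewrite gt_eqF // sqrtr_gt0.
have pp : p * p = (1 + be) / 2 by rewrite -expr2 sqr_sqrtr // ltW.
have qq : (- al / (2 * p)) * (- al / (2 * p)) = (1 - be) / 2.
  rewrite (_ : _ * _ = al ^+ 2 / (4 * (p * p))); last by field.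
  rewrite pp (_ : al ^+ 2 = (1 + be) * (1 - be)); last by rewrite -(addrK (be ^+ 2) (al ^+ 2)) h; ring.
  by field; rewrite gt_eqF // -(pmulr_lgt0 _ (_ : 0 < 2^-1)) // invr_gt0.
exists p, (- al / (2 * p)); split; rewrite ?qq ?pp; by field.
Qed.

Lemma rotation_moebius (p q : R) : p * p + q * q = 1 ->
  [/\ \det (mx2 p q (- q) p) = 1, moebius (mx2 p q (- q) p) base = base,
    (cmul (mobder (mx2 p q (- q) p) base) e2) = (- (2 * p * q), p * p - q * q) &
    (cmul (mobder (mx2 p q (- q) p) base) e1) = (p * p - q * q, 2 * p * q)].
Proof.
move=> h; have [E1 E2 E3 E4] := mx2E p q (- q) p.
have D : mden (mx2 p q (- q) p) base = 1 by rewrite /mden E3 E4 /=; apply: etrans h; ring.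
split.
- by rewrite det_mx2; apply: etrans h; ring.
- rewrite moebiusE D E1 E2 E3 E4 /= invr1 !mulr1; congr pair; ring.
- by rewrite /cmul /mobder D E3 E4 /= expr1n !divr1; congr pair; ring.
- by rewrite /cmul /mobder D E3 E4 /= expr1n !divr1; congr pair; ring.
Qed.

Lemma moebius_base (a b c d : R) : let q := d * d + c * c in
  moebius (mx2 a b c d) base = ((b * d + a * c) * q^-1, q^-1) /\
  mobder (mx2 a b c d) base = ((d * d - c * c) * (q^-1 * q^-1), - (2 * d * c) * (q^-1 * q^-1)).
Proof.
move=> q; have [E1 E2 E3 E4] := mx2E a b c d.
have D : mden (mx2 a b c d) base = q by rewrite /mden E3 E4 /= /q; ring.
split; first by rewrite moebiusE D E1 E2 E3 E4 /=; congr pair; ring.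
by rewrite /mobder D E3 E4 /= expr2 invfM; congr pair; ring.
Qed.

Lemma moebius_base_cvg (I : Type) (FF : set_system I) {FFF : Filter FF} (a_ b_ c_ d_ : I -> R) (a b c d : R) :
  a_ @ FF --> a -> b_ @ FF --> b -> c_ @ FF --> c -> d_ @ FF --> d -> a * d - b * c = 1 ->
  (fun i => moebius (mx2 (a_ i) (b_ i) (c_ i) (d_ i)) base) @ FF --> moebius (mx2 a b c d) base /\
  (fun i => mobder (mx2 (a_ i) (b_ i) (c_ i) (d_ i)) base) @ FF --> mobder (mx2 a b c d) base.
Proof.
move=> ca cb cc cd det1.
have q0 : d * d + c * c != 0.
  apply/eqP => e; have [d0 c0] : d = 0 /\ c = 0.
    by move: e; move/eqP; rewrite paddr_eq0 -?expr2 ?sqr_ge0 // !sqrf_eq0 => /andP[/eqP -> /eqP ->].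
  by move: det1; rewrite d0 c0 !mulr0 subrr => /eqP; rewrite eq_sym oner_eq0.
have cq : (fun i => (d_ i * d_ i + c_ i * c_ i)^-1) @ FF --> (d * d + c * c)^-1.
  by apply: cvgV => //; apply: cvgD; [exact: (cvgM cd cd)|exact: (cvgM cc cc)].
have [-> ->] := moebius_base a b c d.
split.
  under eq_fun do rewrite (moebius_base _ _ _ _).1.
  apply: cvg_pr; last exact: cq.
  by apply: cvgM; [apply: cvgD; [exact: (cvgM cb cd)|exact: (cvgM ca cc)]|exact: cq].
under eq_fun do rewrite (moebius_base _ _ _ _).2.
apply: cvg_pr; apply: cvgM; try exact: (cvgM cq cq).
  by apply: cvgB; [exact: (cvgM cd cd)|exact: (cvgM cc cc)].
apply: cvgN; apply: cvgM; last exact: cc.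
by apply: cvgM; [exact: cvg_cst|exact: cd].
Qed.

(** A rotation about i that fixes a tangent vector is trivial in PSL(2, R). *)
Lemma moebius_fixes_frame (C : 'M[R]_2) : \det C = 1 -> moebius C base = base ->
  cmul (mobder C base) e2 = e2 -> C = 1 \/ C = - 1.
Proof.
rewrite (mx2_eta C) det_mx2; move: (C 0 0) (C 0 1) (C 1 0) (C 1 1) => a b c d det1.
have [-> ->] := moebius_base a b c d.
rewrite /cmul /= => -[h1 h2] [h3 h4].
have q1 : d * d + c * c = 1 by rewrite -[LHS]invrK h2 invr1.
rewrite q1 invr1 !mulr1 !mulr0 ?addr0 ?sub0r ?add0r in h1 h3 h4.
have c0 : c = 0.
  have : c * c = 0 by move: q1 h4; move: (c * c) (d * d) => x y; lra.
  by move/eqP; rewrite mulf_eq0 orbb => /eqP.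
rewrite c0 mulr0 subr0 in det1; rewrite c0 !mulr0 !addr0 in h1 q1.
have d0 : d != 0 by apply/eqP => e; move: q1; rewrite e mulr0 => /eqP; rewrite eq_sym oner_eq0.
have b0 : b = 0 by move/eqP: h1; rewrite mulf_eq0 (negbTE d0) orbF => /eqP.
have ad : a = d by apply: (mulIf d0); rewrite det1 q1.
have : (d - 1) * (d + 1) = 0 by rewrite -(subrr (1 : R)) -{3}q1; ring.
move/eqP; rewrite mulf_eq0 subr_eq0 addr_eq0 => /orP[/eqP|/eqP] e.
  by left; rewrite mx21 ad b0 c0 e.
by right; rewrite mx2N1 ad b0 c0 e.
Qed.

Definition mx_sum (X : 'M[R]_2) : R := \sum_i \sum_j `|X i j|.

Lemma mx_sum_ge0 X : 0 <= mx_sum X.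
Proof. by apply: sumr_ge0 => i _; apply: sumr_ge0. Qed.

Lemma mx_sum_ge (X : 'M[R]_2) i j : `|X i j| <= mx_sum X.
Proof.
rewrite /mx_sum (bigD1 i) //= (bigD1 j) //= -addrA lerDl addr_ge0 //.
  by apply: sumr_ge0.
by apply: sumr_ge0 => k _; apply: sumr_ge0.
Qed.

Lemma mulmx_bound (X D Y : 'M[R]_2) (e : R) i j : 0 <= e -> (forall k l, `|D k l| <= e) ->
  `|(X * D * Y) i j| <= mx_sum X * e * mx_sum Y * 4.
Proof.
move=> e0 De.
have b (k l : 'I_2) : `|(X i k * D k l) * Y l j| <= mx_sum X * e * mx_sum Y.
  by rewrite !normrM; do 2 (apply: ler_pM; rewrite ?mulr_ge0 ?mx_sum_ge //).
rewrite -mulmxE mxE; apply: le_trans (ler_norm_sum _ _ _) _.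
apply: (@le_trans _ _ (\sum_(l < 2) \sum_(k < 2) mx_sum X * e * mx_sum Y)).
  apply: ler_sum => l _; rewrite mxE mulr_suml; apply: le_trans (ler_norm_sum _ _ _) _.
  by apply: ler_sum => k _; exact: b.
rewrite !sumr_const !card_ord -mulrnA -[X in X <= _]mulr_natr //.
Qed.

End Moebius.

(** * Charts of a lamination *)

Section Lamination.
Context {R : realType} {M : metricType R} {F : lamination R M}.
Implicit Types (a b : idx F).
Local Notation e1 := ((1, 0) : plane R).
Local Notation e2 := ((0, 1) : plane R).
Local Notation base := ((0, 1) : plane R).
Local Notation H := (@upper_half_plane R).

Lemma leaf_openE (O : set (leaf_space F)) : @open (leaf_space F) O = leaf_open O.
Proof. by []. Qed.

Lemma param_line_cvg b (x : plane R) (t : transv b) : chart_disk_of b x ->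
  (fun y : plane R => param b (y, t)) @ x --> param b (x, t).
Proof.
move=> dx; have c := @param_continuous _ _ _ b (x, t) dx.
have H : (fun y : plane R => (y, t)) @ x --> (x, t).
  by apply: (cvg_pair (G := nbhs x)); [exact: cvg_id | exact: cvg_cst].
exact: (cvg_comp _ _ H c).
Qed.

Lemma open_in_leaf (O : set M) : open O -> @open (leaf_space F) O.
Proof.
move=> oO; rewrite leaf_openE => a t; rewrite openE => x [dx Ox].
have c := param_line_cvg (t := t) dx.
apply: filterI.
  by apply: open_nbhs_nbhs; split=> //; exact: disk_open.
by apply: c; exact: open_nbhs_nbhs.
Qed.

Lemma leaf_to_M_cvg (I : Type) (FF : set_system I) (FFF : Filter FF) (u : I -> leaf_space F) (x : leaf_space F) :
  u @ FF --> x -> (u : I -> M) @ FF --> (x : M).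
Proof.
move=> ux A; rewrite nbhsE => -[W [oO Ox] OA].
apply: (filterS OA); apply: ux; apply: open_nbhs_nbhs; split=> //.
exact: open_in_leaf.
Qed.

Arguments leaf_to_M_cvg {I FF FFF u x}.

Lemma overlap_open a b : open (@overlap _ _ F a b).
Proof.
rewrite openE => p [dp dap].
apply: filterI.
  have c : (fun q : plane R * transv b => q.1) @ p --> p.1 by exact: cvg_fst.
  by apply: c; apply: open_nbhs_nbhs; split=> //; exact: disk_open.
have c := param_continuous dp.
by apply: c; apply: open_nbhs_nbhs; split=> //; exact: dom_open.
Qed.

(** The second coordinate is constant on plaques of any other chart, by [change_transverse]. *)
Lemma plaque_open a (t : transv a) (W : set (plane R)) : open W ->
  @open (leaf_space F) [set m : leaf_space F | [/\ dom a m, (chart a m).2 = t & W (chart a m).1]].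
Proof.
move=> oW; rewrite leaf_openE => b s; rewrite openE => x [dx [dax tx Wx]].
have [tau Htau] := change_transverse a b.
have ts : tau s = t by rewrite -tx -(Htau (x, s)).
have c := param_line_cvg (t := s) dx.
have N1 : \forall y \near x, chart_disk_of b y.
  by apply: open_nbhs_nbhs; split=> //; exact: disk_open.
have N2 : \forall y \near x, dom a (param b (y, s)).
  by apply: c; apply: open_nbhs_nbhs; split=> //; exact: dom_open.
have N3 : \forall y \near x, W (chart a (param b (y, s))).1.
  have c2 : (fun y : plane R => (chart a (param b (y, s))).1) @ x --> (chart a (param b (x, s))).1.
    exact: (cvg1 (cvg_app (chart_continuous dax) c)).
  by apply: c2; apply: open_nbhs_nbhs; split.
apply: filterS2 (filterI N1 N2) N3 => y [dy day] Wy; split=> //; split=> //.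
by rewrite (Htau (y, s)).
Qed.

Lemma plaque_compact a (t : transv a) (c : plane R) (r : R) :
  (forall x, `|x - c| <= r -> chart_disk_of a x) ->
  closed [set param a (x, t) | x in [set x : plane R | `|x - c| <= r]].
Proof.
move=> hd; apply: compact_closed; first exact: metric_hausdorff.
apply: continuous_compact; last exact: square_compact.
apply: continuous_in_subspaceT => x; rewrite inE => xr.
have h : (fun y : plane R => param a (y, t)) @ x --> param a (x, t).
  have c0 : {for (x, t), continuous (@param _ _ F a)} by apply: param_continuous; exact: (hd x xr).
  apply: (cvg_app c0); apply: cvg_pr; [exact: cvg_id|exact: cvg_cst].
exact: h.
Qed.

Definition transition a b (t : transv b) (x : plane R) : plane R := (chart a (param b (x, t))).1.

Lemma transition_diff a b (p : plane R * transv b) : @overlap _ _ F a b p ->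
  differentiable (transition a p.2) p.1.
Proof.
move=> Op.
have h := @smooth_family_diff_plane R _ _ _ p [::] (@overlap_open a b) (@change_smooth _ _ F a b) Op.
exact: h.
Qed.

Lemma dchangeE a b (p : plane R * transv b) (u : plane R) : @overlap _ _ F a b p ->
  dchange a p u = u.1 *: 'D_e1 (transition a p.2) p.1 + u.2 *: 'D_e2 (transition a p.2) p.1.
Proof.
by move=> Op; rewrite /dchange -deriveE; [exact: derive_plane (transition_diff Op)|exact: transition_diff].
Qed.

Lemma dchange_cvg a b (I : Type) (FF : set_system I) {FFF : Filter FF}
    (p_ : I -> plane R * transv b) (u_ : I -> plane R) p u :
  @overlap _ _ F a b p -> p_ @ FF --> p -> u_ @ FF --> u ->
  [/\ \forall i \near FF, @overlap _ _ F a b (p_ i),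
    (fun i => chart a (param b (p_ i))) @ FF --> chart a (param b p) &
    (fun i => dchange a (p_ i) (u_ i)) @ FF --> dchange a p u].
Proof.
move=> Op pp uu; have [dp dap] := Op.
have n : \forall i \near FF, @overlap _ _ F a b (p_ i).
  by apply: pp; apply: open_nbhs_nbhs; split=> //; exact: overlap_open.
split=> //.
  have c1 := cvg_comp _ _ pp (param_continuous dp).
  exact: (cvg_comp _ _ c1 (chart_continuous dap)).
have c v : (fun i => 'D_v (transition a (p_ i).2) (p_ i).1) @ FF --> 'D_v (transition a p.2) p.1.
  have [_ c] := @change_smooth _ _ F a b [:: v] p Op.
  exact: (cvg_comp _ _ pp c).
rewrite (dchangeE u Op).
have h : (fun i => (u_ i).1 *: 'D_e1 (transition a (p_ i).2) (p_ i).1 +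
    (u_ i).2 *: 'D_e2 (transition a (p_ i).2) (p_ i).1) @ FF -->
   u.1 *: 'D_e1 (transition a p.2) p.1 + u.2 *: 'D_e2 (transition a p.2) p.1.
  by apply: cvgD; apply: cvgZ; [exact: cvg1 uu|exact: c|exact: cvg2 uu|exact: c].
apply: cvg_trans h; apply: near_eq_cvg; apply: filterS n => i Oi.
by rewrite (dchangeE _ Oi).
Qed.

Lemma transition_near a b (p : plane R * transv b) c : @overlap _ _ F a b p -> @overlap _ _ F c b p ->
  \forall y \near p.1, transition c p.2 y =
    transition c (chart a (param b p)).2 (transition a p.2 y).
Proof.
move=> Oa Oc.
have [tau Htau] := @change_transverse _ _ F a b.
have n : \forall y \near p.1, @overlap _ _ F a b (y, p.2).
  by apply: slice_near; apply: open_nbhs_nbhs; split=> //; exact: overlap_open.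
apply: filterS n => y [dy day]; rewrite /transition.
have -> : (chart a (param b p)).2 = (chart a (param b (y, p.2))).2.
  by case: Oa => dp dap; rewrite (Htau p) // (Htau (y, p.2)).
by rewrite -surjective_pairing chartK.
Qed.

Lemma transition_id a (p : plane R * transv a) : chart_disk_of a p.1 ->
  \forall y \near p.1, transition a p.2 y = y.
Proof.
move=> dp.
have n : \forall y \near p.1, chart_disk_of a y.
  by apply: open_nbhs_nbhs; split=> //; exact: disk_open.
by apply: filterS n => y dy; rewrite /transition paramK.
Qed.

Lemma dchange_id a (p : plane R * transv a) u : chart_disk_of a p.1 -> dchange a p u = u.
Proof.
move=> dp; have n := transition_id dp.
have n' : \forall y \near p.1, id y = transition a p.2 y by apply: filterS n => y ->.
have [_ e] := near_eq_differentiable n' (@ex_diff _ _ _ _ _ _ _ (is_diff_id p.1)).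
rewrite /dchange -[(fun x => _)]/(transition a p.2) e.
by rewrite (@diff_val _ _ _ _ _ _ _ (is_diff_id p.1)).
Qed.

Lemma dchange_comp a b c (p : plane R * transv b) u : @overlap _ _ F a b p -> @overlap _ _ F c b p ->
  dchange c (chart a (param b p)) (dchange a p u) = dchange c p u.
Proof.
move=> Oa Oc; have n := transition_near Oa Oc.
have [dp dap] := Oa; have [_ dcp] := Oc.
set q := chart a (param b p) in n *.
have Oq : @overlap _ _ F c a q.
  by split; [exact: chart_disk | rewrite chartK].
have dq : differentiable (transition c q.2) (transition a p.2 p.1).
  by have := transition_diff Oq; rewrite /q /transition -surjective_pairing.
have da := transition_diff Oa.
have n' : \forall y \near p.1, (transition c q.2 \o transition a p.2) y = transition c p.2 y.
  by apply: filterS n => y ->.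
have [_ e] := near_eq_differentiable n' (differentiable_comp da dq).
apply: esym; apply: (etrans (congr1 (fun h : plane R -> plane R => h u) e)).
apply: (etrans (congr1 (fun h : plane R -> plane R => h u) (diff_comp da dq))).
have q1 : transition a p.2 p.1 = q.1 by rewrite /transition -surjective_pairing.
by rewrite q1.
Qed.

(** * The metric and the unit tangent bundle *)

Variable g : leaf_metric F.

Lemma chart_disk_near a (p : plane R * transv a) : chart_disk_of a p.1 ->
  \forall q \near p, chart_disk_of a q.1.
Proof.
move=> dp; have c : (fun q : plane R * transv a => q.1) @ p --> p.1 by exact: cvg_fst.
by apply: c; apply: open_nbhs_nbhs; split=> //; exact: disk_open.
Qed.

Lemma chart_disk_open a : open [set p : plane R * transv a | chart_disk_of a p.1].
Proof. by rewrite openE => p; exact: chart_disk_near. Qed.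

Lemma metric_expand a (p : plane R * transv a) u v : chart_disk_of a p.1 ->
  metric g p u v = metric g p e1 e1 * (u.1 * v.1) +
    metric g p e1 e2 * (u.1 * v.2 + u.2 * v.1) + metric g p e2 e2 * (u.2 * v.2).
Proof.
move=> dp; have lin := metric_linear g dp; have sy := Defs.metric_sym g dp.
have l0 w : metric g p 0 w = 0.
  by have := lin 1 0 0 w; rewrite scale1r addr0 mul1r; move: (metric g p 0 w) => x; lra.
have lZ k x w : metric g p (k *: x) w = k * metric g p x w.
  by have := lin k x 0 w; rewrite addr0 l0 addr0.
have lE x w : metric g p x w = x.1 * metric g p e1 w + x.2 * metric g p e2 w.
  by rewrite {1}(plane_decomp x) lin lZ.
rewrite lE (sy e1 v) (sy e2 v) !(lE v) (sy e2 e1); ring.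
Qed.

Lemma metric_coef_cvg a (I : Type) (FF : set_system I) {FFF : Filter FF} (p_ : I -> plane R * transv a)
   p u v : chart_disk_of a p.1 -> p_ @ FF --> p ->
   (fun i => metric g (p_ i) u v) @ FF --> metric g p u v.
Proof.
move=> dp pp; have [_ c] := @metric_smooth _ _ _ g a u v [::] p dp.
pose h (q : plane R * transv a) := metric g (q.1, q.2) u v.
have hE q : h q = metric g q u v by rewrite /h -surjective_pairing.
have : (fun i => h (p_ i)) @ FF --> h p by exact: cvg_app c pp.
by rewrite hE; under eq_fun do rewrite hE.
Qed.

Lemma metric_cvg a (I : Type) (FF : set_system I) {FFF : Filter FF} (p_ : I -> plane R * transv a)
   (u_ v_ : I -> plane R) p u v : chart_disk_of a p.1 -> p_ @ FF --> p ->
   u_ @ FF --> u -> v_ @ FF --> v ->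
   (fun i => metric g (p_ i) (u_ i) (v_ i)) @ FF --> metric g p u v.
Proof.
move=> dp pp uu vv; rewrite (metric_expand u v dp).
have h : (fun i => metric g (p_ i) e1 e1 * ((u_ i).1 * (v_ i).1) +
    metric g (p_ i) e1 e2 * ((u_ i).1 * (v_ i).2 + (u_ i).2 * (v_ i).1) +
    metric g (p_ i) e2 e2 * ((u_ i).2 * (v_ i).2)) @ FF -->
  metric g p e1 e1 * (u.1 * v.1) + metric g p e1 e2 * (u.1 * v.2 + u.2 * v.1) +
  metric g p e2 e2 * (u.2 * v.2).
  have c w w' : (fun i => metric g (p_ i) w w') @ FF --> metric g p w w' by exact: metric_coef_cvg.
  have u1 : (fun i => (u_ i).1) @ FF --> u.1 by exact: cvg1.
  have u2 : (fun i => (u_ i).2) @ FF --> u.2 by exact: cvg2.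
  have v1 : (fun i => (v_ i).1) @ FF --> v.1 by exact: cvg1.
  have v2 : (fun i => (v_ i).2) @ FF --> v.2 by exact: cvg2.
  apply: cvgD; [apply: cvgD|].
  - by apply: cvgM; [exact: c|apply: cvgM; [exact: u1|exact: v1]].
  - apply: cvgM; first exact: c.
    by apply: cvgD; apply: cvgM; [exact: u1|exact: v2|exact: u2|exact: v1].
  - by apply: cvgM; [exact: c|apply: cvgM; [exact: u2|exact: v2]].
apply: cvg_trans h; apply: near_eq_cvg.
have n : \forall i \near FF, chart_disk_of a (p_ i).1.
  exact: (pp _ (chart_disk_near dp)).
by apply: filterS n => i di; exact: (esym (metric_expand _ _ di)).
Qed.

(** Complete the square in each variable. *)
Lemma quadratic_lower (A B C K m : R) (u : plane R) : 0 < A -> A <= K -> C <= K ->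
  m <= A * C - B ^+ 2 -> 0 < m -> 0 < C ->
  m / K * `|u| ^+ 2 <= A * (u.1 * u.1) + B * (u.1 * u.2 + u.2 * u.1) + C * (u.2 * u.2).
Proof.
move=> A0 AK CK mD m0 C0; have K0 : 0 < K by apply: lt_le_trans AK.
set Q := _ + C * _.
have h1 : m * u.1 ^+ 2 <= K * Q.
  have e : C * Q = (C * u.2 + B * u.1) ^+ 2 + (A * C - B ^+ 2) * u.1 ^+ 2 by rewrite /Q; ring.
  have Q0 : 0 <= Q.
    rewrite -(pmulr_rge0 _ C0) e addr_ge0 ?sqr_ge0 // mulr_ge0 ?sqr_ge0 //.
    exact: le_trans (ltW m0) mD.
  apply: (@le_trans _ _ (C * Q)); last exact: ler_wpM2r.
  rewrite e; apply: (@le_trans _ _ ((A * C - B ^+ 2) * u.1 ^+ 2)).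
    by rewrite ler_wpM2r // sqr_ge0.
  by rewrite lerDr sqr_ge0.
have h2 : m * u.2 ^+ 2 <= K * Q.
  have e : A * Q = (A * u.1 + B * u.2) ^+ 2 + (A * C - B ^+ 2) * u.2 ^+ 2 by rewrite /Q; ring.
  have Q0 : 0 <= Q.
    rewrite -(pmulr_rge0 _ A0) e addr_ge0 ?sqr_ge0 // mulr_ge0 ?sqr_ge0 //.
    exact: le_trans (ltW m0) mD.
  apply: (@le_trans _ _ (A * Q)); last exact: ler_wpM2r.
  rewrite e; apply: (@le_trans _ _ ((A * C - B ^+ 2) * u.2 ^+ 2)).
    by rewrite ler_wpM2r // sqr_ge0.
  by rewrite lerDr sqr_ge0.
rewrite mulrAC ler_pdivrMr // [Q * K]mulrC norm_plane.
have [le|lt] := leP `|u.1| `|u.2|.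
  by rewrite real_normK ?num_real.
by rewrite real_normK ?num_real.
Qed.

Lemma metric_lower a (p : plane R * transv a) : chart_disk_of a p.1 ->
  exists2 m : R, 0 < m & \forall q \near p, chart_disk_of a q.1 /\
     forall u : plane R, m * `|u| ^+ 2 <= metric g q u u.
Proof.
move=> dp.
pose A q := metric g (q : plane R * transv a) e1 e1.
pose B q := metric g (q : plane R * transv a) e1 e2.
pose C q := metric g (q : plane R * transv a) e2 e2.
have ne1 : e1 != 0 :> plane R by apply/eqP => -[/eqP]; rewrite oner_eq0.
have ne2 : e2 != 0 :> plane R by apply/eqP => -[/eqP]; rewrite oner_eq0.
have A0 : 0 < A p by exact: metric_gt0.
have C0 : 0 < C p by exact: metric_gt0.
have D0 : 0 < A p * C p - B p ^+ 2.
  pose u : plane R := (- B p, A p).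
  have u0 : u != 0 by apply/eqP => -[_ /eqP]; rewrite gt_eqF.
  have := metric_gt0 g dp u0; rewrite metric_expand //= -/(A p) -/(B p) -/(C p).
  rewrite (_ : _ + _ = A p * (A p * C p - B p ^+ 2)); last by ring.
  by rewrite pmulr_rgt0.
have cA : A @ p --> A p by apply: metric_coef_cvg => //; exact: cvg_id.
have cB : B @ p --> B p by apply: metric_coef_cvg => //; exact: cvg_id.
have cC : C @ p --> C p by apply: metric_coef_cvg => //; exact: cvg_id.
have cD : (fun q => A q * C q - B q ^+ 2) @ p --> A p * C p - B p ^+ 2.
  by apply: cvgB; [exact: cvgM|rewrite expr2; under eq_fun do rewrite expr2; exact: cvgM].
pose K := A p + C p + 1.
pose m := (A p * C p - B p ^+ 2) / 2.
have m0 : 0 < m by rewrite divr_gt0.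
have mD : m < A p * C p - B p ^+ 2 by rewrite /m ltr_pdivrMr // mulr_natr mulr2n ltrDl.
exists (m / K); first by rewrite divr_gt0 // !addr_gt0.
have AK : A p < K by rewrite /K; lra.
have CK : C p < K by rewrite /K; lra.
have N1 : \forall q \near p, 0 < A q /\ 0 < C q.
  by apply: filterI; [exact: (cvgr_gt _ cA _ A0)|exact: (cvgr_gt _ cC _ C0)].
have N2 : \forall q \near p, A q < K /\ C q < K.
  by apply: filterI; [exact: (cvgr_lt _ cA _ AK)|exact: (cvgr_lt _ cC _ CK)].
have N3 : \forall q \near p, m < A q * C q - B q ^+ 2 /\ chart_disk_of a q.1.
  by apply: filterI; [exact: (cvgr_gt _ cD _ mD)|exact: chart_disk_near].
apply: filterS3 N1 N2 N3 => q [a0 c0] [ak ck] [md dq]; split=> // u.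
rewrite (metric_expand u u dq); apply: quadratic_lower => //; exact: ltW.
Qed.

Lemma unit_tangent_eq (v w : unit_tangent g) a : dom a (foot v) -> foot v = foot w ->
  tcoord v a = tcoord w a -> v = w.
Proof.
case: v => m t o1 c1 u1; case: w => m' t' o2 c2 u2 /= da e; rewrite -{}e in o2 c2 u2 * => et.
have {}et : t = t'.
  apply/funext => b; have [db|ndb] := pselect (dom b m); last by rewrite o1 // o2.
  by rewrite (c1 b a) // (c2 b a) // et.
by rewrite -{}et in o2 c2 u2 *; congr UnitTangent; exact: Prop_irrelevance.
Qed.

Lemma mk_unit_tangent a (m : M) (tau : plane R) : dom a m ->
  metric g (chart a m) tau tau = 1 -> exists w : unit_tangent g, foot w = m /\ tcoord w a = tau.
Proof.
move=> da ut.
have O_ b c : dom b m -> dom c m -> @overlap _ _ F c b (chart b m).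
  by move=> db dc; split; [exact: chart_disk | rewrite chartK].
pose t b := if pselect (dom b m) is left _ then dchange b (chart a m) tau else 0.
have h1 b : ~ dom b m -> t b = 0 by rewrite /t; case: pselect.
have h2 b c : dom b m -> dom c m -> t b = dchange b (chart c m) (t c).
  move=> db dc; rewrite /t; case: pselect => // _; case: pselect => // _.
  have := @dchange_comp c a b (chart a m) tau (O_ _ _ da dc) (O_ _ _ da db).
  by rewrite chartK.
have h3 b : dom b m -> metric g (chart b m) (t b) (t b) = 1.
  move=> db; rewrite /t; case: pselect => // _.
  have := metric_change g (O_ _ _ da db) tau tau.
  by rewrite chartK // ut.
exists (UnitTangent h1 h2 h3); split=> //=.
by rewrite /t; case: pselect => // _; rewrite dchange_id //; exact: chart_disk.
Qed.

(** Convergence in the unit tangent bundle can be tested in one chart around the limit. *)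
Lemma unit_tangent_cvg (I : Type) (FF : set_system I) {FFF : Filter FF}
    (w_ : I -> unit_tangent g) (w : unit_tangent g) a : dom a (foot w) ->
  (\forall i \near FF, dom a (foot (w_ i))) ->
  (fun i => chart a (foot (w_ i))) @ FF --> chart a (foot w) ->
  (fun i => tcoord (w_ i) a) @ FF --> tcoord w a -> w_ @ FF --> w.
Proof.
move=> da n cc tt A; rewrite nbhsE => -[W [oW Ww] WA]; apply: (filterS WA).
have oW' : unit_tangent_open W by exact: oW.
have h := oW' w Ww a da.
have ct : (fun i => (chart a (foot (w_ i)), tcoord (w_ i) a)) @ FF -->
    (chart a (foot w), tcoord w a) by exact: cvg_pr.
have := ct _ h; apply: filterS2 n => i di H; exact: H.
Qed.

Lemma unit_tangent_chart_cvg (I : Type) (FF : set_system I) {FFF : Filter FF}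
    (w_ : I -> unit_tangent g) (w : unit_tangent g) a : dom a (foot w) ->
  w_ @ FF --> w -> [/\ \forall i \near FF, dom a (foot (w_ i)),
  (fun i => chart a (foot (w_ i))) @ FF --> chart a (foot w) &
  (fun i => tcoord (w_ i) a) @ FF --> tcoord w a].
Proof.
move=> da ww.
pose S (W : set ((plane R * transv a) * plane R)) :=
  [set v : unit_tangent g | dom a (foot v) /\ W (chart a (foot v), tcoord v a)].
have oS W : open W -> open (S W).
  move=> oW; suff : unit_tangent_open (S W) by [].
  move=> v [dv Wv] b db /=.
  have O_ (v' : unit_tangent g) : dom b (foot v') -> dom a (foot v') -> @overlap _ _ F a b (chart b (foot v')).
    by move=> h1 h2; split; [exact: chart_disk | rewrite chartK].
  pose P := nbhs (chart b (foot v), tcoord v b).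
  have [n1 n2 n3] := @dchange_cvg a b _ P _ fst snd (chart b (foot v)) (tcoord v b)
     (O_ v db dv) cvg_fst cvg_snd.
  rewrite chartK // -(tcoord_change dv db) in n2 n3.
  have n4 : \forall q \near P, W (chart a (param b q.1), dchange a q.1 q.2).
    have h : (fun q : (plane R * transv b) * plane R => (chart a (param b q.1), dchange a q.1 q.2)) @ P -->
      (chart a (foot v), tcoord v a) by exact: cvg_pr.
    by apply: h; exact: open_nbhs_nbhs.
  apply: filterS2 n1 n4 => q Oq Wq w' dw' qE.
  have dw : dom a (foot w') by case: Oq => _; rewrite -qE /= chartK.
  split=> //; move: Wq; rewrite -qE /= chartK //.
  by rewrite (tcoord_change dw dw').
have key W : nbhs (chart a (foot w), tcoord w a) W -> \forall i \near FF,
   dom a (foot (w_ i)) /\ W (chart a (foot (w_ i)), tcoord (w_ i) a).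
  rewrite nbhsE => -[W' [oW' W'w] W'W].
  have : \forall i \near FF, S W' (w_ i).
    by apply: ww; apply: open_nbhs_nbhs; split; [exact: oS|split].
  by apply: filterS => i [? /W'W].
have ct : (fun i => (chart a (foot (w_ i)), tcoord (w_ i) a)) @ FF -->
    (chart a (foot w), tcoord w a).
  by move=> W /key; apply: filterS => i [].
split; [|exact: (cvg1 ct)|exact: (cvg2 ct)].
have k : \forall i \near FF, dom a (foot (w_ i)) /\ setT (chart a (foot (w_ i)), tcoord (w_ i) a).
  by apply: key; exact: filterT.
by apply: filterS k => i [].
Qed.

Lemma unit_tangent_hausdorff : hausdorff_space (unit_tangent g).
Proof.
move=> v w; rewrite cluster_cvgE => -[FF PF [vw vF]].
have wF : (id : unit_tangent g -> unit_tangent g) @ FF --> w by exact: vw.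
have {vF} vF : (id : unit_tangent g -> unit_tangent g) @ FF --> v by move=> A nA; exact: vF nA.
have [a dav] := dom_cover F (foot v).
have [b dbw] := dom_cover F (foot w).
have [n1 c1 t1] := @unit_tangent_chart_cvg _ FF _ id v a dav vF.
have [n2 c2 t2] := @unit_tangent_chart_cvg _ FF _ id w b dbw wF.
have f1 : (fun u : unit_tangent g => foot u) @ FF --> foot v.
  have h : (fun u : unit_tangent g => param a (chart a (foot u))) @ FF --> param a (chart a (foot v)).
    apply: (cvg_app (param_continuous _) c1); exact: chart_disk.
  rewrite chartK // in h; apply: cvg_trans h; apply: near_eq_cvg.
  by apply: filterS n1 => u du; rewrite /= chartK.
have f2 : (fun u : unit_tangent g => foot u) @ FF --> foot w.
  have h : (fun u : unit_tangent g => param b (chart b (foot u))) @ FF --> param b (chart b (foot w)).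
    apply: (cvg_app (param_continuous _) c2); exact: chart_disk.
  rewrite chartK // in h; apply: cvg_trans h; apply: near_eq_cvg.
  by apply: filterS n2 => u du; rewrite /= chartK.
have e : foot v = foot w by apply: (cvg_unique (@metric_hausdorff _ M) f1 f2).
apply: (unit_tangent_eq dav e).
have daw : dom a (foot w) by rewrite -e.
have [_ _ t3] := @unit_tangent_chart_cvg _ FF _ id w a daw wF.
exact: (cvg_unique (@norm_hausdorff _ _) t1 t3).
Qed.

(** Along an ultrafilter feet converge, and coordinates are bounded since the metric is bounded below
    near the limit of the feet. *)
Lemma unit_tangent_compact : compact [set: M] -> compact [set: unit_tangent g].
Proof.
move=> M_compact; rewrite compact_ultra => FF UF _.
have PF := @ultra_proper _ _ UF.
have [|x _ fx] := @ultra_cvg _ FF UF M setT (fun w : unit_tangent g => foot w) M_compact.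
  exact: filterT.
have [a dax] := dom_cover F x.
have n : \forall w \near FF, dom a (foot (w : unit_tangent g)).
  by apply: fx; apply: open_nbhs_nbhs; split=> //; exact: dom_open.
have cx : (fun w : unit_tangent g => chart a (foot w)) @ FF --> chart a x.
  exact: (cvg_app (chart_continuous dax) fx).
have dx : chart_disk_of a (chart a x).1 by exact: chart_disk.
have [m m0 Hm] := metric_lower dx.
have bd : \forall w \near FF, `|tcoord (w : unit_tangent g) a| ^+ 2 <= m^-1.
  have := cx _ Hm; apply: filterS2 n => w dw [_ Hw].
  have := Hw (tcoord w a); rewrite tcoord_unit // mulrC.
  by rewrite -ler_pdivlMr // div1r.
have bd' : \forall w \near FF, `|tcoord (w : unit_tangent g) a| <= Num.sqrt m^-1.
  apply: filterS bd => w le.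
  by rewrite -(@ler_pXn2r _ 2) ?nnegrE ?sqrtr_ge0 // sqr_sqrtr // invr_ge0 ltW.
have [|t1 _ t1l] := @ultra_cvg_bounded _ FF UF R (fun w : unit_tangent g => (tcoord w a).1) (Num.sqrt m^-1).
  by apply: filterS bd' => w; apply: le_trans; exact: norm_fst_le.
have [|t2 _ t2l] := @ultra_cvg_bounded _ FF UF R (fun w : unit_tangent g => (tcoord w a).2) (Num.sqrt m^-1).
  by apply: filterS bd' => w; apply: le_trans; exact: norm_snd_le.
have tl : (fun w : unit_tangent g => tcoord w a) @ FF --> ((t1, t2) : plane R).
  rewrite (_ : (fun w : unit_tangent g => tcoord w a) = (fun w => ((tcoord w a).1, (tcoord w a).2))).
    exact: cvg_pr.
  by apply/funext => w; case: (tcoord w a).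
have u1 : metric g (chart a x) (t1, t2) (t1, t2) = 1.
  have h := metric_cvg dx cx tl tl.
  apply: (cvg_unique (@norm_hausdorff _ _) (h _)); apply: cvg_near_cst.
  by apply: filterS n => w dw; exact: tcoord_unit.
have [w [fw tw]] := mk_unit_tangent dax u1.
exists w; split=> //; rewrite /=.
rewrite -fw in dax cx.
by apply: (@unit_tangent_cvg _ FF _ id w a dax n cx); rewrite tw.
Qed.

Lemma coef_diff a (t : transv a) (x : plane R) (vs : seq (plane R)) u v : chart_disk_of a x ->
  differentiable (iter_derive vs (fun x => metric g (x, t) u v)) x.
Proof.
move=> dx.
have h : differentiable (iter_derive vs ((fun x t => metric g (x, t) u v)^~ ((x, t) : plane R * transv a).2)) ((x, t) : plane R * transv a).1.
  have o1 := (@chart_disk_open a).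
  have o2 := (@metric_smooth _ _ _ g a u v).
  by apply: (smooth_family_diff_real vs o1 o2); exact: dx.
exact: h.
Qed.

Definition basis (b : bool) : plane R := if b then e2 else e1.

(** The relevant derivatives of the coefficients of the metric, indexed by a finite type so that
    they are bounded simultaneously. *)
Definition gder a (u v : bool) (ks : seq bool) (q : plane R * transv a) : R :=
  iter_derive (map basis ks) (fun x => metric g (x, q.2) (basis u) (basis v)) q.1.

Lemma gder_cvg a u v ks (p : plane R * transv a) : chart_disk_of a p.1 ->
  {for p, continuous (gder u v ks)}.
Proof.
move=> dp.
have [_ c] := @metric_smooth _ _ _ g a (basis u) (basis v) (map basis ks) p dp.
exact: c.
Qed.

Lemma gder_bounded a (J : finType) (f : J -> bool * bool * seq bool) (p : plane R * transv a) :
  chart_disk_of a p.1 ->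
  exists2 N : R, 0 < N & \forall q \near p, forall j, `|gder (f j).1.1 (f j).1.2 (f j).2 q| <= N.
Proof.
move=> dp; pose h j (q : plane R * transv a) := gder (f j).1.1 (f j).1.2 (f j).2 q.
exists (\sum_j `|h j p| + 1); first by rewrite ltr_wpDl // sumr_ge0.
pose P j : set (plane R * transv a) := [set q | `|h j q| <= \sum_k `|h k p| + 1].
suff : forall j, \forall q \near p, P j q by move=> hP; exact: (@filter_forall _ _ P (nbhs p) (nbhs_filter p) hP).
move=> j; rewrite /P /=.
have c : (fun q => `|h j q|) @ p --> `|h j p|.
  by apply: cvg_norm; exact: gder_cvg.
have lt : `|h j p| < \sum_j `|h j p| + 1.
  rewrite (bigD1 j) //= -addrA ltrDl ltr_wpDl // sumr_ge0 //.
have lt' : \forall q \near p, `|h j q| < \sum_k `|h k p| + 1 by exact: (cvgr_lt _ c _ lt).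
by apply: filterS lt' => q /ltW.
Qed.

(** A neighbourhood of a point in a chart, made of squares of half-side rho in the plaques, on which
    the data of the equation of jets are controlled uniformly. *)
Record good_box a (p : plane R * transv a) (rho N : R) (T : set (transv a)) : Prop := GoodBox {
  gb_rho : 0 < rho;
  gb_N : 0 < N;
  gb_T : nbhs p.2 T;
  gb_disk : forall x t, `|x - p.1| <= rho -> T t -> chart_disk_of a x;
  gb_metric : forall x t w, `|x - p.1| <= rho -> T t -> `|w| ^+ 2 <= N * metric g (x, t) w w;
  gb_der : forall x t u v k, `|x - p.1| <= rho -> T t -> `|gder u v [:: k] (x, t)| <= N;
  gb_der2 : forall x t u v k l, `|x - p.1| <= rho -> T t -> `|gder u v [:: l; k] (x, t)| <= N
}.

Lemma good_box_exists a (p : plane R * transv a) : chart_disk_of a p.1 ->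
  exists rho N T, good_box p rho N T.
Proof.
move=> dp.
have [m m0 Hm] := metric_lower dp.
have [N1 N10 H1] := @gder_bounded a (bool * bool * bool)%type
  (fun j => (j.1, [:: j.2])) p dp.
have [N2 N20 H2] := @gder_bounded a (bool * bool * bool * bool)%type
  (fun j => (j.1.1, [:: j.2; j.1.2])) p dp.
have [[A T] /= [nA nT] HAT] := filterI Hm (filterI H1 H2).
move/nbhs_normP : nA => [r /= r0 HA].
pose N := m^-1 + N1 + N2.
exists (r / 2), N, T.
have N0 : 0 < m^-1 by rewrite invr_gt0.
have key x t : `|x - p.1| <= r / 2 -> T t -> (A `*` T) (x, t).
  move=> xr Tt; split=> //=; apply: HA; rewrite /ball_ /= distrC.
  by apply: (le_lt_trans xr); rewrite ltr_pdivrMr // ltr_pMr // ltr1n.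
split=> //.
- by rewrite divr_gt0.
- by rewrite /N !addr_gt0.
- by move=> x t xr Tt; have [[]] := HAT _ (key x t xr Tt).
- move=> x t w xr Tt; have [[_ /(_ w) h] _] := HAT _ (key x t xr Tt).
  have g0 : 0 <= metric g (x, t) w w by apply: le_trans h; rewrite mulr_ge0 ?sqr_ge0 // ltW.
  apply: (@le_trans _ _ (m^-1 * metric g (x, t) w w)).
    by rewrite ler_pdivlMl.
  by rewrite ler_wpM2r // /N -addrA lerDl addr_ge0 // ltW.
- move=> x t u v k xr Tt; have [_ [/(_ (u, v, k)) h _]] := HAT _ (key x t xr Tt).
  by apply: (le_trans h); rewrite /N addrAC lerDr addr_ge0 // ltW.
- move=> x t u v k l xr Tt; have [_ [_ /(_ (u, v, k, l)) h]] := HAT _ (key x t xr Tt).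
  by apply: (le_trans h); rewrite /N lerDr addr_ge0 // ltW.
Qed.

Lemma gder_lipschitz a (p : plane R * transv a) rho N T x x' t u v k : good_box p rho N T ->
  `|x - p.1| <= rho -> `|x' - p.1| <= rho -> T t ->
  `|gder u v [:: k] (x', t) - gder u v [:: k] (x, t)| <=
    N * (`|x'.1 - x.1| + `|x'.2 - x.2|).
Proof.
move=> gb xr xr' Tt; set C := N * _.
pose G (y : plane R) := gder u v [:: k] (y, t).
have D (s : R) : 0 <= s <= 1 -> is_derive s (1 : R) (fun s : R => G (x + s *: (x' - x))) ('D_(x' - x) G (x + s *: (x' - x))).
  move=> s01; apply: is_derive_line; apply: diff_is_derive.
  apply: (@coef_diff a t _ (map basis [:: k]) (basis u) (basis v)).
  exact: (gb_disk gb (line_in_ball s01 xr xr') Tt).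
have B (s : R) : 0 <= s <= 1 -> `|'D_(x' - x) G (x + s *: (x' - x))| <= C.
  move=> s01; set y := _ + _.
  have yr : `|y - p.1| <= rho := line_in_ball s01 xr xr'.
  have dG : differentiable G y.
    apply: (@coef_diff a t _ (map basis [:: k]) (basis u) (basis v)).
    exact: (gb_disk gb yr Tt).
  rewrite (derive_plane _ dG).
  have b1 : `|'D_e1 G y| <= N by exact: (gb_der2 gb u v k false yr Tt).
  have b2 : `|'D_e2 G y| <= N by exact: (gb_der2 gb u v k true yr Tt).
  exact: (lin_bound (x' - x).1 (x' - x).2 b1 b2).
have := @increment_le R _ _ 1 C ler01 D B.
rewrite mulr1 scale0r addr0 scale1r /G.
by rewrite addrCA subrr addr0.
Qed.

(** Uniformity over the square follows from its compactness. *)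
Lemma gder_tube a (p : plane R * transv a) rho N T (eta : R) : good_box p rho N T -> 0 < eta ->
  \forall t \near p.2, forall x u v k, `|x - p.1| <= rho ->
   `|gder u v [:: k] (x, t) - gder u v [:: k] (x, p.2)| <= eta.
Proof.
move=> gb eta0.
pose P (j : bool * bool * bool) : set (transv a) := [set t | forall x, `|x - p.1| <= rho ->
  `|gder j.1.1 j.1.2 [:: j.2] (x, t) - gder j.1.1 j.1.2 [:: j.2] (x, p.2)| <= eta].
have key j : \forall t \near p.2, P j t.
  have nc := iffLR (compact_near_coveringP _) (@square_compact R p.1 rho).
  apply: (nc _ _ (fun t (x : plane R) => `|gder j.1.1 j.1.2 [:: j.2] (x, t) - gder j.1.1 j.1.2 [:: j.2] (x, p.2)| <= eta)).
  move=> x xr; have dx : chart_disk_of a x := gb_disk gb xr (nbhs_singleton (gb_T gb)).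
  pose G := @gder a j.1.1 j.1.2 [:: j.2].
  have c1 : (fun q : plane R * transv a => G (q.1, q.2)) @ (nbhs x, nbhs p.2) --> G (x, p.2).
    apply: (cvg_app (@gder_cvg a _ _ _ (x, p.2) dx)).
    by apply: cvg_pr; [exact: cvg_fst|exact: cvg_snd].
  have c2 : (fun q : plane R * transv a => G (q.1, p.2)) @ (nbhs x, nbhs p.2) --> G (x, p.2).
    apply: (cvg_app (@gder_cvg a _ _ _ (x, p.2) dx)).
    by apply: cvg_pr; [exact: cvg_fst|exact: cvg_cst].
  have c : (fun q : plane R * transv a => `|G (q.1, q.2) - G (q.1, p.2)|) @ (nbhs x, nbhs p.2) --> (0 : R).
    by rewrite -[X in _ --> X](normr0 R) -[X in `|X|](subrr (G (x, p.2))); apply: cvg_norm; apply: cvgB.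
  have lt : \forall q \near (nbhs x, nbhs p.2), `|G (q.1, q.2) - G (q.1, p.2)| < eta.
    exact: (cvgr_lt _ c _ eta0).
  by apply: filterS lt => q /ltW.
have all : \forall t \near p.2, forall j, P j t := @filter_forall _ _ P (nbhs p.2) (nbhs_filter p.2) key.
by apply: filterS all => t h x u v k; exact: (h (u, v, k)).
Qed.

(** * Local isometries from the upper half plane to a leaf *)

Variable o : leaf_orientation F.

(** An oriented local isometry from the upper half plane to a leaf, with the regularity that the
    equation of jets requires. *)
Record developing (phi : plane R -> leaf_space F) : Prop := Developing {
  dev_cont : forall z, H z -> {for z, continuous phi};
  dev_diff : forall a z, H z -> dom a (phi z) ->
    differentiable (fun y => (chart a (phi y)).1) z;
  dev_diff2 : forall a z v, H z -> dom a (phi z) ->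
    differentiable ('D_v (fun y => (chart a (phi y)).1)) z;
  dev_isom : forall a z, H z -> dom a (phi z) -> forall u v,
    metric g (chart a (phi z)) ('D_u (fun y => (chart a (phi y)).1) z)
      ('D_v (fun y => (chart a (phi y)).1) z) = (u.1 * v.1 + u.2 * v.2) / z.2 ^+ 2;
  dev_orient : forall a z, H z -> dom a (phi z) ->
    (0 < jac_det (fun u => 'D_u (fun y => (chart a (phi y)).1) z)) = orient o (chart a (phi z)).2
}.

Definition coord a (phi : plane R -> leaf_space F) (z : plane R) : plane R := (chart a (phi z)).1.

Lemma dev_near phi a z (W : set (plane R)) : developing phi -> H z -> dom a (phi z) -> open W -> W (coord a phi z) ->
  \forall y \near z, [/\ H y, dom a (phi y), (chart a (phi y)).2 = (chart a (phi z)).2 & W (coord a phi y)].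
Proof.
move=> dphi Hz dz oW Wz.
have n1 : \forall y \near z, H y by apply: open_nbhs_nbhs; split=> //; exact: upper_half_plane_open.
have n2 : \forall y \near z, [set m : leaf_space F | [/\ dom a m, (chart a m).2 = (chart a (phi z)).2 & W (chart a m).1]] (phi y).
  apply: (dev_cont dphi Hz); apply: open_nbhs_nbhs; split; first exact: plaque_open.
  by split.
by apply: filterS2 n1 n2 => y Hy [? ? ?]; split.
Qed.

Lemma dev_M_cvg phi z (I : Type) (FF : set_system I) {FFF : Filter FF} (z_ : I -> plane R) :
  developing phi -> H z -> z_ @ FF --> z -> (fun i => phi (z_ i) : M) @ FF --> (phi z : M).
Proof.
move=> dphi Hz zz; apply: leaf_to_M_cvg.
exact: (cvg_app (dev_cont dphi Hz) zz).
Qed.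

Lemma coord_change a b phi z u : developing phi -> H z -> dom a (phi z) -> dom b (phi z) ->
  'D_u (coord b phi) z = dchange b (chart a (phi z)) ('D_u (coord a phi) z).
Proof.
move=> dphi Hz da db.
have Oz : @overlap _ _ F b a (chart a (phi z)) by split; [exact: chart_disk|rewrite chartK].
have n := dev_near dphi Hz da (@openT _) I.
have n' : \forall y \near z, (transition b (chart a (phi z)).2 \o coord a phi) y = coord b phi y.
  apply: filterS n => y [Hy dy ty _]; rewrite /transition /coord /= -ty.
  by rewrite -surjective_pairing chartK.
have dt := transition_diff Oz.
have df := dev_diff dphi Hz da.
have [_ E] := near_eq_is_derive n' (is_derive_comp_diff u dt df).
apply: (etrans E).
by rewrite (deriveE _ dt).
Qed.

Lemma dev_hyp_isometry phi a z : developing phi -> H z -> dom a (phi z) ->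
  let t := (chart a (phi z)).2 in
  hyp_isometry (fun x => metric g (x, t) e1 e1) (fun x => metric g (x, t) e1 e2)
    (fun x => metric g (x, t) e2 e2) (coord a phi) z.
Proof.
move=> dphi Hz da t; have n := dev_near dphi Hz da (@openT _) I.
have dx : chart_disk_of a (coord a phi z) by exact: chart_disk.
split=> //.
- by apply: filterS n => y [Hy dy _ _]; exact: (dev_diff dphi Hy dy).
- by move=> v; exact: (dev_diff2 dphi v Hz da).
- exact: (@coef_diff a t (coord a phi z) [::] e1 e1 dx).
- exact: (@coef_diff a t (coord a phi z) [::] e1 e2 dx).
- exact: (@coef_diff a t (coord a phi z) [::] e2 e2 dx).
- move=> v w _ _; apply: filterS n => y [Hy dy ty _].
  have := dev_isom dphi Hy dy v w.
  have dcy : chart_disk_of a (chart a (phi y)).1 by exact: chart_disk.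
  rewrite (metric_expand _ _ dcy).
  have -> : chart a (phi y) = (coord a phi y, t) by rewrite /t -ty -surjective_pairing.
  by [].
Qed.

(** A unit vector of H at height y has Euclidean length y, and 2 N <= (2 N + 1)^2. *)
Lemma dev_speed phi a z w (N y0 : R) : developing phi -> dom a (phi z) -> 0 < N ->
  0 < y0 <= z.2 ->
  (forall u, `|u| ^+ 2 <= N * metric g (chart a (phi z)) u u) ->
  `|'D_w (coord a phi) z| <= (N + N + 1) / y0 * `|w|.
Proof.
move=> dphi da N0 /andP[y00 yz] b.
have z0 : 0 < z.2 by apply: lt_le_trans yz.
have := b ('D_w (coord a phi) z).
rewrite (dev_isom dphi z0 da w w) => h.
have Cw : 0 <= (N + N + 1) / y0 * `|w|.
  by rewrite !mulr_ge0 // ?invr_ge0 ?(ltW y00) // !addr_ge0 // ltW.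
rewrite -(@ler_pXn2r _ 2) ?nnegrE //; apply: (le_trans h).
have w2 : w.1 * w.1 + w.2 * w.2 <= `|w| ^+ 2 + `|w| ^+ 2.
  rewrite -!expr2 -[w.1 ^+ 2]real_normK ?num_real // -[w.2 ^+ 2]real_normK ?num_real //.
  by apply: lerD; rewrite lerXn2r ?nnegrE //; [exact: norm_fst_le|exact: norm_snd_le].
have iy : (z.2 ^+ 2)^-1 <= (y0 ^+ 2)^-1.
  by rewrite lef_pV2 ?posrE ?exprn_gt0 // lerXn2r ?nnegrE // ltW.
apply: (@le_trans _ _ (N * ((`|w| ^+ 2 + `|w| ^+ 2) * (y0 ^+ 2)^-1))).
  rewrite ler_wpM2l ?(ltW N0) //; apply: ler_pM => //.
    by rewrite addr_ge0 // -expr2 sqr_ge0.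
  by rewrite invr_ge0 sqr_ge0.
rewrite !exprMn exprVn mulrA mulrAC -subr_ge0 -!mulrBl.
rewrite mulr_ge0 ?invr_ge0 ?sqr_ge0 //.
have := sqr_ge0 (`|w| : R); move: (`|w| ^+ 2) => k k0.
rewrite (_ : _ - _ = k * (N * N * 4 + N + N + 1)); last by ring.
by rewrite mulr_ge0 // !addr_ge0 // ?mulr_ge0 // ltW.
Qed.

(** The image of the segment cannot leave the square through its boundary, since its speed is
    bounded; it cannot jump to another plaque, since the image of a smaller closed square is closed
    in the ambient space. *)
Lemma dev_stay phi a (p : plane R * transv a) rho N T z w (y0 : R) : developing phi ->
  good_box p rho N T -> 0 < y0 ->
  (forall s : R, 0 <= s <= 1 -> y0 <= (z + s *: w).2) ->
  dom a (phi z) -> T (chart a (phi z)).2 ->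
  `|coord a phi z - p.1| + (N + N + 1) / y0 * `|w| < rho ->
  forall s : R, 0 <= s <= 1 -> [/\ dom a (phi (z + s *: w)),
    (chart a (phi (z + s *: w))).2 = (chart a (phi z)).2 &
    `|coord a phi (z + s *: w) - p.1| < rho].
Proof.
move=> dphi gb y00 hy dz Tz hrho.
pose C := (N + N + 1) / y0 * `|w|.
have N0 := gb_N gb.
have C0 : 0 <= C.
  by rewrite !mulr_ge0 // ?invr_ge0 ?(ltW y00) // !addr_ge0 // ltW.
set t := (chart a (phi z)).2 in Tz *.
pose f (s : R) := z + s *: w.
have Hf s : 0 <= s <= 1 -> H (f s) by move=> /hy; exact: lt_le_trans.
pose P (s : R) := [/\ dom a (phi (f s)), (chart a (phi (f s))).2 = t &
    `|coord a phi (f s) - p.1| < rho].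
have fc : continuous f.
  by move=> s; apply: cvgD; [exact: cvg_cst|apply: cvgZr_tmp; exact: cvg_id].
have bnd (s : R) : 0 <= s <= 1 -> (forall s', 0 <= s' <= s -> P s') ->
    `|coord a phi (f s) - coord a phi z| <= C.
  move=> /andP[s0 s1] Ps.
  have D r : 0 <= r <= s -> is_derive r (1 : R) (fun r : R => coord a phi (f r)) ('D_w (coord a phi) (f r)).
    move=> rs; have [da _ _] := Ps r rs.
    apply: is_derive_line; apply: diff_is_derive.
    apply: (dev_diff dphi _ da); apply: Hf.
    by case/andP: rs => -> /le_trans -> .
  have B r : 0 <= r <= s -> `|'D_w (coord a phi) (f r)| <= C.
    move=> rs; have [da ta lt] := Ps r rs.
    have r1 : 0 <= r <= 1 by case/andP: rs => -> /le_trans -> .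
    apply: (@dev_speed phi a (f r) w N y0) => //.
      by rewrite y00 /=; exact: hy.
    move=> u; have := gb_metric gb u (ltW lt) Tz.
    by rewrite -ta /coord -surjective_pairing.
  have e1' : `|(coord a phi (f s)).1 - (coord a phi (f 0)).1| <= C * s.
    apply: (@increment_le R (fun r => (coord a phi (f r)).1) (fun r => ('D_w (coord a phi) (f r)).1)) => // r rs.
      exact: (is_derive_fst (D r rs)).
    by apply: le_trans (B r rs); exact: norm_fst_le.
  have e2' : `|(coord a phi (f s)).2 - (coord a phi (f 0)).2| <= C * s.
    apply: (@increment_le R (fun r => (coord a phi (f r)).2) (fun r => ('D_w (coord a phi) (f r)).2)) => // r rs.
      exact: (is_derive_snd (D r rs)).
    by apply: le_trans (B r rs); exact: norm_snd_le.
  have f0 : f 0 = z by rewrite /f scale0r addr0.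
  rewrite f0 in e1' e2'.
  apply: (@le_trans _ _ (C * s)); last by rewrite ler_piMr.
  by rewrite norm_plane ge_max e1' e2'.
have P0 : P 0.
  rewrite /P /f scale0r addr0; split=> //.
  by apply: le_lt_trans hrho; rewrite lerDl.
apply: (@real_induction R P P0).
- move=> s /andP[s0 s1] Ps.
  have [da ta lt] := Ps s (introT andP (conj s0 (lexx s))).
  have Hs : H (f s) by apply: Hf; rewrite s0 ltW.
  pose W := [set x : plane R | `|x - p.1| < rho].
  have oW : open W.
    rewrite openE => x xr.
    have c : (fun x : plane R => `|x - p.1|) @ x --> `|x - p.1|.
      by apply: cvg_norm; apply: cvgB; [exact: cvg_id|exact: cvg_cst].
    exact: (cvgr_lt _ c _ xr).
  have n := dev_near dphi Hs da oW lt.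
  have n' : \forall s' \near s, [/\ H (f s'), dom a (phi (f s')), (chart a (phi (f s'))).2 = (chart a (phi (f s))).2 & W (coord a phi (f s'))].
    exact: (fc s _ n).
  by apply: filterS n' => s' [_ d1 d2 d3]; split=> //; rewrite d2.
- move=> s /andP[s0 s1] Ps.
  pose rho' := `|coord a phi z - p.1| + C.
  have rr : rho' < rho by [].
  have cl := @plaque_compact a t p.1 rho' (fun x xr => gb_disk gb (le_trans xr (ltW rr)) Tz).
  have Hs : H (f s) by apply: Hf; rewrite (ltW s0).
  have cv : (fun s' => phi (f s') : M) @ s^'- --> (phi (f s) : M).
    apply: (dev_M_cvg dphi Hs); apply: cvg_at_left_filter; exact: fc.
  have [x /= xr px] : [set param a (x, t) | x in [set x : plane R | `|x - p.1| <= rho']] (phi (f s)).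
    apply: (@closed_cvg _ _ _ _ (fun s' => phi (f s') : M) _ cl _ _ cv).
    have n1 : \forall s' \near s^'-, 0 < s' by exact: nbhs_left_gt.
    have n2 : \forall s' \near s^'-, s' < s by exact: nbhs_left_lt.
    apply: filterS2 n1 n2 => s' s'0 s's.
    have Q r : 0 <= r <= s' -> P r.
      by move=> /andP[r0 rs]; apply: Ps; rewrite r0 (le_lt_trans rs).
    have [|da ta _] := Q s'; first by rewrite ltW /=.
    exists (coord a phi (f s')).
      rewrite /= (le_trans (ler_distD (coord a phi z) _ _)) // addrC lerD //.
      by apply: bnd => //; rewrite ltW //= (le_trans (ltW s's)).
    by rewrite -ta /coord -surjective_pairing chartK.
  have dx : chart_disk_of a x by exact: (gb_disk gb (le_trans xr (ltW rr)) Tz).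
  rewrite /P /coord -px paramK //; split=> //; first exact: param_dom.
  exact: le_lt_trans xr rr.
Qed.

(** Convergence of 1-jets read in the chart a; the convergence of the chart includes that of
    the transverse coordinate, so that the leaf may vary. *)
Definition jets_cvg a (I : Type) (FF : set_system I) (phi_ : I -> plane R -> leaf_space F)
    (z_ : I -> plane R) (phi : plane R -> leaf_space F) (z : plane R) :=
  [/\ \forall i \near FF, dom a (phi_ i (z_ i)),
    (fun i => chart a (phi_ i (z_ i))) @ FF --> chart a (phi z),
    (fun i => 'D_e1 (coord a (phi_ i)) (z_ i)) @ FF --> 'D_e1 (coord a phi) z &
    (fun i => 'D_e2 (coord a (phi_ i)) (z_ i)) @ FF --> 'D_e2 (coord a phi) z].

Lemma jet6_cvg a (I : Type) (FF : set_system I) {FFF : Filter FF} (phi_ : I -> plane R -> leaf_space F)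
    (z_ : I -> plane R) (phi : plane R -> leaf_space F) (z : plane R) :
  (fun i => coord a (phi_ i) (z_ i)) @ FF --> coord a phi z ->
  (fun i => 'D_e1 (coord a (phi_ i)) (z_ i)) @ FF --> 'D_e1 (coord a phi) z ->
  (fun i => 'D_e2 (coord a (phi_ i)) (z_ i)) @ FF --> 'D_e2 (coord a phi) z ->
  forall k, (k < 6)%N ->
  (fun i => jet 0 0 0 (coord a (phi_ i)) 0 (z_ i) k) @ FF --> jet 0 0 0 (coord a phi) 0 z k.
Proof.
move=> h0 h1 h2 [|[|[|[|[|[|//]]]]]] _; rewrite /jet.
- exact: cvg1 h0.
- exact: cvg2 h0.
- exact: cvg1 h1.
- exact: cvg2 h1.
- exact: cvg1 h2.
- exact: cvg2 h2.
Qed.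

Lemma cvg_jet6 a (I : Type) (FF : set_system I) {FFF : Filter FF} (phi_ : I -> plane R -> leaf_space F)
    (z_ : I -> plane R) (phi : plane R -> leaf_space F) (z : plane R) :
  (forall k, (k < 6)%N ->
  (fun i => jet 0 0 0 (coord a (phi_ i)) 0 (z_ i) k) @ FF --> jet 0 0 0 (coord a phi) 0 z k) ->
  [/\ (fun i => coord a (phi_ i) (z_ i)) @ FF --> coord a phi z,
  (fun i => 'D_e1 (coord a (phi_ i)) (z_ i)) @ FF --> 'D_e1 (coord a phi) z &
  (fun i => 'D_e2 (coord a (phi_ i)) (z_ i)) @ FF --> 'D_e2 (coord a phi) z].
Proof.
have key (u_ : I -> plane R) (u : plane R) : (fun i => (u_ i).1) @ FF --> u.1 ->
    (fun i => (u_ i).2) @ FF --> u.2 -> u_ @ FF --> u.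
  move=> h1 h2; have h : (fun i => ((u_ i).1, (u_ i).2)) @ FF --> (u.1, u.2) by exact: cvg_pr.
  move: h; rewrite -surjective_pairing.
  by rewrite (_ : (fun i => ((u_ i).1, (u_ i).2)) = u_) //; apply/funext => i; case: (u_ i).
move=> h; split; apply: key.
- exact: (h 0%N isT).
- exact: (h 1%N isT).
- exact: (h 2%N isT).
- exact: (h 3%N isT).
- exact: (h 4%N isT).
- exact: (h 5%N isT).
Qed.

Lemma sum_ge (A B C D E G K : R) : 0 <= A -> 0 <= B -> 0 <= C -> 0 <= D -> 0 <= E -> 0 <= G -> 0 <= K ->
  let S := A + B + C + D + (E + K) + G + (K + K) in
  [/\ A + B <= S, C <= S, D <= S & [/\ E + K <= S, G <= S & K + K <= S]].
Proof. by move=> A0 B0 C0 D0 E0 G0 K0 S; rewrite /S; split; [| | |split]; lra. Qed.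

(** Along the segment from z1 to z_i, all the maps stay in one good box. There their jets solve
    equations whose coefficients converge uniformly, and [jet_gronwall] compares the jets of phi_i and
    of phi at z_i; the jet of phi is continuous. *)
Lemma jets_cvg_local a (I : Type) (FF : set_system I) {FFF : Filter FF}
    (phi_ : I -> plane R -> leaf_space F) phi (z0 : plane R) :
  (forall i, developing (phi_ i)) -> developing phi -> H z0 -> dom a (phi z0) ->
  exists2 r : R, 0 < r & (forall z, `|z - z0| <= r -> H z /\ dom a (phi z)) /\
   forall z1 z2 (z_ : I -> plane R), `|z1 - z0| <= r -> `|z2 - z0| < r -> z_ @ FF --> z2 ->
   jets_cvg a FF phi_ (fun=> z1) phi z1 -> jets_cvg a FF phi_ z_ phi z2.
Proof.
move=> dphi_ dphi Hz0 da0.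
set p := chart a (phi z0).
have dp : chart_disk_of a p.1 by exact: chart_disk.
have [rho [N [T gb]]] := good_box_exists dp.
have rho0 := gb_rho gb; have N0 := gb_N gb.
pose y0 := z0.2 / 2.
have y00 : 0 < y0 by rewrite divr_gt0.
pose C := (N + N + 1) / y0.
have C0 : 0 < C by rewrite divr_gt0 // !addr_gt0.
pose W := [set x : plane R | `|x - p.1| < rho / 2].
have oW : open W.
  rewrite openE => x xr.
  have c : (fun x : plane R => `|x - p.1|) @ x --> `|x - p.1|.
    by apply: cvg_norm; apply: cvgB; [exact: cvg_id|exact: cvg_cst].
  exact: (cvgr_lt _ c _ xr).
have W0 : W (coord a phi z0) by rewrite /W /= subrr normr0 divr_gt0.
have [r1 /= r10 Hr1] := iffLR (nbhs_normP _ _) (dev_near dphi Hz0 da0 oW W0).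
(* by the bound C on the speed, the image of a segment of length 2 r moves by less than rho / 2 *)
pose r := Num.min (r1 / 2) (Num.min y0 (rho / (C * 8))).
have r0 : 0 < r by rewrite !lt_min !divr_gt0 // mulr_gt0.
have rr1 : r < r1.
  by apply: (@le_lt_trans _ _ (r1 / 2)); [rewrite ge_min lexx|rewrite ltr_pdivrMr // ltr_pMr // ltr1n].
have ry : r <= y0 by rewrite !ge_min lexx orbT.
have rC : C * (r + r) < rho / 2.
  have : r <= rho / (C * 8) by rewrite !ge_min lexx !orbT.
  rewrite ler_pdivlMr; last by rewrite (mulr_gt0 C0).
  move=> h; have Cr : 0 < C * r by exact: mulr_gt0.
  move: (C) (r) h Cr => x y.
  have -> : y * (x * 8) = x * y * 8 by ring.
  have -> : x * (y + y) = x * y + x * y by ring.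
  by move: (x * y) => k h Cr; lra.
have loc z : `|z - z0| <= r -> [/\ H z, dom a (phi z), (chart a (phi z)).2 = p.2 & W (coord a phi z)].
  by move=> zr; apply: Hr1; rewrite /ball_ /= distrC; exact: le_lt_trans zr rr1.
have ylow z : `|z - z0| <= r -> y0 <= z.2.
  move=> zr; have : `|z.2 - z0.2| <= y0.
    by apply: le_trans ry; apply: le_trans zr; exact: (norm_snd_le (z - z0)).
  rewrite ler_distl => /andP[h _]; apply: le_trans h.
  rewrite /y0; lra.
clearbody r y0; exists r; first exact: r0.
split; first by move=> z /loc [].
move=> z1 z2 z_ zr1 zr2 zz [nd1 nc1 ne1 nf1].
have [Hz1 da1 t1 W1] := loc _ zr1.
have [Hz2 da2 t2 W2] := loc _ (ltW zr2).
pose t_ i := (chart a (phi_ i z1)).2.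
have ct : t_ @ FF --> p.2 by rewrite -t1; exact: cvg2 nc1.
have nz : \forall i \near FF, `|z_ i - z0| <= r.
  have c : (fun z : plane R => `|z - z0|) @ z2 --> `|z2 - z0|.
    by apply: cvg_norm; apply: cvgB; [exact: cvg_id|exact: cvg_cst].
  have lt : \forall z \near z2, `|z - z0| < r by exact: (cvgr_lt _ c _ zr2).
  have lt' : \forall i \near FF, `|z_ i - z0| < r by exact: (near_cvg zz lt).
  by apply: filterS lt' => i /ltW.
have nT : \forall i \near FF, T (t_ i) by exact: (near_cvg ct (gb_T gb)).
have nW : \forall i \near FF, W (coord a (phi_ i) z1).
  have c : (fun i => coord a (phi_ i) z1) @ FF --> coord a phi z1 by exact: cvg1 nc1.
  by apply: (near_cvg c); apply: open_nbhs_nbhs.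
have stay psi z : developing psi -> dom a (psi z1) -> T (chart a (psi z1)).2 -> W (coord a psi z1) ->
  `|z - z0| <= r -> forall s : R, 0 <= s <= 1 -> [/\ dom a (psi (z1 + s *: (z - z1))),
    (chart a (psi (z1 + s *: (z - z1)))).2 = (chart a (psi z1)).2 &
    `|coord a psi (z1 + s *: (z - z1)) - p.1| < rho].
  move=> dpsi dz Tz Wz zr; apply: (@dev_stay psi a p rho N T z1 (z - z1) y0) => //.
    by move=> s s01; apply: ylow; exact: line_in_ball.
  have le : `|z - z1| <= r + r.
    rewrite (_ : z - z1 = (z - z0) + (z0 - z1)); last by rewrite addrA subrK.
    by apply: le_trans (ler_normD _ _) _; apply: lerD => //; rewrite distrC.
  rewrite (splitr rho); apply: ltr_leD; first exact: Wz.
  by apply: le_trans (ltW rC); rewrite ler_wpM2l // ltW.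
pose K' := `|p.1| + rho + C + N + (`|z0| + r) + y0^-1 + (r + r).
pose coef (t : transv a) (u v : bool) x := metric g (x, t) (basis u) (basis v).
pose J psi t w z := jet (coef t false false) (coef t false true) (coef t true true) (coord a psi) w z.
have iy0 : 0 < y0^-1 by rewrite invr_gt0.
have bx psi w z t : developing psi -> dom a (psi z) -> (chart a (psi z)).2 = t ->
    `|coord a psi z - p.1| < rho -> T t -> `|z - z0| <= r -> `|w| <= r + r ->
    box K' 16 (J psi t w z).
  move=> dpsi dz et lt Tt zr wr.
  have b0 : `|coord a psi z| <= `|p.1| + rho.
    rewrite -[coord a psi z](subrK p.1); apply: le_trans (ler_normD _ _) _.
    by rewrite addrC lerD // ltW.
  have be u : `|u : plane R| = 1 -> `|'D_u (coord a psi) z| <= C.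
    move=> u1; rewrite -[C]mulr1 -u1; apply: (@dev_speed psi a z u N y0) => //.
      by rewrite y00 /=; exact: ylow.
    move=> x; have := gb_metric gb x (ltW lt) Tt.
    by rewrite -et /coord -surjective_pairing.
  have oe1 : `|e1 : plane R| = 1 by rewrite norm_plane /= normr1 normr0 max_l.
  have oe2 : `|e2 : plane R| = 1 by rewrite norm_plane /= normr1 normr0 max_r.
  have b1 := be _ oe1; have b2 := be _ oe2.
  have b3 u v k : `|gder u v [:: k] (coord a psi z, t)| <= N by exact: (gb_der gb u v k (ltW lt) Tt).
  have b4 : `|z| <= `|z0| + r.
    by rewrite -[z](subrK z0); apply: le_trans (ler_normD _ _) _; rewrite addrC lerD.
  have b5 : `|z.2^-1| <= y0^-1.
    have yz := ylow z zr; have z20 : 0 < z.2 by exact: lt_le_trans yz.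
    by rewrite gtr0_norm ?invr_gt0 // lef_pV2.
  have [f0 f1 f2 [f3 f4 f5]] : [/\ `|p.1| + rho <= K', C <= K', N <= K' & [/\ `|z0| + r <= K', y0^-1 <= K' & r + r <= K']].
    by apply: sum_ge; rewrite // ltW.
  move=> i; rewrite /J /jet.
  do 16 ?[case: i => [_|i] //=].
  - exact: (le_trans (norm_fst_le _) (le_trans b0 f0)).
  - exact: (le_trans (norm_snd_le _) (le_trans b0 f0)).
  - exact: (le_trans (norm_fst_le _) (le_trans b1 f1)).
  - exact: (le_trans (norm_snd_le _) (le_trans b1 f1)).
  - exact: (le_trans (norm_fst_le _) (le_trans b2 f1)).
  - exact: (le_trans (norm_snd_le _) (le_trans b2 f1)).
  - exact: (le_trans (b3 false false false) f2).
  - exact: (le_trans (b3 false false true) f2).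
  - exact: (le_trans (b3 false true false) f2).
  - exact: (le_trans (b3 false true true) f2).
  - exact: (le_trans (b3 true true false) f2).
  - exact: (le_trans (b3 true true true) f2).
  - exact: (le_trans (norm_snd_le _) (le_trans b4 f3)).
  - exact: (le_trans b5 f4).
  - exact: (le_trans (norm_fst_le _) (le_trans wr f5)).
  - exact: (le_trans (norm_snd_le _) (le_trans wr f5)).
have aux (K x : R) : 0 <= x -> K * (x + x) <= x * ((K + 1) * 2).
  by move=> x0; rewrite -subr_ge0 (_ : _ - _ = x + x); [rewrite addr_ge0|ring].
have [K K0 HK] := @jet_gronwall R K' N (ltW N0).
have S1 : (fun i => \sum_(k < 6) (jet 0 0 0 (coord a (phi_ i)) 0 z1 k - jet 0 0 0 (coord a phi) 0 z1 k) ^+ 2) @ FF --> (0 : R).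
  apply: (@sum_sqr_cvg0 R I FF _ 6 (fun i k => jet 0 0 0 (coord a (phi_ i)) 0 z1 k - jet 0 0 0 (coord a phi) 0 z1 k)) => k k6.
  have c0 : (fun i => jet 0 0 0 (coord a (phi_ i)) 0 z1 k) @ FF --> jet 0 0 0 (coord a phi) 0 z1 k.
    apply: (@jet6_cvg a I FF _ phi_ (fun=> z1) phi z1) => //.
    exact: cvg1 nc1.
  exact: (cvg_sub0 c0).
have S2 : forall e : R, 0 < e -> \forall i \near FF,
    \sum_(k < 6) (jet 0 0 0 (coord a (phi_ i)) 0 (z_ i) k - jet 0 0 0 (coord a phi) 0 (z_ i) k) ^+ 2 <= e.
  move=> e e0.
  pose delta : R := Num.min 1 (e / ((K + 1) * 2)).
  have K10 : 0 < K + 1 by rewrite ltr_wpDl.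
  have d0 : 0 < delta by rewrite lt_min ltr01 divr_gt0 // mulr_gt0.
  have d1 : delta <= 1 by rewrite ge_min lexx.
  have d2 : delta * ((K + 1) * 2) <= e.
    by rewrite -ler_pdivlMr ?ge_min ?lexx ?orbT // mulr_gt0.
  clearbody delta.
  have n1 : \forall i \near FF, \sum_(k < 6) (jet 0 0 0 (coord a (phi_ i)) 0 z1 k - jet 0 0 0 (coord a phi) 0 z1 k) ^+ 2 < delta.
    exact: (cvgr_lt _ S1 _ d0).
  have n2 : \forall i \near FF, forall x u v k, `|x - p.1| <= rho ->
     `|gder u v [:: k] (x, t_ i) - gder u v [:: k] (x, p.2)| <= delta.
    exact: (near_cvg ct (gder_tube gb d0)).
  apply: filterS3 (filterI n1 n2) (filterI nd1 nT) (filterI nW nz) => i [h1 h2] [h3 h4] [h5 h6].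
  have w2r : `|z_ i - z1| <= r + r.
    rewrite (_ : z_ i - z1 = (z_ i - z0) + (z0 - z1)); last by rewrite addrA subrK.
    by apply: le_trans (ler_normD _ _) _; apply: lerD => //; rewrite distrC.
  have T2 : T p.2 := nbhs_singleton (gb_T gb).
  have st1 := stay (phi_ i) (z_ i) (dphi_ i) h3 h4 h5 h6.
  have st2 : forall s : R, 0 <= s <= 1 -> [/\ dom a (phi (z1 + s *: (z_ i - z1))),
    (chart a (phi (z1 + s *: (z_ i - z1)))).2 = p.2 &
    `|coord a phi (z1 + s *: (z_ i - z1)) - p.1| < rho].
    move=> s s01; rewrite -t1; apply: stay => //; by rewrite t1.
  have := HK (coef (t_ i) false false) (coef (t_ i) false true) (coef (t_ i) true true)
    (coef p.2 false false) (coef p.2 false true) (coef p.2 true true)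
    (coord a (phi_ i)) (coord a phi) z1 (z_ i - z1) delta (ltW d0).
  have addK : z1 + (z_ i - z1) = z_ i by rewrite addrC subrK.
  rewrite addK => HK'.
  have := HK' _; rewrite (eq_bigr (fun k : 'I_6 => (jet 0 0 0 (coord a (phi_ i)) 0 (z_ i) k - jet 0 0 0 (coord a phi) 0 (z_ i) k) ^+ 2)); last first.
    by move=> k _; congr ((_ - _) ^+ 2); apply: jet6.
  rewrite [X in K * (X + _)](eq_bigr (fun k : 'I_6 => (jet 0 0 0 (coord a (phi_ i)) 0 z1 k - jet 0 0 0 (coord a phi) 0 z1 k) ^+ 2)); last first.
    by move=> k _; congr ((_ - _) ^+ 2); apply: jet6.
  move=> {HK' HK} HK; apply: (le_trans (HK _)).
    move=> s s01 z; have [da_ dt_ dl_] := st1 s s01; have [da' dt' dl'] := st2 s s01.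
    have zr : `|z - z0| <= r by apply: line_in_ball.
    have Hz : H z by have [] := loc _ zr.
    split.
    - have := dev_hyp_isometry (dphi_ i) Hz da_; rewrite dt_; exact.
    - have := dev_hyp_isometry dphi Hz da'; rewrite dt'; exact.
    - exact: (bx (phi_ i) (z_ i - z1) z (t_ i) (dphi_ i) da_ dt_ dl_ h4 zr w2r).
    - exact: (bx phi (z_ i - z1) z p.2 dphi da' dt' dl' T2 zr w2r).
    have key u v k : `|gder u v [:: k] (coord a (phi_ i) z, t_ i) - gder u v [:: k] (coord a phi z, p.2)| <=
        N * (`|(coord a (phi_ i) z).1 - (coord a phi z).1| + `|(coord a (phi_ i) z).2 - (coord a phi z).2|) + delta.
      rewrite -(subrKA (gder u v [:: k] (coord a phi z, t_ i))).
      apply: le_trans (ler_normD _ _) _; apply: lerD.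
        exact: (gder_lipschitz u v k gb (ltW dl') (ltW dl_) h4).
      exact: (h2 (coord a phi z) u v k (ltW dl')).
    move=> j; do 6 (case: j => [//|j]).
    rewrite /jet; do 6 ?[case: j => [_|j] //=].
    - exact: (key false false false).
    - exact: (key false false true).
    - exact: (key false true false).
    - exact: (key false true true).
    - exact: (key true true false).
    - exact: (key true true true).
  apply: le_trans d2.
  have d3 : delta ^+ 2 <= delta by rewrite expr2 ler_piMr // ltW.
  have : K * (\sum_(k < 6) (jet 0 0 0 (coord a (phi_ i)) 0 z1 k - jet 0 0 0 (coord a phi) 0 z1 k) ^+ 2 + delta ^+ 2) <= K * (delta + delta).
    by apply: ler_wpM2l => //; apply: lerD => //; exact: ltW.
  move=> /le_trans; apply; exact: aux (ltW d0).
have S3 := @sum_sqr_cvg0_comp R I FF _ 6 (fun i k => jet 0 0 0 (coord a (phi_ i)) 0 (z_ i) k - jet 0 0 0 (coord a phi) 0 (z_ i) k) S2.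
have S4 k : (k < 6)%N -> (fun i => jet 0 0 0 (coord a phi) 0 (z_ i) k) @ FF --> jet 0 0 0 (coord a phi) 0 z2 k.
  apply: (@jet6_cvg a I FF _ (fun=> phi) z_ phi z2).
  - exact: (cvg_app (differentiable_continuous (dev_diff dphi Hz2 da2)) zz).
  - exact: (cvg_app (differentiable_continuous (dev_diff2 dphi e1 Hz2 da2)) zz).
  - exact: (cvg_app (differentiable_continuous (dev_diff2 dphi e2 Hz2 da2)) zz).
have [c0 c1 c2] : [/\ (fun i => coord a (phi_ i) (z_ i)) @ FF --> coord a phi z2,
  (fun i => 'D_e1 (coord a (phi_ i)) (z_ i)) @ FF --> 'D_e1 (coord a phi) z2 &
  (fun i => 'D_e2 (coord a (phi_ i)) (z_ i)) @ FF --> 'D_e2 (coord a phi) z2].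
  apply: cvg_jet6 => k k6; exact: (cvg_add0 (S3 _ k k6) (S4 k k6)).
have n3 : \forall i \near FF, dom a (phi_ i (z_ i)) /\ (chart a (phi_ i (z_ i))).2 = t_ i.
  apply: filterS3 (filterI nd1 nT) nW nz => i [h1 h2] h3 h4.
  have := stay (phi_ i) (z_ i) (dphi_ i) h1 h2 h3 h4 1 (introT andP (conj ler01 (lexx 1))).
  by rewrite scale1r addrC subrK => -[].
split=> //.
- by apply: filterS n3 => i [].
- have c3 : (fun i => (coord a (phi_ i) (z_ i), t_ i)) @ FF --> (coord a phi z2, p.2) by apply: cvg_pr.
  rewrite -t2 -surjective_pairing in c3.
  apply: cvg_trans c3; apply: near_eq_cvg; apply: filterS n3 => i [_ <-].
  by rewrite /coord -surjective_pairing.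
Qed.

Lemma jets_cvg_chart a b (I : Type) (FF : set_system I) {FFF : Filter FF}
    (phi_ : I -> plane R -> leaf_space F) phi (z_ : I -> plane R) (z : plane R) :
  (forall i, developing (phi_ i)) -> developing phi -> H z -> z_ @ FF --> z ->
  dom a (phi z) -> dom b (phi z) ->
  jets_cvg a FF phi_ z_ phi z -> jets_cvg b FF phi_ z_ phi z.
Proof.
move=> dphi_ dphi Hz zz da db [n c c1 c2].
have O : @overlap _ _ F b a (chart a (phi z)) by split; [exact: chart_disk|rewrite chartK].
have nH : \forall i \near FF, H (z_ i).
  by apply: (near_cvg zz); apply: open_nbhs_nbhs; split=> //; exact: upper_half_plane_open.
have [n1 d1 _] := dchange_cvg O c c1.
have n2 : \forall i \near FF, [/\ H (z_ i), dom a (phi_ i (z_ i)) & dom b (phi_ i (z_ i))].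
  apply: filterS3 n n1 nH => i da' [_ db'] Hi; split=> //.
  by rewrite chartK in db'.
have key u : (fun i => 'D_u (coord a (phi_ i)) (z_ i)) @ FF --> 'D_u (coord a phi) z ->
    (fun i => 'D_u (coord b (phi_ i)) (z_ i)) @ FF --> 'D_u (coord b phi) z.
  move=> cu; have [_ _ f1] := dchange_cvg O c cu.
  rewrite (coord_change u dphi Hz da db); apply: cvg_trans f1; apply: near_eq_cvg.
  by apply: filterS n2 => i [Hi da' db']; rewrite (coord_change u (dphi_ i) Hi da' db').
split.
- by apply: filterS n2 => i [].
- rewrite chartK // in d1; apply: cvg_trans d1; apply: near_eq_cvg.
  by apply: filterS n2 => i [_ da' _]; rewrite chartK.
- exact: key c1.
- exact: key c2.
Qed.

(** Convergence propagates along the segment from z1 to z2 by [real_induction]: by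
    [jets_cvg_local], each point of the segment has a neighbourhood in which convergence at one
    point implies convergence at all points. *)
Lemma jets_cvg_all a b (I : Type) (FF : set_system I) {FFF : Filter FF}
    (phi_ : I -> plane R -> leaf_space F) phi (z_ : I -> plane R) (z1 z2 : plane R) :
  (forall i, developing (phi_ i)) -> developing phi -> H z1 -> H z2 -> z_ @ FF --> z2 ->
  dom a (phi z1) -> dom b (phi z2) ->
  jets_cvg a FF phi_ (fun=> z1) phi z1 -> jets_cvg b FF phi_ z_ phi z2.
Proof.
move=> dphi_ dphi Hz1 Hz2 zz da db j1.
pose f (s : R) := z1 + s *: (z2 - z1).
have Hf s : 0 <= s <= 1 -> H (f s).
  move=> /andP[s0 s1]; rewrite /f /H /= /GRing.scale /=.
  have h1 : 0 < z1.2 by []. have h2 : 0 < z2.2 by [].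
  by move: (z1.2) (z2.2) h1 h2 => x y x0 y0; nra.
have fc : continuous f.
  by move=> s; apply: cvgD; [exact: cvg_cst|apply: cvgZr_tmp; exact: cvg_id].
pose P (s : R) := forall c : idx F, dom c (phi (f s)) -> jets_cvg c FF phi_ (fun=> f s) phi (f s).
have near_f (s r : R) : 0 < r -> \forall s' \near s, `|f s' - f s| < r.
  move=> r0; have c : (fun s' => `|f s' - f s|) @ s --> (0 : R).
    rewrite -(normr0 (plane R)) -(subrr (f s)); apply: cvg_norm.
    by apply: cvgB; [exact: fc|exact: cvg_cst].
  exact: (cvgr_lt _ c _ r0).
have P0 : P 0.
  rewrite /P /f scale0r addr0 => c dc.
  by apply: (jets_cvg_chart dphi_ dphi Hz1 _ da dc j1); exact: cvg_cst.
have P1 : P 1.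
  apply: (@real_induction R P P0); last by rewrite ler01 lexx.
  - move=> s /andP[s0 s1] Ps.
    have s01 : 0 <= s <= 1 by rewrite s0 ltW.
    have [c dc] := dom_cover F (phi (f s)).
    have [r r0 [hr loc]] := @jets_cvg_local c I FF _ phi_ phi (f s) dphi_ dphi (Hf s s01) dc.
    have Ps' := Ps s (introT andP (conj s0 (lexx s))) c dc.
    apply: filterS (near_f s r r0) => s' lt b' db'.
    have [Hs' dc'] := hr _ (ltW lt).
    apply: (jets_cvg_chart dphi_ dphi Hs' _ dc' db'); first exact: cvg_cst.
    have le0 : `|f s - f s| <= r by rewrite subrr normr0 ltW.
    exact: (loc (f s) (f s') _ le0 lt (cvg_cst _) Ps').
  - move=> s /andP[s0 s1] Ps b' db'.
    have s01 : 0 <= s <= 1 by rewrite ltW.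
    have [r r0 [hr loc]] := @jets_cvg_local b' I FF _ phi_ phi (f s) dphi_ dphi (Hf s s01) db'.
    have n1 : \forall s' \near s^'-, 0 < s' by exact: nbhs_left_gt.
    have n2 : \forall s' \near s^'-, s' < s by exact: nbhs_left_lt.
    have n3 : \forall s' \near s^'-, `|f s' - f s| < r.
      have c : (fun s' : R => s') @ s^'- --> s by apply: cvg_at_left_filter; exact: cvg_id.
      exact: (near_cvg c (near_f s r r0)).
    have [s' [[s'0 s's] lt]] := @filter_ex _ (s^'-) _ _ (filterI (filterI n1 n2) n3).
    have [Hs' dc'] := hr _ (ltW lt).
    have s'01 : 0 <= s' < s by rewrite ltW.
    have lt0 : `|f s - f s| < r by rewrite subrr normr0.
    exact: (loc (f s') (f s) _ (ltW lt) lt0 (cvg_cst _) (Ps s' s'01 b' dc')).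
have f1 : f 1 = z2 by rewrite /f scale1r addrC subrK.
have [r r0 [hr loc]] := @jets_cvg_local b I FF _ phi_ phi z2 dphi_ dphi Hz2 db.
have lt0 : `|z2 - z2| < r by rewrite subrr normr0.
have P1' := P1 b; rewrite f1 in P1'.
exact: (loc z2 z2 z_ (ltW lt0) lt0 zz (P1' db)).
Qed.

Lemma orthonormal_solve (a b c p1 p2 q1 q2 : R) :
  a * (p1 * p1) + b * (p1 * p2 + p2 * p1) + c * (p2 * p2) = 1 ->
  a * (p1 * q1) + b * (p1 * q2 + p2 * q1) + c * (p2 * q2) = 0 ->
  a * (q1 * q1) + b * (q1 * q2 + q2 * q1) + c * (q2 * q2) = 1 ->
  let k := p1 * q2 - q1 * p2 in
  [/\ k ^+ 2 * (a * c - b ^+ 2) = 1, p1 = k * (b * q1 + c * q2) & p2 = - k * (a * q1 + b * q2)].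
Proof.
move=> pp pq qq k; split.
- rewrite -[RHS](mulr1 1) -{1}pp -qq -[LHS]addr0 -(mulr0 0) -{1}pq -pq /k; ring.
- rewrite -[LHS]mulr1 -qq -[LHS]subr0 -(mulr0 q1) -pq /k; ring.
- rewrite -[LHS]mulr1 -qq -[LHS]subr0 -(mulr0 q2) -pq /k; ring.
Qed.

(** The second vector of an orthonormal basis and the orientation determine the first one. *)
Lemma orthonormal_horizontal (a b c p1 p2 q1 q2 : R) (s : bool) :
  a * (p1 * p1) + b * (p1 * p2 + p2 * p1) + c * (p2 * p2) = 1 ->
  a * (p1 * q1) + b * (p1 * q2 + p2 * q1) + c * (p2 * q2) = 0 ->
  a * (q1 * q1) + b * (q1 * q2 + q2 * q1) + c * (q2 * q2) = 1 ->
  (0 < p1 * q2 - q1 * p2) = s ->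
  let k := (if s then 1 else -1) * (Num.sqrt (a * c - b ^+ 2))^-1 in
  0 < a * c - b ^+ 2 /\
  (p1, p2) = (k * (b * q1 + c * q2), - k * (a * q1 + b * q2)).
Proof.
move=> pp pq qq hs k.
have [kk E1 E2] := orthonormal_solve pp pq qq.
set k' := p1 * q2 - q1 * p2 in kk hs E1 E2.
set D := a * c - b ^+ 2 in kk k *.
have k0 : k' != 0.
  by apply/eqP => e; move: kk; rewrite e expr0n mul0r => /eqP; rewrite eq_sym oner_eq0.
have k20 : 0 < k' ^+ 2 by rewrite exprn_even_gt0.
have D0 : 0 < D by rewrite -(pmulr_rgt0 _ k20) kk ltr01.
split=> //.
suff -> : k = k' by rewrite -E1 -E2.
have DE : D = (k' ^+ 2)^-1 by apply: (mulfI (lt0r_neq0 k20)); rewrite kk divff // lt0r_neq0.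
rewrite /k DE sqrtrV ?ltW // sqrtr_sqr invrK -hs.
case: ltrP => h.
  by rewrite mul1r gtr0_norm.
by rewrite mulN1r ler0_norm // opprK.
Qed.

Lemma orient_near a (I : Type) (FF : set_system I) {FFF : Filter FF} (t_ : I -> transv a) t :
  t_ @ FF --> t -> \forall i \near FF, orient o (t_ i) = orient o t.
Proof.
move=> tt.
have c : (fun i => orient o (t_ i)) @ FF --> orient o t by exact: (cvg_app (@orient_continuous _ _ _ o a t) tt).
have n : nbhs (orient o t) [set b | b = orient o t].
  by apply: open_nbhs_nbhs; split=> //; exact: discrete_open.
exact: (near_cvg c n).
Qed.

Lemma dev_horizontal a phi : developing phi -> dom a (phi base) ->
  let p := chart a (phi base) in let q := 'D_e2 (coord a phi) base in
  let A := metric g p e1 e1 in let B := metric g p e1 e2 in let C := metric g p e2 e2 in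
  let k := (if orient o p.2 then 1 else -1) * (Num.sqrt (A * C - B ^+ 2))^-1 in
  0 < A * C - B ^+ 2 /\
  'D_e1 (coord a phi) base = (k * (B * q.1 + C * q.2), - k * (A * q.1 + B * q.2)).
Proof.
move=> dphi da p q A B C.
have dp : chart_disk_of a p.1 by exact: chart_disk.
pose E u := 'D_u (coord a phi) base.
have h u v : A * ((E u).1 * (E v).1) + B * ((E u).1 * (E v).2 + (E u).2 * (E v).1) +
    C * ((E u).2 * (E v).2) = (u.1 * v.1 + u.2 * v.2).
  have := dev_isom dphi base_in_H da u v.
  by rewrite (metric_expand _ _ dp) /= expr1n divr1.
have h11 := h e1 e1; have h12 := h e1 e2; have h22 := h e2 e2.
rewrite /= !(mulr1, mulr0, mul0r, addr0, add0r) in h11 h12 h22.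
have ho := dev_orient dphi base_in_H da.
have [D0 e] := orthonormal_horizontal h11 h12 h22 ho.
split; first exact: D0.
by rewrite -e -surjective_pairing.
Qed.

Definition horizontal a (p : plane R * transv a) (q : plane R) : plane R :=
  let A := metric g p e1 e1 in let B := metric g p e1 e2 in let C := metric g p e2 e2 in
  let k := (if orient o p.2 then 1 else -1) * (Num.sqrt (A * C - B ^+ 2))^-1 in
  (k * (B * q.1 + C * q.2), - k * (A * q.1 + B * q.2)).

Lemma horizontal_cvg a (I : Type) (FF : set_system I) {FFF : Filter FF}
    (p_ : I -> plane R * transv a) (q_ : I -> plane R) p q :
  chart_disk_of a p.1 -> 0 < metric g p e1 e1 * metric g p e2 e2 - metric g p e1 e2 ^+ 2 ->
  p_ @ FF --> p -> q_ @ FF --> q ->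
  (fun i => horizontal (p_ i) (q_ i)) @ FF --> horizontal p q.
Proof.
move=> dp D0 cp cq.
pose A_ i := metric g (p_ i) e1 e1. pose B_ i := metric g (p_ i) e1 e2. pose C_ i := metric g (p_ i) e2 e2.
have no : \forall i \near FF, orient o (p_ i).2 = orient o p.2 by exact: (orient_near (cvg2 cp)).
pose A := metric g p e1 e1. pose B := metric g p e1 e2. pose C := metric g p e2 e2.
have cA : A_ @ FF --> A by exact: metric_coef_cvg.
have cB : B_ @ FF --> B by exact: metric_coef_cvg.
have cC : C_ @ FF --> C by exact: metric_coef_cvg.
have c1 : (fun i => (q_ i).1) @ FF --> q.1 by exact: cvg1 cq.
have c2 : (fun i => (q_ i).2) @ FF --> q.2 by exact: cvg2 cq.
pose s : R := if orient o p.2 then 1 else -1.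
have cD : (fun i => A_ i * C_ i - B_ i * B_ i) @ FF --> A * C - B * B.
  by apply: cvgB; [exact: (cvgM cA cC)|exact: (cvgM cB cB)].
rewrite -expr2 in cD.
have ck : (fun i => s * (Num.sqrt (A_ i * C_ i - B_ i * B_ i))^-1) @ FF --> s * (Num.sqrt (A * C - B ^+ 2))^-1.
  apply: cvgM; first exact: cvg_cst.
  apply: cvgV; first by rewrite lt0r_neq0 // sqrtr_gt0.
  exact: (cvg_app (@sqrt_continuous R _) cD).
have h : (fun i => let k := s * (Num.sqrt (A_ i * C_ i - B_ i * B_ i))^-1 in
   (k * (B_ i * (q_ i).1 + C_ i * (q_ i).2), - k * (A_ i * (q_ i).1 + B_ i * (q_ i).2))) @ FF -->
   ((s * (Num.sqrt (A * C - B ^+ 2))^-1 * (B * q.1 + C * q.2), - (s * (Num.sqrt (A * C - B ^+ 2))^-1) * (A * q.1 + B * q.2)) : plane R).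
  apply: cvg_pr.
    by apply: cvgM; [exact: ck|apply: cvgD; apply: cvgM; [exact: cB|exact: c1|exact: cC|exact: c2]].
  apply: cvgM; first by apply: cvgN; exact: ck.
  by apply: cvgD; apply: cvgM; [exact: cA|exact: c1|exact: cB|exact: c2].
apply: cvg_trans h; apply: near_eq_cvg; apply: filterS no => i oi.
by rewrite /horizontal oi -/s /= -expr2.
Qed.

Lemma dev_horizontalE a phi : developing phi -> dom a (phi base) ->
  'D_e1 (coord a phi) base = horizontal (chart a (phi base)) ('D_e2 (coord a phi) base).
Proof. by move=> dphi da; have [_ e] := dev_horizontal dphi da; exact: e. Qed.

Lemma jets_cvg_vertical a (I : Type) (FF : set_system I) {FFF : Filter FF}
    (phi_ : I -> plane R -> leaf_space F) phi :
  (forall i, developing (phi_ i)) -> developing phi -> dom a (phi base) ->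
  (\forall i \near FF, dom a (phi_ i base)) ->
  (fun i => chart a (phi_ i base)) @ FF --> chart a (phi base) ->
  (fun i => 'D_e2 (coord a (phi_ i)) base) @ FF --> 'D_e2 (coord a phi) base ->
  jets_cvg a FF phi_ (fun=> base) phi base.
Proof.
move=> dphi_ dphi da n cp cq.
have dp : chart_disk_of a (chart a (phi base)).1 by exact: chart_disk.
have [D0 _] := dev_horizontal dphi da.
have h : (fun i => horizontal (chart a (phi_ i base)) ('D_e2 (coord a (phi_ i)) base)) @ FF --> horizontal (chart a (phi base)) ('D_e2 (coord a phi) base).
  exact: (horizontal_cvg dp D0 cp cq).
suff c : (fun i => 'D_e1 (coord a (phi_ i)) base) @ FF --> 'D_e1 (coord a phi) base by exact: And4 n cp c cq.
rewrite (dev_horizontalE dphi da); apply: cvg_trans h; apply: near_eq_cvg; apply: filterS n => i da'.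
exact: (esym (dev_horizontalE (dphi_ i) da')).
Qed.

Lemma is_derive_coord_moebius a phi B z v : developing phi -> \det B = 1 -> H z -> dom a (phi (moebius B z)) ->
  is_derive z v (coord a (phi \o moebius B)) ('D_(cmul (mobder B z) v) (coord a phi) (moebius B z)).
Proof.
move=> dphi dB Hz da; have Hm := moebius_H dB Hz.
have q0 : mden B z != 0 by rewrite lt0r_neq0 // mden_gt0.
have [_ E] := is_derive_moebius v dB Hz.
rewrite -E.
exact: (is_derive_comp_diff v (dev_diff dphi Hm da) (diff_moebius q0)).
Qed.

Lemma coord_moebius_derive a phi B z v : developing phi -> \det B = 1 -> H z -> dom a (phi (moebius B z)) ->
  let m := cmul (mobder B z) v in
  'D_v (coord a (phi \o moebius B)) z =
    (m.1 * ('D_e1 (coord a phi) (moebius B z)).1 + m.2 * ('D_e2 (coord a phi) (moebius B z)).1,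
     m.1 * ('D_e1 (coord a phi) (moebius B z)).2 + m.2 * ('D_e2 (coord a phi) (moebius B z)).2).
Proof.
move=> dphi dB Hz da m; have Hm := moebius_H dB Hz.
have [_ E] := is_derive_coord_moebius v dphi dB Hz da.
apply: (etrans E); exact: (derive_plane m (dev_diff dphi Hm da)).
Qed.

(** Moebius transformations act on vectors at z by a complex multiplication, of modulus the inverse of
    [mden], and divide the height by [mden]. *)
Lemma dev_comp phi B : developing phi -> \det B = 1 -> developing (phi \o moebius B).
Proof.
move=> dphi dB; split.
- move=> z Hz; apply: continuous_comp; first exact: moebius_continuous.
  exact: (dev_cont dphi (moebius_H dB Hz)).
- move=> a z Hz da; have q0 : mden B z != 0 by rewrite lt0r_neq0 // mden_gt0.
  exact: (differentiable_comp (diff_moebius q0) (dev_diff dphi (moebius_H dB Hz) da)).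
- move=> a z v Hz da.
  have q0 : mden B z != 0 by rewrite lt0r_neq0 // mden_gt0.
  have dm := diff_moebius q0; have [d1 d2] := diff_mobder q0.
  pose m y := cmul (mobder B y) v.
  have c1 : differentiable (fun y => (m y).1) z.
    apply: diffD; first by apply: diffM; [exact: d1|exact: diffC].
    by apply: diffN; apply: diffM; [exact: d2|exact: diffC].
  have c2 : differentiable (fun y => (m y).2) z.
    by apply: diffD; apply: diffM; solve [exact: d1|exact: d2|exact: diffC].
  have x1 := differentiable_comp dm (dev_diff2 dphi e1 (moebius_H dB Hz) da).
  have x2 := differentiable_comp dm (dev_diff2 dphi e2 (moebius_H dB Hz) da).
  pose h y : plane R := ((m y).1 * ('D_e1 (coord a phi) (moebius B y)).1 + (m y).2 * ('D_e2 (coord a phi) (moebius B y)).1,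
     (m y).1 * ('D_e1 (coord a phi) (moebius B y)).2 + (m y).2 * ('D_e2 (coord a phi) (moebius B y)).2).
  have dh : differentiable h z.
    apply: differentiable_pair; apply: diffD; apply: diffM.
    + exact: c1.
    + exact: (differentiable_fst x1).
    + exact: c2.
    + exact: (differentiable_fst x2).
    + exact: c1.
    + exact: (differentiable_snd x1).
    + exact: c2.
    + exact: (differentiable_snd x2).
  have n := dev_near dphi (moebius_H dB Hz) da (@openT _) I.
  have n1 : \forall y \near z, dom a (phi (moebius B y)).
    have n' : \forall y \near moebius B z, dom a (phi y) by apply: filterS n => y [].
    exact: (moebius_continuous dB Hz n').
  have n2 : \forall y \near z, H y by apply: open_nbhs_nbhs; split=> //; exact: upper_half_plane_open.
  have n3 : \forall y \near z, h y = 'D_v (coord a (phi \o moebius B)) y.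
    by apply: filterS2 n1 n2 => y da' Hy; exact: (esym (coord_moebius_derive v dphi dB Hy da')).
  by have [] := near_eq_differentiable n3 dh.
- move=> a z Hz da u v.
  have [_ E1] := is_derive_coord_moebius u dphi dB Hz da.
  have [_ E2] := is_derive_coord_moebius v dphi dB Hz da.
  have := dev_isom dphi (moebius_H dB Hz) da (cmul (mobder B z) u) (cmul (mobder B z) v).
  rewrite -E1 -E2 => e; apply: (etrans e).
  have D0 := mden_gt0 dB Hz; have mn := mobder_norm dB Hz.
  have z0 : z.2 != 0 by rewrite gt_eqF.
  move: mn; move: (mobder B z) => [m1 m2] mn.
  rewrite moebiusE /cmul /=; rewrite /= in mn.
  have -> : (m1 * u.1 - m2 * u.2) * (m1 * v.1 - m2 * v.2) + (m2 * u.1 + m1 * u.2) * (m2 * v.1 + m1 * v.2)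
    = (m1 ^+ 2 + m2 ^+ 2) * (u.1 * v.1 + u.2 * v.2) by ring.
  have Dn : mden B z != 0 by rewrite lt0r_neq0.
  by rewrite mn; field; rewrite z0.
- move=> a z Hz da; rewrite -(dev_orient dphi (moebius_H dB Hz) da) /jac_det.
  have E1 := coord_moebius_derive e1 dphi dB Hz da.
  have E2 := coord_moebius_derive e2 dphi dB Hz da.
  have D0 := mden_gt0 dB Hz; have mn := mobder_norm dB Hz.
  have : 0 < (mobder B z).1 ^+ 2 + (mobder B z).2 ^+ 2 by rewrite mn invr_gt0 exprn_gt0.
  have aux (m1 m2 p1 p2 q1 q2 : R) (x y : plane R) : x = (m1 * p1 + m2 * q1, m1 * p2 + m2 * q2) ->
     y = (- m2 * p1 + m1 * q1, - m2 * p2 + m1 * q2) -> 0 < m1 ^+ 2 + m2 ^+ 2 ->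
     (0 < x.1 * y.2 - y.1 * x.2) = (0 < p1 * q2 - q1 * p2).
    move=> -> -> h /=.
    rewrite (_ : _ - _ = (m1 ^+ 2 + m2 ^+ 2) * (p1 * q2 - q1 * p2)); last by ring.
    by rewrite pmulr_rgt0.
  apply: aux.
    apply: (etrans E1); rewrite /cmul /=.
    by rewrite !(mulr1, mulr0, subr0, addr0).
  apply: (etrans E2); rewrite /cmul /=.
  by rewrite !(mulr1, mulr0, sub0r, add0r).
Qed.

Lemma uniformization_dev G L pi : uniformization g o G L pi -> developing pi.
Proof.
move=> u.
have op a : open [set z | H z /\ dom a (pi z)].
  rewrite openE => z [Hz da].
  have n1 : \forall y \near z, H y by apply: open_nbhs_nbhs; split=> //; exact: upper_half_plane_open.
  have n2 : \forall y \near z, [set m : leaf_space F | dom a m] (pi y).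
    apply: (uniformization_continuous u Hz); apply: open_nbhs_nbhs; split=> //.
    by apply: open_in_leaf; exact: dom_open.
  by apply: filterS2 n1 n2 => y.
have df a z vs : H z -> dom a (pi z) -> differentiable (iter_derive vs (fun z => (chart a (pi z)).1)) z.
  by move=> Hz da; apply: (smooth_on_diff_plane vs (op a) (@uniformization_smooth _ _ _ _ _ _ _ _ u a)).
split.
- exact: (uniformization_continuous u).
- by move=> a z Hz da; exact: (df a z [::] Hz da).
- by move=> a z v Hz da; exact: (df a z [:: v] Hz da).
- move=> a z Hz da v w; rewrite -(uniformization_isometry u Hz da).
  by have d := df a z [::] Hz da; rewrite !(deriveE _ d).
- move=> a z Hz da; rewrite -(uniformization_oriented u Hz da) /jac_det.
  have d := df a z [::] Hz da.
  have E k : 'D_k (fun y => (chart a (pi y)).1) z = 'd (fun z => (chart a (pi z)).1) z k by exact: (deriveE k d).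
  by rewrite (E e1) (E e2).
Qed.

(** * Frames and the action of SL(2, R) *)

(** The vector v is the image under phi of the vertical unit vector at i. *)
Definition frame_of (phi : plane R -> leaf_space F) (v : unit_tangent g) :=
  foot v = phi base /\ forall a, dom a (foot v) -> tcoord v a = 'D_e2 (coord a phi) base.

Lemma frame_in_chart (phi : plane R -> leaf_space F) (v : unit_tangent g) a : developing phi -> foot v = phi base -> dom a (foot v) ->
  tcoord v a = 'D_e2 (coord a phi) base -> frame_of phi v.
Proof.
move=> dphi fv da ta; split; first exact: fv.
move=> b db.
rewrite (tcoord_change db da) ta fv; symmetry.
by apply: (coord_change e2 dphi base_in_H); rewrite -fv.
Qed.

Lemma frame_unique phi (v w : unit_tangent g) : frame_of phi v -> frame_of phi w -> v = w.
Proof.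
move=> [fv tv] [fw tw]; have [a da] := dom_cover F (foot v).
have e : foot v = foot w by rewrite fv fw.
by apply: (unit_tangent_eq da e); rewrite tv // tw // -e.
Qed.

Lemma frame_exists_dev phi : developing phi -> exists v, frame_of phi v.
Proof.
move=> dphi; have [a da] := dom_cover F (phi base : M).
have u : metric g (chart a (phi base)) ('D_e2 (coord a phi) base) ('D_e2 (coord a phi) base) = 1.
  apply: (etrans (dev_isom dphi base_in_H da e2 e2)).
  by rewrite /= mulr0 add0r mulr1 expr1n divr1.
have [w [fw tw]] := mk_unit_tangent da u.
by exists w; apply: (frame_in_chart (a := a) dphi) => //; rewrite fw.
Qed.

Lemma frame_jets (I : Type) (FF : set_system I) {FFF : Filter FF}
    (phi_ : I -> plane R -> leaf_space F) phi (v_ : I -> unit_tangent g) v b (z_ : I -> plane R) z :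
  (forall i, developing (phi_ i)) -> developing phi -> (forall i, frame_of (phi_ i) (v_ i)) -> frame_of phi v ->
  v_ @ FF --> v -> H z -> dom b (phi z) -> z_ @ FF --> z -> jets_cvg b FF phi_ z_ phi z.
Proof.
move=> dphi_ dphi fr_ fr vv Hz db zz.
have [a da] := dom_cover F (foot v).
have [n c t] := unit_tangent_chart_cvg da vv.
have [fv tv] := fr.
have da' : dom a (phi base) by rewrite -fv.
have n' : \forall i \near FF, dom a (phi_ i base) by apply: filterS n => i; have [-> _] := fr_ i.
apply: (jets_cvg_all dphi_ dphi base_in_H Hz zz da' db).
apply: jets_cvg_vertical => //.
- rewrite -fv; under eq_fun => i do rewrite -(fr_ i).1.
  exact: c.
- rewrite -(tv a da); apply: cvg_trans t; apply: near_eq_cvg.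
  by apply: filterS n => i di; rewrite ((fr_ i).2 a di).
Qed.

(** The constant sequence psi converges to phi, by [frame_jets]. *)
Lemma dev_unique phi psi v : developing phi -> developing psi -> frame_of phi v -> frame_of psi v ->
  forall z, H z -> phi z = psi z.
Proof.
move=> dphi dpsi fphi fpsi z Hz.
have [a da] := dom_cover F (phi z : M).
have [n c _ _] := @frame_jets nat \oo _ (fun=> psi) phi (fun=> v) v a (fun=> z) z
  (fun=> dpsi) dphi (fun=> fpsi) fphi (cvg_cst v) Hz da (cvg_cst z).
have [_ da'] := filter_ex n.
have e : chart a (psi z) = chart a (phi z).
  have x1 : (chart a (psi z)).1 = (chart a (phi z)).1.
    by apply: (cvg_unique (@norm_hausdorff _ _) (cvg_cst _) (cvg1 c)).
  have x2 : (chart a (psi z)).2 = (chart a (phi z)).2.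
    by apply: (cvg_unique (@metric_hausdorff _ _) (cvg_cst _) (cvg2 c)).
  by rewrite [LHS]surjective_pairing x1 x2 -surjective_pairing.
by rewrite -[LHS](chartK da) -e chartK.
Qed.

(** A rotation about i brings the vertical vector to the preimage of v; the rotation of matrix
    (p q; -q p) turns tangent vectors by twice its angle. *)
Lemma frame_rotate phi (v : unit_tangent g) : developing phi -> foot v = phi base ->
  exists B, \det B = 1 /\ frame_of (phi \o moebius B) v.
Proof.
move=> dphi fv; have [a da] := dom_cover F (foot v).
have da' : dom a (phi base) by rewrite -fv.
pose p := chart a (phi base); pose A := metric g p e1 e1; pose B := metric g p e1 e2.
pose C := metric g p e2 e2.
have dp : chart_disk_of a p.1 by exact: chart_disk.
pose E u := 'D_u (coord a phi) base.
have h u w : A * ((E u).1 * (E w).1) + B * ((E u).1 * (E w).2 + (E u).2 * (E w).1) +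
    C * ((E u).2 * (E w).2) = (u.1 * w.1 + u.2 * w.2).
  have := dev_isom dphi base_in_H da' u w.
  by rewrite (metric_expand _ _ dp) /= expr1n divr1.
have h11 := h e1 e1; have h12 := h e1 e2; have h22 := h e2 e2.
rewrite /= !(mulr1, mulr0, mul0r, addr0, add0r) in h11 h12 h22.
have tu : metric g p (tcoord v a) (tcoord v a) = 1 by rewrite /p -fv; exact: tcoord_unit.
rewrite (metric_expand _ _ dp) -/A -/B -/C in tu.
have Ed : (E e1, E e2) = ('D_e1 (coord a phi) base, 'D_e2 (coord a phi) base) by [].
move: (E e1) (E e2) h11 h12 h22 Ed => [p1 p2] [q1 q2] /= h11 h12 h22 [D1 D2].
set t := tcoord v a in tu *.
have [t1 t2] := gram_expand t.1 t.2 (oner_neq0 R) h11 h12 h22.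
set P := _ + C * (t.2 * p2) in t1 t2; set Q := _ + C * (t.2 * q2) in t1 t2.
rewrite invr1 !mul1r in t1 t2.
have PQ : P ^+ 2 + Q ^+ 2 = 1.
  have k : A * (t.1 * (P * p1 + Q * q1)) + B * (t.1 * (P * p2 + Q * q2) + t.2 * (P * p1 + Q * q1))
     + C * (t.2 * (P * p2 + Q * q2)) = P ^+ 2 + Q ^+ 2 by rewrite /P /Q; ring.
  by rewrite -k -t1 -t2.
have [x [y [xy e_al e_be]]] := half_angle PQ.
have [dB mB c2 c1] := rotation_moebius xy.
exists (mx2 x y (- y) x); split; first exact: dB.
apply: (frame_in_chart (dev_comp dphi dB) _ da); first by rewrite /= mB.
have dmB : dom a (phi (moebius (mx2 x y (- y) x) base)) by rewrite mB.
apply: (etrans _ (esym (coord_moebius_derive e2 dphi dB base_in_H dmB))).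
rewrite mB c2 e_al e_be -D1 -D2 /= -t1 -t2.
exact: surjective_pairing.
Qed.

Lemma frame_ext (phi psi : plane R -> leaf_space F) (v : unit_tangent g) : developing psi ->
  (forall z, H z -> phi z = psi z) -> frame_of phi v -> frame_of psi v.
Proof.
move=> dpsi e [fv tv]; have eb := e _ base_in_H.
split; first by rewrite fv.
move=> a da; rewrite (tv a da).
have da' : dom a (psi base) by rewrite -eb -fv.
have n : \forall y \near (base : plane R), coord a psi y = coord a phi y.
  have n1 : \forall y \near (base : plane R), H y.
    by apply: open_nbhs_nbhs; split; [exact: upper_half_plane_open|exact: base_in_H].
  by apply: filterS n1 => y Hy; rewrite /coord e.
by have [_ E] := near_eq_is_derive n (diff_is_derive e2 (dev_diff dpsi base_in_H da')); exact: E.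
Qed.

Lemma is_frameE pi (A : 'M[R]_2) (v : unit_tangent g) : developing pi -> \det A = 1 ->
  is_frame pi A v <-> frame_of (pi \o moebius A) v.
Proof.
move=> dpi dA; have dc := dev_comp dpi dA.
have E a : dom a (pi (moebius A base)) ->
    'd (fun z => (chart a (pi (moebius A z))).1) base base = 'D_e2 (coord a (pi \o moebius A)) base.
  by move=> da; rewrite (deriveE _ (dev_diff dc base_in_H da)).
split=> -[fv tv]; split; try exact: fv.
- move=> a da; rewrite -E; first exact: (tv a da).
  by move: da; rewrite fv.
- move=> a da; rewrite E; first exact: (tv a da).
  by move: da; rewrite fv.
Qed.

Lemma frame_exists G L pi (v : unit_tangent g) : uniformization g o G L pi -> L (foot v) ->
  exists A, \det A = 1 /\ is_frame pi A v.
Proof.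
move=> u Lv; have dpi := uniformization_dev u.
have [z Hz pz] : (pi @` H) (foot v) by rewrite (uniformization_image u).
have [A0 [dA0 mA0]] := moebius_transitive Hz.
have [|B [dB fB]] := @frame_rotate (pi \o moebius A0) v (dev_comp dpi dA0).
  by rewrite /= mA0.
have dAB : \det (A0 * B) = 1 by rewrite det_mulmx dA0 dB mulr1.
exists (A0 * B); split; first exact: dAB.
apply/(is_frameE v dpi dAB).
apply: frame_ext (dev_comp dpi dAB) _ fB => y Hy /=.
by rewrite moebius_M.
Qed.

Hypothesis F_hyperbolic : hyperbolic_leaves g o.

Lemma frame_at (v : unit_tangent g) : exists G pi A, [/\ uniformization g o G (leaf F (foot v)) pi,
  \det A = 1 & is_frame pi A v].
Proof.
have [G [pi u]] := F_hyperbolic (foot v).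
have [|A [dA fA]] := frame_exists u (v := v); first exact: connected_component_refl.
by exists G, pi, A.
Qed.

Lemma dev_at (v : unit_tangent g) : exists2 phi, developing phi & frame_of phi v.
Proof.
have [G [pi [A [u dA fA]]]] := frame_at v; have dpi := uniformization_dev u.
exists (pi \o moebius A); first exact: dev_comp.
exact/is_frameE.
Qed.

(** The isometries pi o A given by two uniformizations of the leaf coincide as they have the same
    frame v, so that the set which defines the translation contains only w. *)
Lemma right_translationP phi B (v w : unit_tangent g) : developing phi -> \det B = 1 ->
  frame_of phi v -> frame_of (phi \o moebius B) w -> right_translation o B v = w.
Proof.
move=> dphi dB fv fw.
have key G pi A : uniformization g o G (leaf F (foot v)) pi -> \det A = 1 -> is_frame pi A v ->
    forall z, H z -> pi (moebius (A * B) z) = phi (moebius B z).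
  move=> u dA fA z Hz; have dpi := uniformization_dev u.
  have h := dev_unique (dev_comp dpi dA) dphi (iffLR (is_frameE v dpi dA) fA) fv (moebius_H dB Hz).
  by rewrite -h /= moebius_M.
have [G [pi [A [u dA fA]]]] := frame_at v.
have dAB A' : \det A' = 1 -> \det (A' * B) = 1 by move=> dA'; rewrite det_mulmx dA' dB mulr1.
have wS : [set w | exists G pi A, [/\ uniformization g o G (leaf F (foot v)) pi, \det A = 1,
        is_frame pi A v & is_frame pi (A * B) w]] w.
  exists G, pi, A; split=> //; have dpi := uniformization_dev u.
  apply/(is_frameE w dpi (dAB _ dA)).
  apply: (frame_ext (dev_comp dpi (dAB _ dA)) _ fw) => z Hz /=.
  by rewrite (key G pi A u dA fA z Hz).
have [G' [pi' [A' [u' dA' fA' fAB']]]] := xgetPex v (ex_intro _ w wS).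
rewrite -/(right_translation o B v) in fAB'.
have dpi' := uniformization_dev u'.
have f' := iffLR (is_frameE _ dpi' (dAB _ dA')) fAB'.
have f : frame_of (phi \o moebius B) (right_translation o B v).
  by apply: (frame_ext (dev_comp dphi dB) _ f') => z Hz /=; rewrite (key G' pi' A' u' dA' fA' z Hz).
exact: (frame_unique f fw).
Qed.

Lemma translate_frame phi B (v : unit_tangent g) : developing phi -> \det B = 1 -> frame_of phi v ->
  frame_of (phi \o moebius B) (right_translation o B v).
Proof.
move=> dphi dB fv; have [w fw] := frame_exists_dev (dev_comp dphi dB).
by rewrite (right_translationP dphi dB fv fw).
Qed.

Definition act (v : unit_tangent g) (a b c d : R) := right_translation o (mx2 a b c d) v.

Lemma act1 v : act v 1 0 0 1 = v.
Proof.
have [phi dphi fv] := dev_at v.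
have d1 : \det (mx2 (1 : R) 0 0 1) = 1 by rewrite det_mx2 mulr0 subr0 mulr1.
apply: (right_translationP dphi d1 fv).
by apply: (frame_ext (dev_comp dphi d1) _ fv) => z Hz /=; rewrite -mx21 moebius_1.
Qed.

Lemma actN1 v : act v (-1) 0 0 (-1) = v.
Proof.
have [phi dphi fv] := dev_at v.
have d1 : \det (mx2 (-1 : R) 0 0 (-1)) = 1 by rewrite det_mx2 mulr0 subr0 mulrNN mulr1.
apply: (right_translationP dphi d1 fv).
apply: (frame_ext (dev_comp dphi d1) _ fv) => z Hz /=.
by rewrite -mx2N1 moebius_N moebius_1.
Qed.

Lemma actM v (a b c d a' b' c' d' : R) : a * d - b * c = 1 -> a' * d' - b' * c' = 1 ->
  act (act v a b c d) a' b' c' d' =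
  act v (a * a' + b * c') (a * b' + b * d') (c * a' + d * c') (c * b' + d * d').
Proof.
move=> d1 d2; have [phi dphi fv] := dev_at v.
have d1' : \det (mx2 a b c d) = 1 by rewrite det_mx2.
have d2' : \det (mx2 a' b' c' d') = 1 by rewrite det_mx2.
have f1 := translate_frame dphi d1' fv.
have f2 := translate_frame (dev_comp dphi d1') d2' f1.
rewrite /act -mx2M.
have d12 : \det (mx2 a b c d * mx2 a' b' c' d') = 1 by rewrite det_mulmx d1' d2' mulr1.
symmetry; apply: (right_translationP dphi d12 fv).
apply: (frame_ext (dev_comp dphi d12) _ f2) => z Hz /=.
by rewrite moebius_M.
Qed.

(** The vector v . B is the image under the isometry of frame v of a unit vector depending
    continuously on B, and 1-jets converge by [frame_jets]. *)
Lemma act_cvg (I : Type) (FF : set_system I) {FFF : ProperFilter FF} (x_ : I -> unit_tangent g)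
    (a_ b_ c_ d_ : I -> R) (x : unit_tangent g) (a b c d : R) :
  x_ @ FF --> x -> a_ @ FF --> a -> b_ @ FF --> b -> c_ @ FF --> c -> d_ @ FF --> d ->
  (\forall i \near FF, a_ i * d_ i - b_ i * c_ i = 1) ->
  (fun i => act (x_ i) (a_ i) (b_ i) (c_ i) (d_ i)) @ FF --> act x a b c d.
Proof.
move=> cx ca cb cc cd n1.
have det1 : a * d - b * c = 1.
  have h : (fun i => a_ i * d_ i - b_ i * c_ i) @ FF --> a * d - b * c.
    by apply: cvgB; [exact: (cvgM ca cd)|exact: (cvgM cb cc)].
  apply: (cvg_unique (@norm_hausdorff _ _) h); exact: cvg_near_cst.
have dB : \det (mx2 a b c d) = 1 by rewrite det_mx2.
have [phi dphi fr] := dev_at x.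
pose phi_ i := projT1 (cid2 (dev_at (x_ i))).
have dphi_ i : developing (phi_ i) by rewrite /phi_; case: cid2.
have fr_ i : frame_of (phi_ i) (x_ i) by rewrite /phi_; case: cid2.
clearbody phi_.
pose B := mx2 a b c d; pose B_ i := mx2 (a_ i) (b_ i) (c_ i) (d_ i).
have [cz cm] := moebius_base_cvg ca cb cc cd det1.
have fw := translate_frame dphi dB fr.
have fw_ : \forall i \near FF, \det (B_ i) = 1 /\ frame_of (phi_ i \o moebius (B_ i)) (act (x_ i) (a_ i) (b_ i) (c_ i) (d_ i)).
  apply: filterS n1 => i di; have di' : \det (B_ i) = 1 by rewrite det_mx2.
  by split; [exact: di'|exact: (translate_frame (dphi_ i) di' (fr_ i))].
have [b' db] := dom_cover F (foot (act x a b c d)).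
have [f1 t1] := fw.
have Hz := moebius_H dB base_in_H.
have db' : dom b' (phi (moebius (mx2 a b c d) base)) by rewrite f1 in db.
have [n cp c1 c2] := frame_jets dphi_ dphi fr_ fr cx Hz db' cz.
have nf : \forall i \near FF, foot (act (x_ i) (a_ i) (b_ i) (c_ i) (d_ i)) = phi_ i (moebius (B_ i) base).
  by apply: filterS fw_ => i [_ []].
apply: (unit_tangent_cvg (a := b') db).
- by apply: filterS2 n nf => i di e; rewrite e.
- exact: (cvg_near_eq cp (congr1 (chart b') f1) (filterS (fun i e => congr1 (chart b') e) nf)).
- pose m := cmul (mobder (mx2 a b c d) base) e2.
  pose m_ i := cmul (mobder (B_ i) base) e2.
  have k1 : (fun i => (m_ i).1) @ FF --> m.1.
    by apply: cvgB; apply: cvgM; solve [exact: cvg_cst|exact: (cvg1 cm)|exact: (cvg2 cm)].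
  have k2 : (fun i => (m_ i).2) @ FF --> m.2.
    by apply: cvgD; apply: cvgM; solve [exact: cvg_cst|exact: (cvg1 cm)|exact: (cvg2 cm)].
  have h : (fun i => ((m_ i).1 * ('D_e1 (coord b' (phi_ i)) (moebius (B_ i) base)).1 + (m_ i).2 * ('D_e2 (coord b' (phi_ i)) (moebius (B_ i) base)).1,
     (m_ i).1 * ('D_e1 (coord b' (phi_ i)) (moebius (B_ i) base)).2 + (m_ i).2 * ('D_e2 (coord b' (phi_ i)) (moebius (B_ i) base)).2)) @ FF -->
     (m.1 * ('D_e1 (coord b' phi) (moebius B base)).1 + m.2 * ('D_e2 (coord b' phi) (moebius B base)).1,
     m.1 * ('D_e1 (coord b' phi) (moebius B base)).2 + m.2 * ('D_e2 (coord b' phi) (moebius B base)).2).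
    apply: cvg_pr; apply: cvgD; apply: cvgM.
    + exact: k1.
    + exact: (cvg1 c1).
    + exact: k2.
    + exact: (cvg1 c2).
    + exact: k1.
    + exact: (cvg2 c1).
    + exact: k2.
    + exact: (cvg2 c2).
  apply: (cvg_near_eq h (etrans (t1 b' db) (coord_moebius_derive e2 dphi dB base_in_H db'))).
  apply: filterS3 fw_ n nf => i [di [fi ti]] dni nfi.
  have dfi : dom b' (foot (act (x_ i) (a_ i) (b_ i) (c_ i) (d_ i))) by rewrite nfi.
  apply: (etrans (ti b' dfi)).
  exact: (coord_moebius_derive e2 (dphi_ i) di base_in_H dni).
Qed.

(** * Stabilizers and orbits *)

Lemma dev_isom_inj phi z m a : developing phi -> H z -> dom a (phi z) ->
  'D_m (coord a phi) z = 'D_e2 (coord a phi) z -> m = e2.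
Proof.
move=> dphi Hz da e; have z0 : z.2 ^+ 2 != 0 by rewrite sqrf_eq0 gt_eqF.
have h u v := dev_isom dphi Hz da u v.
have g1 := etrans (esym (h m m)) (etrans (congr2 (metric g (chart a (phi z))) e e) (h e2 e2)).
have g2 := etrans (esym (h m e2)) (etrans (congr1 (metric g (chart a (phi z)) ^~ ('D_e2 (coord a phi) z)) e) (h e2 e2)).
have {}g1 := mulIf (invr_neq0 z0) g1. have {}g2 := mulIf (invr_neq0 z0) g2.
move: g1 g2; rewrite /= !mulr0 !add0r !mulr1 => g1 g2.
rewrite g2 mulr1 in g1.
have m1 : m.1 = 0.
  have : m.1 * m.1 = 0 by move: g1; move: (m.1 * m.1) => x; lra.
  by move/eqP; rewrite mulf_eq0 orbb => /eqP.
by rewrite [LHS]surjective_pairing m1 g2.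
Qed.

(** If B fixes the frame v of pi o A, then A B and A send i to the same orbit of G, hence A B equals
    A' A C with A' in G and C a rotation about i. As pi o A' = pi, the rotation C fixes v as well, so that it is
    1 or -1. *)
Lemma stabilizer_conj G L pi A B (v : unit_tangent g) : uniformization g o G L pi -> \det A = 1 ->
  is_frame pi A v -> \det B = 1 -> right_translation o B v = v -> G (A * B * A^-1).
Proof.
move=> u dA fA dB fix_v; have dpi := uniformization_dev u; have sg := uniformization_group u.
have fv := iffLR (is_frameE v dpi dA) fA.
have fBv := translate_frame (dev_comp dpi dA) dB fv; rewrite fix_v in fBv.
have dAB : \det (A * B) = 1 by rewrite det_mulmx dA dB mulr1.
have [A' GA' eA'] : exists2 A', G A' & moebius (A * B) base = moebius A' (moebius A base).
  apply: (iffLR (uniformization_fibers u (moebius_H dA base_in_H) (moebius_H dAB base_in_H))).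
  have := fBv.1; rewrite fv.1 /= moebius_M //; exact: base_in_H.
have dA' := surface_group_det sg GA'.
have dA'A : \det (A' * A) = 1 by rewrite det_mulmx dA dA' mulr1.
pose C := (A' * A)^-1 * (A * B).
have dC : \det C = 1 by rewrite det_mulmx dAB (det_inv1 dA'A) mulr1.
have AC : A' * A * C = A * B by rewrite /C mulrA mulrV ?mul1r // unit_det.
have Cb : moebius C base = base.
  rewrite /C (moebius_M (det_inv1 dA'A) dAB base_in_H) eA'.
  rewrite -(moebius_M dA' dA base_in_H) -(moebius_M (det_inv1 dA'A) dA'A base_in_H).
  by rewrite mulVr ?moebius_1 // unit_det.
have fC : frame_of ((pi \o moebius A) \o moebius C) v.
  apply: (frame_ext (dev_comp (dev_comp dpi dA) dC) _ fBv) => z Hz /=.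
  rewrite -(moebius_M dA dB Hz) -AC (moebius_M dA'A dC Hz) (moebius_M dA' dA (moebius_H dC Hz)).
  symmetry; apply/(uniformization_fibers u).
  - exact: (moebius_H dA (moebius_H dC Hz)).
  - exact: (moebius_H dA' (moebius_H dA (moebius_H dC Hz))).
  - by exists A'.
have [a da] := dom_cover F (foot v).
have da1 : dom a ((pi \o moebius A) base) by rewrite -fv.1.
have da2 : dom a ((pi \o moebius A) (moebius C base)) by rewrite Cb.
have mC : cmul (mobder C base) e2 = e2.
  apply: (dev_isom_inj (dev_comp dpi dA) base_in_H da1).
  have [_ E] := is_derive_coord_moebius e2 (dev_comp dpi dA) dC base_in_H da2.
  rewrite Cb in E; apply: (etrans (esym E)).
  exact: (etrans (esym (fC.2 a da)) (fv.2 a da)).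
have uA := unit_det dA.
have [c1|c1] := moebius_fixes_frame dC Cb mC; rewrite -AC c1.
  by rewrite mulr1 mulrK.
rewrite mulrN1 mulNr mulrK // -mulN1r; apply: (surface_groupM sg) => //.
exact: (surface_groupN1 sg).
Qed.

Lemma stabilizer_of_group G L pi A A' (v : unit_tangent g) : uniformization g o G L pi -> \det A = 1 ->
  is_frame pi A v -> G A' -> right_translation o (A^-1 * A' * A) v = v.
Proof.
move=> u dA fA GA'; have dpi := uniformization_dev u.
have dA' := surface_group_det (uniformization_group u) GA'.
have dV := det_inv1 dA.
have dB : \det (A^-1 * A' * A) = 1 by rewrite !det_mulmx dV dA' dA !mulr1.
have fv := iffLR (is_frameE v dpi dA) fA.
apply: (right_translationP (dev_comp dpi dA) dB fv).
apply: (frame_ext (dev_comp (dev_comp dpi dA) dB) _ fv) => z Hz /=.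
rewrite -(moebius_M dA dB Hz).
have -> : A * (A^-1 * A' * A) = A' * A by rewrite !mulrA mulrV ?mul1r // unit_det.
rewrite (moebius_M dA' dA Hz); apply/(uniformization_fibers u).
- exact: (moebius_H dA Hz).
- exact: (moebius_H dA' (moebius_H dA Hz)).
- by exists A'.
Qed.

(** If B is close to 1, so is A B A^-1, which belongs to G by [stabilizer_conj]. *)
Lemma stab_discrete (x : unit_tangent g) : exists2 e : R, 0 < e & forall a b c d : R,
  a * d - b * c = 1 -> act x a b c d = x ->
  `|a - 1| < e -> `|b| < e -> `|c| < e -> `|d - 1| < e -> b = 0.
Proof.
have [G [pi [A [u dA fA]]]] := frame_at x; have sg := uniformization_group u.
have [_ [V nV VG]] := surface_group_discrete sg (surface_group1 sg).
have [r /= r0 rV] := iffLR (nbhs_ballP _ _) nV.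
pose K := mx_sum A * mx_sum A^-1 * 4.
have K0 : 0 <= K by rewrite !mulr_ge0 // mx_sum_ge0.
have K1 : 0 < K + 1 by rewrite ltr_wpDl.
exists (r / (K + 1)); first by rewrite divr_gt0.
move=> a b c d det1 fx ha hb hc hd.
have dB : \det (mx2 a b c d) = 1 by rewrite det_mx2.
have GB := stabilizer_conj u dA fA dB fx.
set e := r / (K + 1) in ha hb hc hd.
have e0 : 0 < e by rewrite divr_gt0.
have De k l : `|(mx2 a b c d - 1) k l| <= e.
  rewrite mx21 !mxE; case: ifP => _; case: ifP => _; rewrite ?subr0; exact: ltW.
have uA := unit_det dA.
have conj : A * mx2 a b c d * A^-1 = 1 + A * (mx2 a b c d - 1) * A^-1.
  by rewrite mulrBr mulr1 mulrBl mulrV // addrC subrK.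
have in_ball : ball (1 : 'M[R]_2) r (A * mx2 a b c d * A^-1).
  split=> // i j; rewrite conj /ball /= !mxE.
  rewrite opprD addrA subrr add0r normrN.
  have h := mulmx_bound A A^-1 i j (ltW e0) De; rewrite -mulmxE mxE in h.
  apply: (le_lt_trans h).
  rewrite (_ : _ * 4 = K * e); last by rewrite /K; ring.
  rewrite /e; clearbody K; rewrite mulrA ltr_pdivrMr // [K * r]mulrC.
  by rewrite ltr_pM2l // ltrDl.
have B1 : A * mx2 a b c d * A^-1 = 1.
  have : (V `&` G) (A * mx2 a b c d * A^-1) by split=> //; exact: rV.
  by rewrite VG.
have E : mx2 a b c d = 1.
  apply: (mulrI uA); rewrite mulr1.
  by apply: (mulIr (_ : A^-1 \is a GRing.unit)); rewrite ?unitrV // B1 mulrV.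
by have [_ <- _ _] := mx2E a b c d; rewrite E mxE.
Qed.

Lemma stab_nontrivial (x : unit_tangent g) :
  (forall G pi, uniformization g o G (leaf F (foot x)) pi -> exists A', [/\ G A', A' <> 1 & A' <> - 1]) ->
  exists a b c d : R, [/\ a * d - b * c = 1, act x a b c d = x & 0 < `|b| + `|c| + `|a - d|].
Proof.
move=> nt; have [G [pi [A [u dA fA]]]] := frame_at x; have sg := uniformization_group u.
have [A' [GA' n1 nN1]] := nt G pi u.
pose B := A^-1 * A' * A; have uA := unit_det dA.
have dB : \det B = 1 by rewrite !det_mulmx (det_inv1 dA) (surface_group_det sg GA') dA !mulr1.
exists (B 0 0), (B 0 1), (B 1 0), (B 1 1); split.
- by rewrite -det2.
- by rewrite /act -mx2_eta; exact: (stabilizer_of_group u dA fA GA').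
rewrite lt_neqAle !addr_ge0 // andbT eq_sym; apply/negP => /eqP e.
have [b0 c0 ad] : [/\ B 0 1 = 0, B 1 0 = 0 & B 0 0 = B 1 1].
  move/eqP: e; rewrite paddr_eq0 ?addr_ge0 // paddr_eq0 // !normr_eq0 subr_eq0.
  by move=> /andP[/andP[/eqP -> /eqP ->] /eqP ->].
have A'E : A' = A * B * A^-1 by rewrite /B !mulrA mulrV // mul1r mulrK.
have : (B 1 1 - 1) * (B 1 1 + 1) = 0.
  by rewrite det2 b0 c0 ad mulr0 subr0 in dB; rewrite -(subrr (1 : R)) -{3}dB; ring.
move/eqP; rewrite mulf_eq0 subr_eq0 addr_eq0 => /orP[/eqP|/eqP] d1.
  by apply: n1; rewrite A'E (mx2_eta B) b0 c0 ad d1 -mx21 mulr1 mulrV.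
by apply: nN1; rewrite A'E (mx2_eta B) b0 c0 ad d1 -mx2N1 mulrN1 mulNr mulrV.
Qed.

Lemma same_leaf_orbit (v w : unit_tangent g) : leaf F (foot v) (foot w) ->
  exists B, \det B = 1 /\ right_translation o B v = w.
Proof.
move=> Lw; have [G [pi [A [u dA fA]]]] := frame_at v; have dpi := uniformization_dev u.
have [A2 [dA2 fA2]] := frame_exists u Lw.
have dB : \det (A^-1 * A2) = 1 by rewrite det_mulmx (det_inv1 dA) dA2 mulr1.
exists (A^-1 * A2); split; first exact: dB.
apply: (right_translationP (dev_comp dpi dA) dB (iffLR (is_frameE v dpi dA) fA)).
apply: (frame_ext (dev_comp (dev_comp dpi dA) dB) _ (iffLR (is_frameE w dpi dA2) fA2)) => z Hz /=.
rewrite -(moebius_M dA dB Hz).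
by rewrite mulrA mulrV ?mul1r // unit_det.
Qed.

(** Near the foot of a vector w, the vectors with the same direction in a chart as w, normalized,
    form a continuous field; some leaf point near the foot carries such a vector close to w, and unit
    vectors tangent to one leaf lie in one orbit. *)
Lemma orbits_dense (F_minimal : minimal_lamination F) (x : unit_tangent g) (O : set (unit_tangent g)) :
  open O -> O !=set0 -> exists a b c d : R, a * d - b * c = 1 /\ O (act x a b c d).
Proof.
move=> oO [w Ow]; have [a da] := dom_cover F (foot w).
pose tau := tcoord w a; pose s (m : M) := metric g (chart a m) tau tau.
have tau0 : tau != 0.
  apply/eqP => e; have := tcoord_unit (u := w) da; rewrite -/tau e.
  have dp : chart_disk_of a (chart a (foot w)).1 by exact: chart_disk.
  by rewrite (metric_expand _ _ dp) /= !(mul0r, mulr0, addr0) => /eqP; rewrite eq_sym oner_eq0.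
have s0 m : dom a m -> 0 < s m by move=> dm; apply: metric_gt0 => //; exact: chart_disk.
pose k m := (Num.sqrt (s m))^-1.
have un m : dom a m -> metric g (chart a m) (k m *: tau) (k m *: tau) = 1.
  move=> dm; have dp : chart_disk_of a (chart a m).1 by exact: chart_disk.
  rewrite (metric_expand _ _ dp) /= /GRing.scale /=.
  rewrite (_ : _ + _ = k m ^+ 2 * s m); last by rewrite /s (metric_expand tau tau dp); ring.
  rewrite /k exprVn sqr_sqrtr ?ltW ?s0 // mulVf // gt_eqF // s0 //.
pose W (m : M) : unit_tangent g := if pselect (dom a m) is left dm
  then projT1 (cid (mk_unit_tangent dm (un m dm))) else w.
have HW m : dom a m -> foot (W m) = m /\ tcoord (W m) a = k m *: tau.
  by move=> dm; rewrite /W; case: pselect => // dm'; case: cid.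
clearbody W.
have nd : \forall m \near foot w, dom a m.
  by apply: open_nbhs_nbhs; split=> //; exact: dom_open.
have cc : (fun m : M => chart a m) @ foot w --> chart a (foot w) := chart_continuous da.
have cs : s @ foot w --> s (foot w).
  apply: (cvg_app (h := fun q => metric g q tau tau) _ cc).
  by apply: metric_coef_cvg; [exact: chart_disk|exact: cvg_id].
have ck : k @ foot w --> (1 : R).
  have s1 : s (foot w) = 1 by exact: tcoord_unit.
  rewrite -(invr1 R) -(sqrtr1 R) -s1; apply: cvgV.
    by rewrite s1 sqrtr1 oner_neq0.
  exact: (cvg_app (@sqrt_continuous R _) cs).
have cW : W @ foot w --> w.
  apply: (unit_tangent_cvg (a := a) da).
  - by apply: filterS nd => m dm; rewrite (HW m dm).1.
  - apply: (cvg_near_eq cc erefl); apply: filterS nd => m dm; exact: (congr1 (chart a) (HW m dm).1).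
  - have h : (fun m => k m *: tau) @ foot w --> (1 : R) *: tau by apply: cvgZr_tmp; exact: ck.
    apply: (cvg_near_eq h); first by rewrite scale1r.
    by apply: filterS nd => m dm; exact: (HW m dm).2.
have nO : \forall m \near foot w, O (W m) /\ dom a m.
  by apply: filterI => //; apply: cW; apply: open_nbhs_nbhs.
have [m [/interior_subset [Om dm] Lm]] : (interior [set m | O (W m) /\ dom a m] `&` leaf F (foot x)) !=set0.
  apply: (F_minimal (foot x)); last exact: open_interior.
  by exists (foot w).
have [B [dB e]] := @same_leaf_orbit x (W m) (eq_ind_r _ Lm (HW m dm).1).
exists (B 0 0), (B 0 1), (B 1 0), (B 1 1); split; first by rewrite -det2.
by rewrite /act -mx2_eta e.
Qed.

(** * Leaves with trivial fundamental group *)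

Lemma cramer2 (p1 p2 q1 q2 x1 x2 : R) : p1 * q2 - q1 * p2 != 0 ->
  x1 * p1 + x2 * p2 = 0 -> x1 * q1 + x2 * q2 = 0 -> x1 = 0 /\ x2 = 0.
Proof.
move=> k0 hp hq; split; apply: (mulIf k0); rewrite mul0r.
  transitivity ((x1 * p1 + x2 * p2) * q2 - (x1 * q1 + x2 * q2) * p2); first by ring.
  by rewrite hp hq !mul0r subrr.
transitivity ((x1 * q1 + x2 * q2) * p1 - (x1 * p1 + x2 * p2) * q1); first by ring.
by rewrite hp hq !mul0r subrr.
Qed.

Lemma dev_nondegenerate phi a z (x : plane R) : developing phi -> H z -> dom a (phi z) ->
  (forall v, x.1 * ('D_v (coord a phi) z).1 + x.2 * ('D_v (coord a phi) z).2 = 0) -> x = 0.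
Proof.
move=> dphi Hz da hx.
pose p := chart a (phi z); pose A := metric g p e1 e1; pose B := metric g p e1 e2.
pose C := metric g p e2 e2.
have dp : chart_disk_of a p.1 by exact: chart_disk.
pose E u := 'D_u (coord a phi) z.
have h u w : A * ((E u).1 * (E w).1) + B * ((E u).1 * (E w).2 + (E u).2 * (E w).1) +
    C * ((E u).2 * (E w).2) = (u.1 * w.1 + u.2 * w.2) / z.2 ^+ 2.
  have := dev_isom dphi Hz da u w.
  by rewrite (metric_expand _ _ dp).
have h11 := h e1 e1; have h12 := h e1 e2; have h22 := h e2 e2.
rewrite /= !(mulr1, mulr0, mul0r, addr0, add0r) in h11 h12 h22.
have x1 := hx e1. have x2 := hx e2.
rewrite -/(E e1) in x1. rewrite -/(E e2) in x2.
move: (E e1) (E e2) h11 h12 h22 x1 x2 => [p1 p2] [q1 q2] /= h11 h12 h22 x1 x2.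
pose Y := z.2 ^+ 2; have Y0 : Y != 0 by rewrite sqrf_eq0 gt_eqF.
have g11 : (A * Y) * (p1 * p1) + (B * Y) * (p1 * p2 + p2 * p1) + (C * Y) * (p2 * p2) = 1.
  apply: (etrans _ (divff Y0)); rewrite -[Y^-1]mul1r -h11; ring.
have g12 : (A * Y) * (p1 * q1) + (B * Y) * (p1 * q2 + p2 * q1) + (C * Y) * (p2 * q2) = 0.
  by rewrite -(mulr0 Y) -h12; ring.
have g22 : (A * Y) * (q1 * q1) + (B * Y) * (q1 * q2 + q2 * q1) + (C * Y) * (q2 * q2) = 1.
  apply: (etrans _ (divff Y0)); rewrite -[Y^-1]mul1r -h22; ring.
have [kk _ _] := orthonormal_solve g11 g12 g22.
have k0 : p1 * q2 - q1 * p2 != 0.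
  by apply/eqP => e; move: kk; rewrite e expr0n mul0r => /eqP; rewrite eq_sym oner_eq0.
have [y1 y2] := cramer2 k0 x1 x2.
by rewrite [LHS]surjective_pairing y1 y2.
Qed.

(** This is [local_open] in a chart, on a square contained in one plaque. *)
Lemma dev_open phi z (U : set (plane R)) : developing phi ->
  (forall z w, H z -> H w -> phi z = phi w -> z = w) -> H z -> nbhs z U ->
  nbhs (phi z) [set m | exists w, [/\ H w, U w & phi w = m]].
Proof.
move=> dphi inj Hz nU; have [a da] := dom_cover F (phi z : M).
have [r1 /= r10 Hr1] := iffLR (nbhs_normP _ _) (filterI nU (dev_near dphi Hz da (@openT _) I)).
pose r := r1 / 2; have r0 : 0 < r by rewrite divr_gt0.
have rr : r < r1 by rewrite ltr_pdivrMr // ltr_pMr // ltr1n.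
have loc w : `|w - z| <= r -> U w /\ [/\ H w, dom a (phi w) & (chart a (phi w)).2 = (chart a (phi z)).2].
  move=> wr; have [|u [h1 h2 h3 _]] := Hr1 w; last by split.
  by rewrite /ball_ /= distrC (le_lt_trans wr).
have key w m : `|w - z| <= r -> dom a m -> (chart a m).2 = (chart a (phi z)).2 -> coord a phi w = (chart a m).1 -> phi w = m.
  move=> /loc [_ [Hw dw tw]] dm tm e.
  have ee : chart a (phi w) = chart a m by rewrite [LHS]surjective_pairing [RHS]surjective_pairing tw tm -e.
  by rewrite -[LHS](chartK dw) ee chartK.
have n : nbhs (coord a phi z) [set x | exists2 w, `|w - z| <= r & coord a phi w = x].
  apply: local_open => //.
  - by move=> w /loc [_ [Hw dw _]]; exact: (dev_diff dphi Hw dw).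
  - by move=> w x /loc [_ [Hw dw _]]; exact: dev_nondegenerate.
  - move=> w wr e; have wr' : `|w - z| <= r by rewrite wr.
    have [_ [Hw _ _]] := loc w wr'.
    have wz : w = z by apply: (inj _ _ Hw Hz); exact: (key w (phi z) wr' da erefl e).
    by move: wr; rewrite wz subrr normr0 => /eqP; rewrite eq_sym gt_eqF.
pose W := interior [set x | exists2 w, `|w - z| <= r & coord a phi w = x].
have oP := @plaque_open a (chart a (phi z)).2 W (@open_interior _ _).
have nP : nbhs (phi z) [set m : leaf_space F | [/\ dom a m, (chart a m).2 = (chart a (phi z)).2 & W (chart a m).1]].
  by apply: open_nbhs_nbhs; split=> //; split.
apply: filterS nP => m [dm tm /interior_subset [w wr e]].
have [Uw [Hw _ _]] := loc w wr.
by exists w; split=> //; exact: (key w m wr dm tm e).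
Qed.

(** A loop is lifted by the inverse map, which is continuous by [dev_open], and contracted in H along
    straight segments towards its base point. *)
Lemma injective_uniformization_simply_connected L phi : developing phi ->
  (forall z w, H z -> H w -> phi z = phi w -> z = w) -> phi @` H = L -> simply_connected R L.
Proof.
move=> dphi inj im.
have cphi (T : topologicalType) (A : set T) (f : T -> plane R) : (forall t, A t -> H (f t)) ->
    {within A, continuous f} -> {within A, continuous (fun t => phi (f t))}.
  move=> Hf /subspace_continuousP cf; apply/subspace_continuousP => t At.
  exact: (cvg_app (dev_cont dphi (Hf t At)) (cf t At)).
split.
  move=> x y; rewrite -im => -[z Hz <-] [w Hw <-].
  exists (fun s : R => phi (z + s *: (w - z))); split.
  - have h1 (s : R) : `[0, 1]%classic s -> H (z + s *: (w - z)).
      by rewrite /= in_itv /=; exact: segment_H.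
    have h2 : {within `[0, 1], continuous (fun s : R => z + s *: (w - z))}.
      apply: continuous_subspaceT => s.
      by apply: cvgD; [exact: cvg_cst|apply: cvgZr_tmp; exact: cvg_id].
    have := cphi _ _ _ h1 h2; exact.
  - move=> m [s /=]; rewrite in_itv /= => s01 <-.
    by exists (z + s *: (w - z)) => //; exact: segment_H.
  - by rewrite scale0r addr0.
  - by rewrite scale1r addrC subrK.
move=> c cc cL c01.
have lift s : s \in `[0, 1] -> exists2 z, H z & phi z = c s.
  move=> s01; have : L (c s) by apply: cL; exists s.
  by rewrite -im => -[z Hz e]; exists z.
pose k (s : R) : plane R := if pselect (s \in `[0, 1]) is left s01 then projT1 (cid2 (lift s s01)) else base.
have kP s : s \in `[0, 1] -> H (k s) /\ phi (k s) = c s.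
  by move=> s01; rewrite /k; case: pselect => // s01'; case: cid2.
clearbody k.
have ck : {within `[0, 1], continuous k}.
  apply/subspace_continuousP => s s01 U nU; have [Hs es] := kP s s01.
  have n := dev_open dphi inj Hs nU; rewrite es in n.
  have n2 := iffLR (subspace_continuousP _ _) cc s s01 _ n.
  have n3 : \forall t \near s, t \in `[0, 1] -> exists w, [/\ H w, U w & phi w = c t] by exact: n2.
  suff h : \forall t \near s, t \in `[0, 1] -> U (k t) by exact: h.
  apply: filterS n3 => t ht t01; have [w [Hw Uw ew]] := ht t01.
  have [Ht et] := kP t t01.
  by rewrite (inj _ _ Ht Hw) // et.
have z01 : (0 : R) \in `[0, 1] by rewrite in_itv /= lexx ler01.
have o01 : (1 : R) \in `[0, 1] by rewrite in_itv /= lexx ler01.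
have [H0 k0] := kP 0 z01; have [H1 k1] := kP 1 o01.
have k01 : k 1 = k 0 by apply: inj => //; rewrite k0 k1.
exists (fun st => phi (k st.1 + st.2 *: (k 0 - k st.1))); split.
- have h1 (st : R * R) : (`[0, 1] `*` `[0, 1])%classic st -> H (k st.1 + st.2 *: (k 0 - k st.1)).
    by case: st => s t [/= s01 t01]; apply: segment_H => //; have [] := kP s s01.
  have h2 : {within `[0, 1] `*` `[0, 1], continuous (fun st : R * R => k st.1 + st.2 *: (k 0 - k st.1))}.
    apply/subspace_continuousP => -[s t] [/= s01 t01].
    have c1 : (fun st : R * R => k st.1) @ within (`[0, 1] `*` `[0, 1]) (nbhs (s, t)) --> k s.
      have h := iffLR (subspace_continuousP _ _) ck s s01.
      move=> U nU; have n : \forall s' \near s, s' \in `[0, 1] -> U (k s') by exact: (h U nU).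
      have c1 : (fun st : R * R => st.1) @ nbhs (s, t) --> s by exact: cvg_fst.
      suff n' : \forall st \near (s, t), (`[0, 1] `*` `[0, 1])%classic st -> U (k st.1) by exact: n'.
      have n2 : \forall st \near (s, t), st.1 \in `[0, 1] -> U (k st.1) by exact: (c1 _ n).
      by apply: filterS n2 => -[s' t'] /= h' [s'01 _]; exact: h'.
    have c2 : (fun st : R * R => st.2) @ within (`[0, 1] `*` `[0, 1]) (nbhs (s, t)) --> t.
      by apply: cvg_within_filter; exact: cvg_snd.
    have c3 : (fun st : R * R => k 0 - k st.1) @ within (`[0, 1] `*` `[0, 1]) (nbhs (s, t)) --> k 0 - k s.
      by apply: cvgB; [exact: cvg_cst|exact: c1].
    by apply: cvgD; [exact: c1|exact: (cvgZ c2 c3)].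
  have := cphi _ _ _ h1 h2; exact.
- move=> m [[s t] /= [s01 t01] <-].
  have [Hs _] := kP s s01; rewrite -im; exists (k s + t *: (k 0 - k s)) => //.
  by apply: segment_H.
- move=> s s01; have [Hs es] := kP s s01; rewrite /= scale0r addr0 es; split=> //.
  by rewrite scale1r addrC subrK.
- move=> t t01; rewrite /= k01 subrr scaler0 addr0 k0; split=> //.
Qed.

Lemma surface_group_nontrivial x G pi : ~ simply_connected R (leaf F x) ->
  uniformization g o G (leaf F x) pi -> exists A, [/\ G A, A <> 1 & A <> - 1].
Proof.
move=> nsc u; apply: contrapT => triv; apply: nsc.
apply: (injective_uniformization_simply_connected (uniformization_dev u)); last exact: uniformization_image u.
move=> z w Hz Hw /(uniformization_fibers u Hz Hw) [A GA ->].
have [->|n1] := pselect (A = 1); first by rewrite moebius_1.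
have [->|nN1] := pselect (A = - 1); first by rewrite moebius_N moebius_1.
by case: triv; exists A.
Qed.

End Lamination.

(** * Minimality *)

Theorem theorem1 (R : realType) (M : metricType R) (F : lamination R M)
    (g : leaf_metric F) (o : leaf_orientation F)
    (M_compact : compact [set: M])
    (F_hyperbolic : hyperbolic_leaves g o)
    (F_minimal : minimal_lamination F)
    (F_nsc : forall x : M, ~ simply_connected R (leaf F x)) :
  forall v : unit_tangent g, dense (horocycle_orbit o v).
Proof.
move=> v W W0 oW.
have nontriv (x : unit_tangent g) : exists a b c d : R,
    [/\ a * d - b * c = 1, act o x a b c d = x & 0 < `|b| + `|c| + `|a - d|].
  by apply: (stab_nontrivial F_hyperbolic) => G pi; exact: surface_group_nontrivial.
have [s Ws] := horocycle_orbits_dense (unit_tangent_compact M_compact) (@unit_tangent_hausdorff _ _ _ g)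
  (act1 F_hyperbolic) (actN1 F_hyperbolic) (actM F_hyperbolic) (@act_cvg _ _ _ _ _ F_hyperbolic)
  (stab_discrete F_hyperbolic) nontriv (orbits_dense F_hyperbolic F_minimal) v oW W0.
exists (act o v 1 s 0 1); split; first exact: Ws.
have E : 1%:M + s *: delta_mx 0 1 = mx2 1 s 0 1 :> 'M[R]_2.
  apply/matrixP => i j; rewrite !mxE.
  case: (unliftP 0 i) => [i' ->|->]; case: (unliftP 0 j) => [j' ->|->] /=;
    by rewrite ?(ord1 i') ?(ord1 j') /= ?(mulr0, mulr1, addr0, add0r).
exists s; first exact: Logic.I.
exact: (congr1 (fun B => right_translation o B v) E).
Qed.
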